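(* Let $n\ge1$, $\sigma\in[0,1)$, $s\ge0$ and $1\le p\le2\le q\le\infty$. Assume $(|D|^2u_0,u_1,\theta_0)\in\mathcal{S}(\mathbb{R}^n)\times\mathcal{S}(\mathbb{R}^n)\times\mathcal{S}(\mathbb{R}^n)$. Let $w^{(0)}$ be the solution of the system (S) and $\tilde w$ the solution of the reference system (R) given in the context. Then, for all $t\ge0$, $$\left\|\chi_{\mathrm{int}}(D)\mathcal{F}^{-1}_{\xi\to x}\left(w^{(0)}-T_0T_1T_{1\frac12}\tilde w\right)(t,\cdot)\right\|_{\dot H^s_q(\mathbb{R}^n)}\lesssim(1+t)^{-\frac{s}{4-2\sigma}-\frac{n}{4-2\sigma}\left(\frac1p-\frac1q\right)-\frac{1-\sigma}{2-\sigma}}\left\|\left(|D|^2u_0,u_1,\theta_0\right)\right\|_{\left(L^p(\mathbb{R}^n)\right)^3}.$$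
   Context: System (S): $$w^{(0)}_t+\left(|\xi|^2A_0+|\xi|^{2\sigma}A_1\right)w^{(0)}=0,\quad t>0,\ \xi\in\mathbb{R}^n,\qquad w^{(0)}(0,\xi)=w^{(0)}_0(\xi):=\left(\hat u_1+|\xi|^2\hat u_0,\;\hat u_1-|\xi|^2\hat u_0,\;\hat\theta_0\right)^{\mathrm T},$$ $$A_0=\tfrac12\begin{pmatrix}0&-2&-2\\2&0&-2\\1&1&2\end{pmatrix},\qquad A_1=\tfrac12\begin{pmatrix}1&1&0\\1&1&0\\0&0&0\end{pmatrix}.$$ It is the Fourier transform in $x$ of the thermoelastic plate problem $u_{tt}+\Delta^2u+\Delta\theta+(-\Delta)^\sigma u_t=0$, $\theta_t-\Delta\theta-\Delta u_t=0$, $(u,u_t,\theta)(0,\cdot)=(u_0,u_1,\theta_0)$, with $w^{(0)}=(\hat u_t+|\xi|^2\hat u,\hat u_t-|\xi|^2\hat u,\hat\theta)^{\mathrm T}$. Matrices: $$T_0=\begin{pmatrix}-1&0&1\\1&0&1\\0&1&0\end{pmatrix},\quad T_1=I_3+|\xi|^{2-2\sigma}\begin{pmatrix}0&0&1\\0&0&1\\1&1&0\end{pmatrix},\quad T_{1\frac12}=I_3+|\xi|^{4-4\sigma}\begin{pmatrix}0&0&0\\0&0&1\\0&1&0\end{pmatrix}$$ (invertible for small $|\xi|$). Reference system (R): $$\tilde w_t+\mathrm{diag}\left(|\xi|^{4-2\sigma},|\xi|^2,|\xi|^{2\sigma}\right)\tilde w=0,\qquad\tilde w(0,\xi)=T_{1\frac12}^{-1}T_1^{-1}T_0^{-1}w^{(0)}_0(\xi).$$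 $\chi_{\mathrm{int}}\in\mathcal{C}^\infty(\mathbb{R}^n)$ is a cut-off function with values in $[0,1]$ supported in $\{|\xi|\le\varepsilon\}$, $0<\varepsilon\ll1$ fixed sufficiently small, equal to $1$ for $|\xi|\le\varepsilon/2$; $\chi_{\mathrm{int}}(D)$ is the Fourier multiplier with symbol $\chi_{\mathrm{int}}$. $|D|^s$ has symbol $|\xi|^s$ and $\|f\|_{\dot H^s_q}=\||D|^sf\|_{L^q}$ (also for $q=\infty$). $\mathcal{S}(\mathbb{R}^n)$ is the Schwartz space. $f\lesssim g$ means $f\le Cg$ with a constant $C>0$ independent of $t$ and of the initial data. *)

(* Defs.v *)
From HB Require Import structures.
From mathcomp Require Import all_boot all_order all_algebra.
From mathcomp Require Import all_classical all_reals all_analysis.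
From mathcomp.real_closed Require Import complex.

Set Implicit Arguments.
Unset Strict Implicit.
Unset Printing Implicit Defensive.

Import Order.TTheory GRing.Theory Num.Theory.
Import numFieldNormedType.Exports.
Local Open Scope classical_set_scope.
Local Open Scope ring_scope.

(* Lebesgue measure on R^n: the iterated product of the one-dimensional one,
   transported along R * R^n ~ R^(n+1). *)
Section lebesgue_measure_tuple.
Context (R : realType).
Local Notation rT := (measurableTypeR R).

Definition tcons n (x : rT * n.-tuple rT) : n.+1.-tuple rT :=
  [the n.+1.-tuple rT of x.1 :: x.2].

Definition tsplit n (x : n.+1.-tuple rT) : rT * n.-tuple rT :=
  (tnth x ord0, [tuple of behead x]).

Lemma tconsK n : cancel (@tcons n) (@tsplit n).
Proof. by case=> x y; congr pair; apply/val_inj. Qed.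

Lemma measurable_tcons n : measurable_fun setT (@tcons n).
Proof. exact: measurable_cons. Qed.

Lemma measurable_tsplit n : measurable_fun setT (@tsplit n).
Proof.
apply: measurable_fun_pair; first exact: measurable_tnth.
exact: measurable_behead.
Qed.

Section step.
Context n (m : {sigma_finite_measure set (n.-tuple rT) -> \bar R}).

Local Notation mu :=
  ((lebesgue_measure \x m)%E :
     {measure set (rT * n.-tuple rT)%type -> \bar R}).

Definition lebesgue_tcons : set (n.+1.-tuple rT) -> \bar R :=
  pushforward mu (@tcons n).

Let mtcons A : measurable A -> measurable (@tcons n @^-1` A).
Proof. by move=> mA; rewrite -[X in measurable X]setTI; exact: measurable_tcons. Qed.

Let lebesgue_tcons0 : lebesgue_tcons set0 = 0%E.
Proof. by rewrite /lebesgue_tcons/pushforward preimage_set0 measure0. Qed.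

Let lebesgue_tcons_ge0 A : (0 <= lebesgue_tcons A)%E.
Proof. by rewrite /lebesgue_tcons/pushforward measure_ge0. Qed.

Let lebesgue_tcons_sigma_additive : semi_sigma_additive lebesgue_tcons.
Proof.
move=> F mF tF mUF; rewrite /lebesgue_tcons /pushforward preimage_bigcup.
apply: measure_semi_sigma_additive.
- by move=> k; exact: mtcons.
- apply/trivIsetP => /= i j _ _ ij; rewrite -preimage_setI.
  by move/trivIsetP : tF => /(_ _ _ _ _ ij) ->//; rewrite preimage_set0.
- by rewrite -preimage_bigcup; exact: mtcons.
Qed.

HB.instance Definition _ := isMeasure.Build _ _ _ lebesgue_tcons
  lebesgue_tcons0 lebesgue_tcons_ge0 lebesgue_tcons_sigma_additive.

Let lebesgue_tcons_sigma_finite : sigma_finite setT lebesgue_tcons.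
Proof.
have /sigma_finiteP[F [FT ndF Foo]] := sigma_finiteT (@lebesgue_measure R).
have /sigma_finiteP[G [GT ndG Goo]] := sigma_finiteT m.
exists (fun k => @tsplit n @^-1` (F k `*` G k)) => [|k].
  rewrite -preimage_bigcup -[LHS](@preimage_setT _ _ (@tsplit n)).
  congr (_ @^-1` _); apply/esym/seteqP; split => // -[x y] _.
  have [i _ Fix] : (\bigcup_i F i) x by rewrite -FT.
  have [j _ Gjy] : (\bigcup_i G i) y by rewrite -GT.
  exists (maxn i j) => //; split => /=.
  - by move: x Fix; apply/subsetPset/ndF/leq_maxl.
  - by move: y Gjy; apply/subsetPset/ndG/leq_maxr.
have [mF Fk] := Foo k; have [mG Gk] := Goo k; split.
  rewrite -[X in measurable X]setTI; apply: measurable_tsplit => //.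
  exact: measurableX.
rewrite /lebesgue_tcons /pushforward -comp_preimage.
have -> : @tsplit n \o @tcons n = id by apply/funext => x; exact: tconsK.
rewrite preimage_id /= product_measure1E//.
by rewrite lte_mul_pinfty// ge0_fin_numE.
Qed.

HB.instance Definition _ := Measure_isSigmaFinite.Build _ _ _ lebesgue_tcons
  lebesgue_tcons_sigma_finite.

End step.

Fixpoint lebesgue_tuple n :
    {sigma_finite_measure set (n.-tuple rT) -> \bar R} :=
  if n is n'.+1 then lebesgue_tcons (lebesgue_tuple n') else \d_ [tuple].

End lebesgue_measure_tuple.

Local Notation normc := ComplexField.Normc.normc.

Section complex_functions.
Context (R : realType).
Local Notation C := R[i].

(* The only scalar field of R[i] with a normed module structure is R[i]
   itself, so that real differentiation is done on the parts. *)
Definition is_cderive (f : R -> C) (t : R) (df : C) : Prop :=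
  is_derive t 1 (fun s => complex.Re (f s)) (complex.Re df) /\
  is_derive t 1 (fun s => complex.Im (f s)) (complex.Im df).

Definition right_ccontinuous (f : R -> C) (t : R) : Prop :=
  complex.Re (f s) @[s --> t^'+] --> complex.Re (f t) /\
  complex.Im (f s) @[s --> t^'+] --> complex.Im (f t).

Definition expi (theta : R) : C := Complex (cos theta) (sin theta).

Definition complexmx m k (A : 'M[R]_(m, k)) : 'M[C]_(m, k) :=
  map_mx (fun a => a%:C%C) A.

(* y' + M y = 0 for t > 0; continuity at 0 ties y to its value y0 there. *)
Definition solves_linear_ode m (M : 'M[R]_m) (y0 : 'cV[C]_m)
    (y : R -> 'cV[C]_m) : Prop :=
  [/\ y 0 = y0,
      forall i, right_ccontinuous (fun t => y t i 0) 0 &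
      forall t, 0 < t -> forall i,
        is_cderive (fun s => y s i 0) t ((- (complexmx M *m y t)) i 0)].

End complex_functions.

Section euclidean_space.
Context (R : realType) (n : nat).
Local Notation C := R[i].
Local Notation V := 'rV[R]_n.
Implicit Types (x xi : V) (f g : V -> C).

Definition dot (x y : V) : R := \sum_(i < n) x 0 i * y 0 i.

(* `|x| is the supremum norm on 'rV[R]_n. *)
Definition enorm (x : V) : R := Num.sqrt (dot x x).

(* The library puts the differential structure on 'rV[R]_n and the
   measurable structure on n.-tuple R. *)
Definition row_of_tuple (z : n.-tuple (measurableTypeR R)) : V :=
  \row_i tnth z i.

Definition cintegral f : C :=
  Complex (\int[@lebesgue_tuple R n]_z complex.Re (f (row_of_tuple z)))
          (\int[@lebesgue_tuple R n]_z complex.Im (f (row_of_tuple z))).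

Definition Lpnorm (p : \bar R) f : \bar R :=
  Lnorm (@lebesgue_tuple R n) p
    (fun z => (normc (f (row_of_tuple z)))%:E).

Definition fourier f xi : C :=
  cintegral (fun x => expi (- dot x xi) * f x).

Definition inv_fourier g x : C :=
  (((2 * pi) ^- n)%:C)%C * cintegral (fun xi => expi (dot x xi) * g xi).

Definition pderiv (l : seq 'I_n) (f : V -> R) : V -> R :=
  foldr (fun i (g : V -> R) => 'D_(delta_mx 0 i) g) f l.

Definition cpderiv (l : seq 'I_n) f x : C :=
  Complex (pderiv l (fun y => complex.Re (f y)) x)
          (pderiv l (fun y => complex.Im (f y)) x).

Definition smooth (f : V -> R) : Prop :=
  forall l x, differentiable (pderiv l f) x.

(* The Schwartz seminorm of index (k, N) of f is at most M. *)
Definition seminorm_le (k N : nat) (M : R) f : Prop :=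
  forall l x, (size l <= N)%N -> (1 + enorm x) ^+ k * normc (cpderiv l f x) <= M.

Definition schwartz f : Prop :=
  [/\ smooth (fun x => complex.Re (f x)), smooth (fun x => complex.Im (f x)) &
      forall k N, exists M, seminorm_le k N M f].

(* Values of u outside the Schwartz space are irrelevant. *)
Definition tempered_distribution (u : (V -> C) -> C) : Prop :=
  (forall (a : C) f g, schwartz f -> schwartz g ->
     u (fun x => a * f x + g x) = a * u f + u g) /\
  exists K k N, forall f M, schwartz f -> seminorm_le k N M f ->
    normc (u f) <= K * M.

Definition dist_fourier (u : (V -> C) -> C) : (V -> C) -> C :=
  fun f => u (fourier f).

Definition dist_mul (m : V -> R) (u : (V -> C) -> C) : (V -> C) -> C :=
  fun f => u (fun x => ((m x)%:C)%C * f x).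

Definition dist_represented_by (u : (V -> C) -> C) (g : V -> C) : Prop :=
  forall f, schwartz f -> u f = cintegral (fun x => g x * f x).

(* g = |D|^2 u : the distribution |xi|^2 u^ is the function g^. *)
Definition is_D2 (u : (V -> C) -> C) (g : V -> C) : Prop :=
  dist_represented_by (dist_mul (fun xi => enorm xi ^+ 2) (dist_fourier u))
    (fourier g).

Definition cutoff (eps : R) (chi : V -> R) : Prop :=
  [/\ smooth chi, forall xi, 0 <= chi xi <= 1,
      forall xi, eps < enorm xi -> chi xi = 0 &
      forall xi, enorm xi <= eps / 2 -> chi xi = 1].

(* The \dot H^s_q norm of chi(D) F^{-1} g: |D|^s and chi(D) act as
   multiplications on the Fourier side, so that F^{-1} is applied to
   |xi|^s chi g, which is compactly supported; g need not be integrable.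
   For s = 0 the factor |xi|^s is 1 also at xi = 0. *)
Definition hnorm_cut (s : R) (q : \bar R) (chi : V -> R) g : \bar R :=
  Lpnorm q (inv_fourier (fun xi => ((enorm xi `^ s * chi xi)%:C)%C * g xi)).

Definition hnorm_cut_vec m (s : R) (q : \bar R) (chi : V -> R)
    (v : V -> 'cV[C]_m) : \bar R :=
  (\sum_(i < m) hnorm_cut s q chi (fun xi => v xi i 0%R))%E.

End euclidean_space.

Section thermoelastic_plate.
Context (R : realType) (n : nat) (sigma : R).
Local Notation C := R[i].
Local Notation V := 'rV[R]_n.
Implicit Type xi : V.

Definition mx3 (rows : seq (seq R)) : 'M[R]_3 :=
  \matrix_(i, j) nth 0 (nth [::] rows i) j.

Definition A0 : 'M[R]_3 := 2^-1 *: mx3 [:: [:: 0; -2; -2];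
                                          [:: 2;  0; -2];
                                          [:: 1;  1;  2]].

Definition A1 : 'M[R]_3 := 2^-1 *: mx3 [:: [:: 1; 1; 0];
                                          [:: 1; 1; 0];
                                          [:: 0; 0; 0]].

Definition T0 : 'M[R]_3 := mx3 [:: [:: -1; 0; 1];
                                  [::  1; 0; 1];
                                  [::  0; 1; 0]].

Definition T1 xi : 'M[R]_3 :=
  1%:M + enorm xi `^ (2 - 2 * sigma) *: mx3 [:: [:: 0; 0; 1];
                                               [:: 0; 0; 1];
                                               [:: 1; 1; 0]].

Definition T1half xi : 'M[R]_3 :=
  1%:M + enorm xi `^ (4 - 4 * sigma) *: mx3 [:: [:: 0; 0; 0];
                                               [:: 0; 0; 1];
                                               [:: 0; 1; 0]].

Definition symbolS xi : 'M[R]_3 :=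
  enorm xi ^+ 2 *: A0 + enorm xi `^ (2 * sigma) *: A1.

Definition symbolR xi : 'M[R]_3 :=
  mx3 [:: [:: enorm xi `^ (4 - 2 * sigma); 0; 0];
          [:: 0; enorm xi ^+ 2; 0];
          [:: 0; 0; enorm xi `^ (2 * sigma)]].

(* D2u0 = |D|^2 u_0, whose Fourier transform is |xi|^2 \hat u_0. *)
Definition initS (D2u0 u1 theta0 : V -> C) xi : 'cV[C]_3 :=
  \col_i nth 0 [:: fourier u1 xi + fourier D2u0 xi;
                   fourier u1 xi - fourier D2u0 xi;
                   fourier theta0 xi] i.

(* T1 and T1half are guaranteed to be invertible for small xi only; where they are
   not, invmx is a dummy value, which the cut-off removes. *)
Definition initR (D2u0 u1 theta0 : V -> C) xi : 'cV[C]_3 :=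
  complexmx (invmx (T1half xi) *m invmx (T1 xi) *m invmx T0)
    *m initS D2u0 u1 theta0 xi.

Definition solutionS (D2u0 u1 theta0 : V -> C) (w : R -> V -> 'cV[C]_3) : Prop :=
  forall xi,
    solves_linear_ode (symbolS xi) (initS D2u0 u1 theta0 xi) (fun t => w t xi).

Definition solutionR (D2u0 u1 theta0 : V -> C) (w : R -> V -> 'cV[C]_3) : Prop :=
  forall xi,
    solves_linear_ode (symbolR xi) (initR D2u0 u1 theta0 xi) (fun t => w t xi).

End thermoelastic_plate.

(* Main.v *)
(* Put r = |xi|, d = r^(2 - 2 sigma), kappa = 4 - 2 sigma.  The difference
   v = w - T0 T1 T1half wt is at most a multiple of d exp(- r^kappa t / 8) |w(0)| when
   d <= 1/4: in the variables of T0, and after subtraction of an approximation of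
   T1 T1half wt to first order in d, the energy of the remainder plus a cross term
   and 32 d^2 |wt|^2 is a Lyapunov function with dissipation rate r^kappa / 4.
   Multiplication by the radial weight m = r^a exp(- c r^kappa t) maps the Fourier
   transform of an L^p function, 1 <= p <= 2, to L^2: writing N for the squared norm of
   m g^, one has N = int g H with H the transform of m^2 g^, and H is estimated by
   Cauchy-Schwarz in L^oo and by the Bessel inequality in L^2, hence in the dual of L^p
   by interpolation, in each case by the square root of N.
   Half of the weight then gives L^1, hence L^oo after inversion; the Bessel inequality
   gives L^2 after inversion; interpolation gives L^q.  The Bessel inequality itself is
   only needed for functions supported in a cube; on the line it follows from the decay
   of the cosine transform of the weight (1 - (x/N)^2)_+, and it is tensorised. *)

Require Import Defs.
From mathcomp Require Import all_boot all_order all_algebra.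
From mathcomp Require Import all_classical all_reals all_analysis.
From mathcomp.real_closed Require Import complex.
From mathcomp Require Import measurable_realfun ess_sup_inf.
From mathcomp Require Import ring lra.
Import Order.TTheory GRing.Theory Num.Theory.
Import numFieldNormedType.Exports.
Local Open Scope ring_scope.

Set Implicit Arguments.
Unset Strict Implicit.
Unset Printing Implicit Defensive.

(** * Energy estimate for the difference of the two solutions *)

Section energy.
Context {R : realType}.

(** Under exp(- r^kappa t / 8) the radius r counts as t^(-1/kappa). The weight is used with a = s +
    2 - 2 sigma: r^s costs s/kappa, the factor d = r^(2 - 2 sigma) costs (2 - 2 sigma)/kappa = (1 -
    sigma)/(2 - sigma), which is the extra decay in the theorem, and the passage from L^p to L^q
    costs n (1/p - 1/q)/kappa. The obstacle in the energy estimate is the slowest mode: it is damped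
    only at the rate r^kappa = r^(2 sigma) d^2, so a residual of first order in d in its equation
    could not be absorbed. The approximation that is subtracted is chosen so that this equation has
    no residual at all. All matrices are real. Real and imaginary parts therefore solve the same
    real system, and everything is estimated for real functions, with cosine and sine transforms in
    place of the Fourier transform. The solutions are given for each xi separately and only through
    their differential equations. Their measurability in xi, without which the integrals over xi
    cannot be handled, is derived: at each time a solution is the limit of Taylor polynomials whose
    coefficients are measurable in xi. *)

Lemma within_continuous_derivable (g g' : R -> R) (t : R) : 0 < t ->
  (g s @[s --> (0:R)^'+] --> g 0)%classic ->
  (forall s : R, 0 < s -> s <= t -> is_derive s (1:R) g (g' s)) ->
  {within `[0, t], continuous g}%classic.
Proof.
move=> t0 g0 dg; apply: derivable_oo_LRcontinuous_within; split => //.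
  move=> x; rewrite in_itv /= => /andP[x0 /ltW xt]; have dx := dg _ x0 xt.
  exact: (@ex_derive _ _ _ _ _ _ _ dx).
apply: cvg_at_left_filter; apply/differentiable_continuous/derivable1_diffP.
by have dx := dg _ t0 (lexx t); exact: (@ex_derive _ _ _ _ _ _ _ dx).
Qed.

(** [expR (k * s) * g s] is nonincreasing on [0, t]. At 0 only right continuity is assumed, which is
    what [solves_linear_ode] provides. *)
Lemma gronwall_decay (g g' : R -> R) (k t : R) : 0 <= t ->
  (g s @[s --> (0:R)^'+] --> g 0)%classic ->
  (forall s : R, 0 < s -> s <= t -> is_derive s (1:R) g (g' s)) ->
  (forall s : R, 0 < s -> s <= t -> g' s <= - k * g s) ->
  g t <= expR (- (k * t)) * g 0.
Proof.
rewrite le_eqVlt => /predU1P[<-|t0] g0 dg gk.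
  by rewrite mulr0 oppr0 expR0 mul1r.
pose h (s : R) := expR (k * s) * g s.
have dh (s : R) : 0 < s -> s <= t -> is_derive s (1 : R) h (expR (k * s) * (k * g s + g' s)).
  move=> s0 st; have dgs := dg _ s0 st.
  have de : is_derive s (1 : R) (fun s => expR (k * s)) (expR (k * s) * k).
    have d1 : is_derive s (1 : R) (fun s => k * s) k.
      by apply: is_derive_eq; rewrite /GRing.scale /= mulr1.
    have := @is_derive1_comp R expR (fun s => k * s) s _ _ _ d1.
    by move=> /(_ _ (is_derive_expR _)) H; apply: is_derive_eq; rewrite mulrC.
  by apply: is_derive_eq; rewrite /GRing.scale /=; ring.
have hcc : h t <= h 0.
  apply: (@ler0_derive1_le_cc R h 0 t); rewrite ?in_itv /= ?lexx ?(ltW t0) //.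
  - move=> x; rewrite in_itv /= => /andP[x0 /ltW xt]; have dx := dh _ x0 xt.
    exact: (@ex_derive _ _ _ _ _ _ _ dx).
  - move=> x; rewrite in_itv /= => /andP[x0 /ltW xt].
    have dhx := dh _ x0 xt; rewrite derive1E derive_val.
    by rewrite pmulr_rle0 ?expR_gt0 // -lerBrDl sub0r -mulNr; exact: gk.
  - apply: within_continuous_derivable t0 _ dh.
    apply: cvgM => //; apply: cvg_at_right_filter.
    apply: (@cvg_comp _ _ _ (fun s => k * s) expR); last exact: continuous_expR.
    by apply: cvgMr; exact: cvg_id.
have -> : g t = expR (- (k * t)) * h t.
  by rewrite /h mulrA -expRD addNr expR0 mul1r.
rewrite ler_pM2l ?expR_gt0 //; move: hcc.
by rewrite [X in _ <= X -> _]/h mulr0 expR0 mul1r.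
Qed.

End energy.

(** * The Lyapunov function of the remainder *)

Section lyapunov.
Context {R : realType}.

(* The energy alone does not damp the first component; the cross term does. *)
Definition lyapunov (d e1 e2 e3 z1 z2 z3 : R) : R :=
  (e1 ^+ 2 + e2 ^+ 2 + e3 ^+ 2) / 2 - d / 2 * (e1 * e3)
  + 32 * d ^+ 2 * (z1 ^+ 2 + z2 ^+ 2 + z3 ^+ 2).

Lemma weighted_amgm (c x y : R) : 0 < c ->
  x * y <= c * x ^+ 2 + (4 * c)^-1 * y ^+ 2.
Proof.
move=> c0; rewrite -subr_ge0.
have -> : c * x ^+ 2 + (4 * c)^-1 * y ^+ 2 - x * y =
  c * (x - (2 * c)^-1 * y) ^+ 2 by field; rewrite gt_eqF.
by rewrite mulr_ge0 ?sqr_ge0 // ltW.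
Qed.

(** [f1], [f2], [f3] are the time derivatives of the remainder without the common factor |xi|^(2
    sigma). The energy yields - d e2^2 - e3^2, the cross term yields - d^2 e1^2 / 2, and the part in
    z yields - 64 d^2 (d^2 z1^2 + d z2^2 + z3^2). These three absorb all remaining products. *)
Lemma lyapunov_dissipation (d e1 e2 e3 z1 z2 z3 : R) : 0 <= d -> d <= 4^-1 ->
  let f1 := - (d * e3) in
  let f2 := - (d * (e2 + e3)) - (d ^+ 3 * z1 + d ^+ 2 * z2 + d ^+ 2 * z3) in
  let f3 := - (e3 - d * (e1 + e2))
            - ((d ^+ 2 - d ^+ 3) * z1 - 2 * d ^+ 2 * z2 - 2 * d ^+ 2 * z3) in
  e1 * f1 + e2 * f2 + e3 * f3 - d / 2 * (f1 * e3 + e1 * f3)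
  - 64 * d ^+ 2 * (d ^+ 2 * z1 ^+ 2 + d * z2 ^+ 2 + z3 ^+ 2)
  <= - (d ^+ 2 / 4) * lyapunov d e1 e2 e3 z1 z2 z3.
Proof.
move=> d0 d1; rewrite /lyapunov /=.
have H (k c x y : R) : 0 <= k -> 0 < c ->
    k * (x * y) <= k * (c * x ^+ 2 + (4 * c)^-1 * y ^+ 2).
  by move=> k0 c0; apply: ler_wpM2l => //; exact: weighted_amgm.
have c8 : 0 < (8^-1 : R) by lra.
have c16 : 0 < (16^-1 : R) by lra.
have c32 : 0 < (32^-1 : R) by lra.
have c4 : 0 < (4^-1 : R) by lra.
have h1 : 0 <= 1 :> R by [].
have h2 : 0 <= 2^-1 :> R by lra.
have h8 : 0 <= 8^-1 :> R by lra.
(* One weighted inequality for each surviving product. The tightest account is that of d^2 e1^2: the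
   six products charged to it use 5/16 and the right-hand side 1/8 of the 1/2 that the cross term
   supplies. *)
have i1 := H _ _ (d * e1) e3 h2 c4.
have i2 := H _ _ (- (d * e1)) (d * e2) h2 c8.
have i3 := H _ _ (- e2) (d ^+ 2 * z1) d0 c8.
have i4 := H _ _ (- e2) (d * z2) d0 c8.
have i5 := H _ _ (- e2) (d * z3) d0 c8.
have i6 := H _ _ (- e3) (d ^+ 2 * (1 - d) * z1) h1 c16.
have i7 := H _ _ e3 (2 * d ^+ 2 * z2) h1 c16.
have i8 := H _ _ e3 (2 * d ^+ 2 * z3) h1 c16.
have i9 := H _ _ (d * e1) (d ^+ 2 * (1 - d) * z1) h2 c16.
have i10 := H _ _ (- (d * e1)) (d ^+ 2 * z2) h1 c32.
have i11 := H _ _ (- (d * e1)) (d ^+ 2 * z3) h1 c32.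
have i12 := H _ _ (d * e1) (- (d ^+ 2 * e3)) h8 c4.
have M (k x : R) : 0 <= k -> 0 <= k * x ^+ 2.
  by move=> k0; rewrite mulr_ge0 ?sqr_ge0.
have p2 : 0 <= d ^+ 2 by exact: exprn_ge0.
have p3 : 0 <= d ^+ 3 by exact: exprn_ge0.
have p4 : 0 <= d ^+ 4 by exact: exprn_ge0.
have q2 : d ^+ 2 <= d / 4 by rewrite expr2; nra.
have q3 : d ^+ 3 <= d ^+ 2 / 4 by rewrite exprS; nra.
have q4 : d ^+ 4 <= d ^+ 3 / 4 by rewrite exprS; nra.
have r1 : 0 <= d ^+ 4 * (1 - (1 - d) ^+ 2).
  by rewrite mulr_ge0 // expr2; nra.
have r2 : 0 <= d ^+ 4 * (4^-1 - d) by rewrite mulr_ge0 // subr_ge0.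
have g1 := M _ e1 p2.
have g2 : 0 <= (d / 4 - d ^+ 2) * e2 ^+ 2 by apply: M; lra.
have g2' := M _ e2 p2.
have g3 : 0 <= (16^-1 - d ^+ 2) * e3 ^+ 2 by apply: M; lra.
have g3' : 0 <= (16^-1 - d ^+ 4) * e3 ^+ 2 by apply: M; lra.
have g3'' := M _ e3 h1.
have k1 := M _ z1 r1.
have k2 := M _ z1 r2.
have k3 := M _ z1 p4.
have k4 : 0 <= (d ^+ 3 / 4 - d ^+ 4) * z2 ^+ 2 by apply: M; lra.
have k5 := M _ z2 p3.
have k6 := M _ z2 p4.
have k7 : 0 <= (d ^+ 2 / 4 - d ^+ 3) * z3 ^+ 2 by apply: M; lra.
have k8 : 0 <= (d ^+ 3 / 4 - d ^+ 4) * z3 ^+ 2 by apply: M; lra.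
have k9 := M _ z3 p4.
have k10 := M _ z3 p2.
lra.
Qed.
End lyapunov.

Section plate.
Context {R : realType}.

Lemma lyapunov_lower (d e1 e2 e3 z1 z2 z3 : R) : 0 <= d -> d <= 4^-1 ->
  3 / 8 * (e1 ^+ 2 + e2 ^+ 2 + e3 ^+ 2)
  + 32 * d ^+ 2 * (z1 ^+ 2 + z2 ^+ 2 + z3 ^+ 2) <= lyapunov d e1 e2 e3 z1 z2 z3.
Proof.
move=> d0 d1; rewrite /lyapunov lerD2r.
have h : e1 * e3 <= (e1 ^+ 2 + e3 ^+ 2) / 2 by have := sqr_ge0 (e1 - e3); rewrite sqrrB; lra.
have s1 := sqr_ge0 e1; have s2 := sqr_ge0 e2; have s3 := sqr_ge0 e3.
have : d / 2 * (e1 * e3) <= d / 2 * ((e1 ^+ 2 + e3 ^+ 2) / 2).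
  by apply: ler_wpM2l => //; lra.
have : d * (e1 ^+ 2 + e3 ^+ 2) <= 4^-1 * (e1 ^+ 2 + e3 ^+ 2).
  by apply: ler_wpM2r => //; lra.
lra.
Qed.

(* In the basis given by the columns of T0, the product T1 T1half acts by the matrix
   [[1, d^3, d], [0, 1 + d^3, d + d^2], [d, d + d^2, 1 + d^3]],
   where d = |xi|^(2 - 2 sigma). *)
Definition T1T1half_col (d z1 z2 z3 : R) : R * R * R :=
  (z1 + d ^+ 3 * z2 + d * z3,
   (1 + d ^+ 3) * z2 + (d + d ^+ 2) * z3,
   d * z1 + (d + d ^+ 2) * z2 + (1 + d ^+ 3) * z3).

(** Since y is exactly the image of z at the initial time, each remainder is a combination of z with
    coefficients of order d. As [S] measures y and not z, T1 T1half also has to be inverted with a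
    uniform bound. *)
Lemma lyapunov_initial (d y1 y2 y3 z1 z2 z3 S : R) : 0 <= d -> d <= 4^-1 ->
  (y1, y2, y3) = T1T1half_col d z1 z2 z3 -> `|y1| + `|y2| + `|y3| <= S ->
  lyapunov d (y1 - z1 - d * z2 - d * z3) (y2 + d * z1 - z2 - d * z3)
    (y3 - d * z1 - d * z2 - z3) z1 z2 z3 <= 220 * d ^+ 2 * S ^+ 2.
Proof.
move=> d0 d1 [y1E y2E y3E] yS.
have q2 : d ^+ 2 <= d / 4 by rewrite expr2; nra.
have q3 : d ^+ 3 <= d ^+ 2 / 4.
  by rewrite exprS; have := sqr_ge0 d; nra.
have p2 : 0 <= d ^+ 2 by exact: exprn_ge0.
have p3 : 0 <= d ^+ 3 by exact: exprn_ge0.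
pose M := `|z1| + `|z2| + `|z3|.
have B (k c x : R) : 0 <= k -> k <= c -> - (c * `|x|) <= k * x <= c * `|x|.
  move=> k0 kc; rewrite -ler_norml normrM (ger0_norm k0); exact: ler_wpM2r.
have n1 := normr_ge0 z1; have n2 := normr_ge0 z2; have n3 := normr_ge0 z3.
(* For d <= 1/4 the matrix of T1 T1half minus the identity has absolute column sums at most 37/64,
   and 1 / (1 - 37/64) < 5/2. *)
have MS : M <= 5 / 2 * S.
  have /andP[a1 a2] := B _ (1/64) z2 p3 ltac:(lra).
  have /andP[a3 a4] := B _ (1/4) z3 d0 ltac:(lra).
  have /andP[a5 a6] := B _ (5/16) z3 (addr_ge0 d0 p2) ltac:(lra).
  have /andP[a7 a8] := B _ (1/4) z1 d0 ltac:(lra).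
  have /andP[a9 a10] := B _ (5/16) z2 (addr_ge0 d0 p2) ltac:(lra).
  have /andP[a11 a12] := B _ (1/64) z3 p3 ltac:(lra).
  have e1 : `|z1| <= `|y1| + 1/64 * `|z2| + 1/4 * `|z3|.
    rewrite ler_norml; have := ler_norm y1; have := ler_norm (- y1); rewrite normrN.
    by move=> *; apply/andP; split; lra.
  have e2 : `|z2| <= `|y2| + 1/64 * `|z2| + 5/16 * `|z3|.
    rewrite ler_norml; have := ler_norm y2; have := ler_norm (- y2); rewrite normrN.
    by move=> *; apply/andP; split; lra.
  have e3 : `|z3| <= `|y3| + 1/4 * `|z1| + 5/16 * `|z2| + 1/64 * `|z3|.
    rewrite ler_norml; have := ler_norm y3; have := ler_norm (- y3); rewrite normrN.
    by move=> *; apply/andP; split; lra.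
  rewrite /M; lra.
have M0 : 0 <= M by rewrite /M; lra.
set e1 := y1 - z1 - _ - _; set e2 := y2 + _ - _ - _; set e3 := y3 - _ - _ - _.
have Be1 : `|e1| <= d * M.
  have -> : e1 = - ((d - d ^+ 3) * z2) by rewrite /e1 y1E; ring.
  rewrite normrN normrM ger0_norm; last lra.
  apply: ler_pM => //; rewrite /M; lra.
have Be2 : `|e2| <= d * M.
  have -> : e2 = d * (z1 + d ^+ 2 * z2 + d * z3) by rewrite /e2 y2E; ring.
  rewrite normrM (ger0_norm d0); apply: ler_wpM2l => //.
  have /andP[a1 a2] := B _ 1 z2 p2 ltac:(lra).
  have /andP[a3 a4] := B _ 1 z3 d0 ltac:(lra).
  rewrite ler_norml /M; have := ler_norm z1; have := ler_norm (- z1); rewrite normrN.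
  by move=> *; apply/andP; split; lra.
have Be3 : `|e3| <= d * M.
  have -> : e3 = d * (d * z2 + d ^+ 2 * z3) by rewrite /e3 y3E; ring.
  rewrite normrM (ger0_norm d0); apply: ler_wpM2l => //.
  have /andP[a1 a2] := B _ 1 z3 p2 ltac:(lra).
  have /andP[a3 a4] := B _ 1 z2 d0 ltac:(lra).
  by rewrite ler_norml /M; apply/andP; split; lra.
have sq (x : R) : `|x| <= d * M -> x ^+ 2 <= d ^+ 2 * M ^+ 2.
  move=> h; rewrite -exprMn -[x ^+ 2]real_normK ?num_real //.
  by apply: lerXn2r => //; rewrite nnegrE ?mulr_ge0.
have s1 := sq _ Be1; have s2 := sq _ Be2; have s3 := sq _ Be3.
have s13 : - (e1 * e3) <= d ^+ 2 * M ^+ 2.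
  have := sqr_ge0 (e1 + e3); rewrite sqrrD; lra.
have s13' : - (d / 2 * (e1 * e3)) <= d / 2 * (d ^+ 2 * M ^+ 2).
  by rewrite -mulrN; apply: ler_wpM2l => //; lra.
have dM0 : 0 <= d ^+ 2 * M ^+ 2 by rewrite mulr_ge0 ?sqr_ge0.
have s13'' : d * (d ^+ 2 * M ^+ 2) <= 4^-1 * (d ^+ 2 * M ^+ 2) by apply: ler_wpM2r.
have zM : d ^+ 2 * (z1 ^+ 2 + z2 ^+ 2 + z3 ^+ 2) <= d ^+ 2 * M ^+ 2.
  apply: ler_wpM2l => //; rewrite -[z1 ^+ 2]real_normK ?num_real //.
  rewrite -[z2 ^+ 2]real_normK ?num_real // -[z3 ^+ 2]real_normK ?num_real // /M.
  by have := mulr_ge0 n1 n2; have := mulr_ge0 n1 n3; have := mulr_ge0 n2 n3; lra.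
have MS2 : d ^+ 2 * M ^+ 2 <= d ^+ 2 * ((5 / 2 * S) ^+ 2).
  apply: ler_wpM2l => //; apply: lerXn2r => //; rewrite nnegrE; lra.
(* Energy, cross term and part in z are at most 3/2, 1/8 and 32 times d^2 M^2, and (3/2 + 1/8 + 32)
   (5/2)^2 < 220. *)
rewrite /lyapunov; lra.
Qed.

(** Here b = |xi|^(2 sigma) only sets the time scale. With y1 = (w2 - w1)/2, y2 = w3, y3 = (w1 +
    w2)/2 the system reads y' = - b N y, where N = [[0, 0, d], [0, d, d], [-d, -d, 1]] has the
    eigenvalues d^2, d, 1 to leading order, those of the reference system. *)
Lemma plate_difference_decay (b d : R) (w1 w2 w3 z1 z2 z3 : R -> R) :
  0 <= b -> 0 <= d -> d <= 4^-1 ->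
  (forall f, f \in [:: w1; w2; w3; z1; z2; z3] ->
    (f s @[s --> (0:R)^'+] --> f 0)%classic) ->
  (forall t : R, 0 < t ->
    [/\ is_derive t (1:R) w1 (- (b * d * (- w2 t - w3 t) + b * ((w1 t + w2 t) / 2))),
        is_derive t (1:R) w2 (- (b * d * (w1 t - w3 t) + b * ((w1 t + w2 t) / 2))) &
        is_derive t (1:R) w3 (- (b * d * ((w1 t + w2 t) / 2 + w3 t)))]) ->
  (forall t : R, 0 < t ->
    [/\ is_derive t (1:R) z1 (- (b * d ^+ 2 * z1 t)),
        is_derive t (1:R) z2 (- (b * d * z2 t)) &
        is_derive t (1:R) z3 (- (b * z3 t))]) ->
  ((w2 0 - w1 0) / 2, w3 0, (w1 0 + w2 0) / 2)
    = T1T1half_col d (z1 0) (z2 0) (z3 0) ->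
  forall t : R, 0 <= t ->
  let u := T1T1half_col d (z1 t) (z2 t) (z3 t) in
  let B := 75 * d * expR (- (b * d ^+ 2 / 8 * t)) * (`|w1 0| + `|w2 0| + `|w3 0|) in
  [/\ `|w1 t - (- u.1.1 + u.2)| <= B, `|w2 t - (u.1.1 + u.2)| <= B &
      `|w3 t - u.1.2| <= B].
Proof.
move=> b0 d0 d1 cts dw dz init t t0.
(* The columns of [[1, d, d], [-d, 1, d], [d, d, 1]] are the eigenvectors of N to first order in d.
   The entries d and -d that couple z1 and z2 do not occur in [T1T1half_col]: they are a coupling of
   order d^2 through the third mode, divided by the distance d of the two slow eigenvalues. With
   them the equation of [e1] has no residual and the other two have residuals of order d^2. *)
pose e1 (s : R) := (w2 s - w1 s) / 2 - z1 s - d * z2 s - d * z3 s.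
pose e2 (s : R) := w3 s + d * z1 s - z2 s - d * z3 s.
pose e3 (s : R) := (w1 s + w2 s) / 2 - d * z1 s - d * z2 s - z3 s.
pose L (s : R) := lyapunov d (e1 s) (e2 s) (e3 s) (z1 s) (z2 s) (z3 s).
pose S := `|w1 0| + `|w2 0| + `|w3 0|.
have cvx f : f \in [:: w1; w2; w3; z1; z2; z3] -> (f s @[s --> (0:R)^'+] --> f 0)%classic.
  exact: cts.
have [cw1 cw2 cw3] : [/\ (w1 s @[s --> (0:R)^'+] --> w1 0)%classic,
  (w2 s @[s --> (0:R)^'+] --> w2 0)%classic & (w3 s @[s --> (0:R)^'+] --> w3 0)%classic].
  by split; apply: cvx; rewrite !in_cons eqxx ?orbT.
have [cz1 cz2 cz3] : [/\ (z1 s @[s --> (0:R)^'+] --> z1 0)%classic,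
  (z2 s @[s --> (0:R)^'+] --> z2 0)%classic & (z3 s @[s --> (0:R)^'+] --> z3 0)%classic].
  by split; apply: cvx; rewrite !in_cons eqxx ?orbT.
have ce1 : (e1 s @[s --> (0:R)^'+] --> e1 0)%classic.
  apply: cvgB; last by apply: cvgMr.
  apply: cvgB; last by apply: cvgMr.
  by apply: cvgB => //; apply: cvgMl; apply: cvgB.
have ce2 : (e2 s @[s --> (0:R)^'+] --> e2 0)%classic.
  apply: cvgB; last by apply: cvgMr.
  by apply: cvgB => //; apply: cvgD => //; apply: cvgMr.
have ce3 : (e3 s @[s --> (0:R)^'+] --> e3 0)%classic.
  apply: cvgB => //.
  apply: cvgB; last by apply: cvgMr.
  by apply: cvgB => //; [apply: cvgMl; apply: cvgD|apply: cvgMr].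
have LS : L 0 <= 220 * d ^+ 2 * S ^+ 2.
  apply: lyapunov_initial => //.
  rewrite /S; have := ler_norm (w2 0 - w1 0).
  rewrite !normrM (ger0_norm (_ : 0 <= 2^-1)); last lra.
  by have := ler_normB (w2 0) (w1 0); have := ler_normD (w1 0) (w2 0); lra.
have LD : L t <= expR (- (b * d ^+ 2 / 4 * t)) * L 0.
  pose f1 s := - (d * e3 s).
  pose f2 s := - (d * (e2 s + e3 s))
    - (d ^+ 3 * z1 s + d ^+ 2 * z2 s + d ^+ 2 * z3 s).
  pose f3 s := - (e3 s - d * (e1 s + e2 s))
     - ((d ^+ 2 - d ^+ 3) * z1 s - 2 * d ^+ 2 * z2 s - 2 * d ^+ 2 * z3 s).
  pose L' s := b * (e1 s * f1 s + e2 s * f2 s + e3 s * f3 s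
     - d / 2 * (f1 s * e3 s + e1 s * f3 s)
     - 64 * d ^+ 2 * (d ^+ 2 * z1 s ^+ 2 + d * z2 s ^+ 2 + z3 s ^+ 2)).
  apply: (@gronwall_decay _ L L') => //.
  - have sqc (f : R -> R) : (f s @[s --> (0:R)^'+] --> f 0)%classic ->
      (f s ^+ 2 @[s --> (0:R)^'+] --> f 0 ^+ 2)%classic.
      by move=> cf; rewrite expr2; under eq_fun do rewrite expr2; apply: cvgM.
    rewrite /L /lyapunov; apply: cvgD.
      apply: cvgB; first by apply: cvgMl; do !apply: cvgD; exact: sqc.
      by apply: cvgMr; apply: cvgM.
    by apply: cvgMr; do !apply: cvgD; exact: sqc.
  - move=> s s0 _; have [dw1 dw2 dw3] := dw _ s0; have [dz1 dz2 dz3] := dz _ s0.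
    have de1 : is_derive s (1:R) e1 (b * f1 s).
      by apply: is_derive_eq; rewrite /GRing.scale /= /f1 /e3; field.
    have de2 : is_derive s (1:R) e2 (b * f2 s).
      by apply: is_derive_eq; rewrite /GRing.scale /= /f2 /e2 /e3; field.
    have de3 : is_derive s (1:R) e3 (b * f3 s).
      by apply: is_derive_eq; rewrite /GRing.scale /= /f3 /e1 /e2 /e3; field.
    rewrite /L /lyapunov /L'.
    by apply: is_derive_eq; rewrite /GRing.scale /=; field.
  - move=> s s0 _; rewrite /L' /L.
    have := ler_wpM2l b0 (lyapunov_dissipation (e1 s) (e2 s) (e3 s) (z1 s) (z2 s) (z3 s) d0 d1).
    by rewrite /=; move=> h; apply: le_trans h _; rewrite le_eqVlt; apply/orP; left;
      apply/eqP; field.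
pose E := expR (- (b * d ^+ 2 / 8 * t)).
have EE : expR (- (b * d ^+ 2 / 4 * t)) = E ^+ 2.
  by rewrite /E -expRM_natr; congr expR; field.
have S0 : 0 <= S by rewrite /S !addr_ge0.
have E0 : 0 <= E by exact: expR_ge0.
have Lt : L t <= 220 * (d * E * S) ^+ 2.
  apply: le_trans LD _; rewrite EE.
  have -> : 220 * (d * E * S) ^+ 2 = E ^+ 2 * (220 * d ^+ 2 * S ^+ 2) by ring.
  by apply: ler_wpM2l => //; exact: sqr_ge0.
have := lyapunov_lower (e1 t) (e2 t) (e3 t) (z1 t) (z2 t) (z3 t) d0 d1.
rewrite -/(L t) => Ll.
have q2 : d ^+ 2 <= d / 4 by rewrite expr2; nra.
have p2 : 0 <= d ^+ 2 by exact: exprn_ge0.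
have q3 : d ^+ 3 <= d ^+ 2 / 4 by rewrite exprS; nra.
have p3 : 0 <= d ^+ 3 by exact: exprn_ge0.
pose Z := (z1 t) ^+ 2 + (z2 t) ^+ 2 + (z3 t) ^+ 2.
have sz1 := sqr_ge0 (z1 t); have sz2 := sqr_ge0 (z2 t); have sz3 := sqr_ge0 (z3 t).
have se1 := sqr_ge0 (e1 t); have se2 := sqr_ge0 (e2 t); have se3 := sqr_ge0 (e3 t).
(* What was subtracted in [e1], [e2], [e3] differs from [T1T1half_col] by d times combinations of z
   with coefficients at most 1, which the term 32 d^2 |z|^2 of the Lyapunov function controls. *)
have key (x a c1 c2 c3 : R) : x = a + d * (c1 * z1 t + c2 * z2 t + c3 * z3 t) ->
   c1 ^+ 2 <= 1 -> c2 ^+ 2 <= 1 -> c3 ^+ 2 <= 1 ->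
   x ^+ 2 <= 2 * a ^+ 2 + 6 * d ^+ 2 * Z.
  move=> -> h1 h2 h3.
  have k1 := ler_wpM2r sz1 h1; have k2 := ler_wpM2r sz2 h2; have k3 := ler_wpM2r sz3 h3.
  set m1 := c1 * z1 t; set m2 := c2 * z2 t; set m3 := c3 * z3 t.
  have hm : (m1 + m2 + m3) ^+ 2 <= 3 * Z.
    have := sqr_ge0 (m1 - m2); have := sqr_ge0 (m1 - m3); have := sqr_ge0 (m2 - m3).
    have : m1 ^+ 2 + m2 ^+ 2 + m3 ^+ 2 <= Z by rewrite /m1 /m2 /m3 !exprMn /Z; lra.
    lra.
  have := ler_wpM2l p2 hm; have := sqr_ge0 (a - d * (m1 + m2 + m3)); lra.
have one : 0 <= 1 :> R by [].
have c01 (c : R) : 0 <= c -> c <= 1 -> c ^+ 2 <= 1 by move=> *; rewrite expr_le1.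
have c0 : 0 ^+ 2 <= 1 :> R by rewrite expr0n.
have cN (c : R) : 0 <= c -> c <= 1 -> (- c) ^+ 2 <= 1 by move=> *; rewrite sqrrN c01.
have cd : d <= 1 by lra.
have [y1 y2 y3] : let u := T1T1half_col d (z1 t) (z2 t) (z3 t) in
  [/\ ((w2 t - w1 t) / 2 - u.1.1) ^+ 2 <= 2 * e1 t ^+ 2 + 6 * d ^+ 2 * Z,
      (w3 t - u.1.2) ^+ 2 <= 2 * e2 t ^+ 2 + 6 * d ^+ 2 * Z &
      ((w1 t + w2 t) / 2 - u.2) ^+ 2 <= 2 * e3 t ^+ 2 + 6 * d ^+ 2 * Z].
  split.
  - apply: (@key _ _ 0 (1 - d ^+ 2) 0) => //; first by rewrite /e1 /=; ring.
    by apply: c01; lra.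
  - apply: (@key _ _ (- 1) (- d ^+ 2) (- d)); first by rewrite /e2 /=; ring.
    + by apply: cN.
    + by apply: cN; lra.
    + by apply: cN; lra.
  - apply: (@key _ _ 0 (- d) (- d ^+ 2)) => //; first by rewrite /e3 /=; ring.
    + by apply: cN; lra.
    + by apply: cN; lra.
move=> u B.
have B0 : 0 <= 75 * (d * E * S) by rewrite !mulr_ge0.
(* 24 * 220 <= 75^2. The factor 24 leaves room for a sum of two components, whose square is at most
   twice the sum of their squares. *)
have fin (x : R) : x ^+ 2 <= 24 * L t -> `|x| <= B.
  move=> h; have -> : B = 75 * (d * E * S) by rewrite /B /E /S; ring.
  rewrite -(ger0_norm B0) -ler_sqr ?nnegrE // !real_normK ?num_real //.
  apply: le_trans h _; have := sqr_ge0 (d * E * S).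
  rewrite [(75 * _) ^+ 2]exprMn; lra.
have dZ : 0 <= d ^+ 2 * Z by rewrite mulr_ge0 // /Z !addr_ge0.
rewrite -/Z in Ll; clearbody Z L.
have pm (p q : R) : p ^+ 2 <= 2 * e1 t ^+ 2 + 6 * d ^+ 2 * Z ->
    q ^+ 2 <= 2 * e3 t ^+ 2 + 6 * d ^+ 2 * Z -> (q - p) ^+ 2 <= 24 * L t.
  by move=> hp hq; have := sqr_ge0 (q + p); lra.
split; apply: fin; move: y1 y2 y3; rewrite -/u => y1 y2 y3.
- have -> : w1 t - (- u.1.1 + u.2) =
    ((w1 t + w2 t) / 2 - u.2) - ((w2 t - w1 t) / 2 - u.1.1) by field.
  exact: pm.
- have -> : w2 t - (u.1.1 + u.2) =
    ((w1 t + w2 t) / 2 - u.2) - (- ((w2 t - w1 t) / 2 - u.1.1)) by field.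
  by apply: pm => //; rewrite sqrrN.
- by lra.
Qed.

End plate.

(** * Kernels satisfying a Bessel inequality, and their products *)

Section integration_tools.
Context {R : realType}.

(** Tonelli applies to the positive and the negative part separately, and [fine] is measurable, so
    that the integral is measurable in x whether or not it converges. *)
Lemma measurable_Rintegral2 d1 d2 (X : measurableType d1) (Y : measurableType d2)
    (nu : {sigma_finite_measure set Y -> \bar R}) (F : X * Y -> R) :
  measurable_fun setT F ->
  measurable_fun setT (fun x => \int[nu]_y F (x, y)).
Proof.
move=> mF.
apply: (measurableT_comp (fine_measurable measurableT)).
under eq_fun do rewrite integralE.
apply: emeasurable_funB.
- have -> : (fun x => (\int[nu]_y (fun y0 => (F (x, y0))%:E)^\+ y)%E) =
     fubini_F nu ((EFin \o F)^\+)%E.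
    by apply/funext => x; apply: eq_integral => y _; rewrite !funeposE.
  apply: measurable_fun_fubini_tonelli_F => //.
  by apply/measurable_funepos/measurable_EFinP.
- have -> : (fun x => (\int[nu]_y (fun y0 => (F (x, y0))%:E)^\- y)%E) =
     fubini_F nu ((EFin \o F)^\-)%E.
    by apply/funext => x; apply: eq_integral => y _; rewrite !funenegE.
  apply: measurable_fun_fubini_tonelli_F => //.
  by apply/measurable_funeneg/measurable_EFinP.
Qed.

Local Notation rT := (measurableTypeR R).
Local Notation mun n := (@lebesgue_tuple R n).

Lemma ge0_integral_tupleS n (f : n.+1.-tuple rT -> \bar R) :
  measurable_fun setT f -> (forall z, 0 <= f z)%E ->
  (\int[mun n.+1]_z f z =
   \int[(lebesgue_measure \x mun n)%E]_z f (tcons z))%E.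
Proof.
move=> mf f0.
rewrite [LHS](@ge0_integral_pushforward _ _ _ _ _ _ (@measurable_tcons R n)) //.
Qed.

Lemma Rintegral_tupleS n (f : n.+1.-tuple rT -> R) : measurable_fun setT f ->
  \int[mun n.+1]_z f z = \int[(lebesgue_measure \x mun n)%E]_z f (tcons z).
Proof.
move=> mf; have mEf : measurable_fun setT (EFin \o f) by exact/measurable_EFinP.
rewrite /Rintegral; apply: (congr1 fine).
rewrite (integralE (mun n.+1)) [RHS]integralE.
rewrite (ge0_integral_tupleS (measurable_funepos mEf) (funepos_ge0 _)).
rewrite (ge0_integral_tupleS (measurable_funeneg mEf) (funeneg_ge0 _)).
congr (_ - _)%E; apply: eq_integral => z _.
- by rewrite !funeposE.
- by rewrite !funenegE.
Qed.

Lemma ge0_integral_tuple0 (f : 0.-tuple rT -> \bar R) :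
  measurable_fun setT f -> (\int[mun 0]_z f z = f [tuple])%E.
Proof. by move=> mf; rewrite integral_dirac // diracT mul1e. Qed.

Lemma measurable_tuple_prod n (h : R -> R) : measurable_fun setT h ->
  measurable_fun setT (fun z : n.-tuple rT => \prod_(i < n) h (tnth z i)).
Proof.
move=> mh; apply: measurable_prod => i _.
exact: (measurableT_comp mh (measurable_tnth i)).
Qed.

Lemma integral_tuple_prod n (h : R -> R) (c : R) :
  measurable_fun setT h -> (forall x, 0 <= h x) ->
  (\int[lebesgue_measure]_x (h x)%:E = c%:E)%E ->
  (\int[mun n]_z (\prod_(i < n) h (tnth z i))%:E = (c ^+ n)%:E)%E.
Proof.
move=> mh h0 hc.
have mp k := measurable_tuple_prod (n := k) mh.
have p0 k (z : k.-tuple rT) : 0 <= \prod_(i < k) h (tnth z i).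
  by apply: prodr_ge0.
elim: n => [|n IH].
  rewrite ge0_integral_tuple0; last by apply/measurable_EFinP; exact: mp.
  by rewrite big_ord0 expr0.
rewrite ge0_integral_tupleS; [|by apply/measurable_EFinP; exact: mp|by move=> z; rewrite lee_fin].
have E (x : rT) (y : n.-tuple rT) :
   \prod_(i < n.+1) h (tnth (tcons (x, y)) i) = h x * \prod_(i < n) h (tnth y i).
  rewrite big_ord_recl; congr (_ * _).
  by apply: eq_bigr => i _; rewrite /tcons /= !(tnth_nth x).
rewrite fubini_tonelli1 //=; first last.
- by move=> z; rewrite lee_fin; exact: (p0 n.+1).
- apply/measurable_EFinP.
  exact: (measurableT_comp (mp n.+1) (@measurable_tcons R n)).
rewrite /fubini_F /=.
under eq_integral => x _.
  under eq_integral do rewrite E EFinM.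
  rewrite ge0_integralZl_EFin //; [|by move=> y _; rewrite lee_fin|by apply/measurable_EFinP; exact: mp].
  rewrite IH; over.
rewrite ge0_integralZr //.
- by rewrite hc -EFinM exprS.
- exact/measurable_EFinP.
- by move=> x _; rewrite lee_fin.
- rewrite lee_fin; apply: exprn_ge0.
  by rewrite -lee_fin -hc; apply: integral_ge0 => x _; rewrite lee_fin.
Qed.

End integration_tools.

Section bessel.
Context {R : realType}.

Lemma Rintegral_prod12 d1 d2 (X : measurableType d1) (Y : measurableType d2)
    (mu : {sigma_finite_measure set X -> \bar R})
    (nu : {sigma_finite_measure set Y -> \bar R}) (f : X * Y -> R) :
  (mu \x nu)%E.-integrable setT (EFin \o f) ->
  (forall x, nu.-integrable setT (fun y => (f (x, y))%:E)) ->
  \int[(mu \x nu)%E]_z f z = \int[mu]_x \int[nu]_y f (x, y).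
Proof.
move=> fi fxi; rewrite /Rintegral -integral12_prod_meas1 //; congr fine.
by apply: eq_integral => x _; rewrite fineK //; exact: integrable_fin_num.
Qed.

Lemma integrable_prod_tensor d1 d2 (X : measurableType d1) (Y : measurableType d2)
    (mu : {sigma_finite_measure set X -> \bar R})
    (nu : {sigma_finite_measure set Y -> \bar R}) (f : X -> R) (g : Y -> R) :
  mu.-integrable setT (EFin \o f) -> nu.-integrable setT (EFin \o g) ->
  (mu \x nu)%E.-integrable setT (fun z => (f z.1 * g z.2)%:E).
Proof.
move=> fi gi.
have mf : measurable_fun setT f by apply/measurable_EFinP; exact: measurable_int fi.
have mg : measurable_fun setT g by apply/measurable_EFinP; exact: measurable_int gi.
apply/(integrable12ltyP mu nu).
  apply/measurable_EFinP; apply: measurable_funM.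
    exact: (measurableT_comp mf measurable_fst).
  exact: (measurableT_comp mg measurable_snd).
have [_ fy] := integrableP _ _ _ fi; have [_ gy] := integrableP _ _ _ gi.
have gfin : (\int[nu]_y `|(g y)%:E|)%E \is a fin_num.
  by rewrite ge0_fin_numE //; apply: integral_ge0.
rewrite (_ : (fun x => _) = (fun x => `|(f x)%:E| * \int[nu]_y `|(g y)%:E|)%E).
  rewrite ge0_integralZr //.
  - by apply: lte_mul_pinfty; [exact: integral_ge0|rewrite ge0_fin_numE //; exact: integral_ge0|].
  - by apply: measurableT_comp => //; exact/measurable_EFinP.
  - exact: integral_ge0.
apply/funext => x /=; rewrite -ge0_integralZl_EFin //.
  by apply: eq_integral => y _; rewrite normrM EFinM.
by apply/measurable_EFinP; exact: measurableT_comp.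
Qed.

Definition dominated_kernel d1 d2 (X : measurableType d1) (Y : measurableType d2)
    (nu : {measure set Y -> \bar R}) (phi : X * Y -> R) (psi : Y -> R) : Prop :=
  [/\ measurable_fun setT phi, forall x y, `|phi (x, y)| <= psi y &
      nu.-integrable setT (EFin \o psi)].

(** For the trigonometric kernels [psi] is the indicator of a cube and [phi] contains the same
    factor: the restriction to functions supported in the cube is carried by the weight and not by
    [a]. *)
Definition bessel d1 d2 (X : measurableType d1) (Y : measurableType d2)
    (mu : {measure set X -> \bar R}) (nu : {measure set Y -> \bar R})
    (phi : X * Y -> R) (psi : Y -> R) (K : R) : Prop :=
  forall (a : Y -> R) (B : R), measurable_fun setT a -> (forall y, `|a y| <= B) ->
  (\int[mu]_x ((\int[nu]_y (a y * phi (x, y))) ^+ 2)%:E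
   <= K%:E * \int[nu]_y (a y ^+ 2 * psi y)%:E)%E.

(* A product of measures is not known here to be sigma-finite, as the library's
   measurability of partial integrals requires; hence this separate property. *)
Definition measurable_transform d1 d2 (X : measurableType d1) (Y : measurableType d2)
    (nu : {measure set Y -> \bar R}) (phi : X * Y -> R) : Prop :=
  forall (a : Y -> R) (B : R), measurable_fun setT a -> (forall y, `|a y| <= B) ->
  measurable_fun setT (fun x => \int[nu]_y (a y * phi (x, y))).

Section dominated.
Context d1 d2 (X : measurableType d1) (Y : measurableType d2).
Context (nu : {measure set Y -> \bar R}).
Context (phi : X * Y -> R) (psi : Y -> R).
Hypothesis dk : dominated_kernel nu phi psi.

Lemma dominated_psi_ge0 (x : X) y : 0 <= psi y.
Proof. by have [_ h _] := dk; exact: le_trans (normr_ge0 _) (h x y). Qed.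

Lemma dominated_kernel_integrable (a : Y -> R) (B : R) (x : X) :
  measurable_fun setT a -> (forall y, `|a y| <= B) ->
  nu.-integrable setT (fun y => (a y * phi (x, y))%:E).
Proof.
move=> ma aB; have [mphi phile ipsi] := dk.
apply: (@le_integrable _ _ _ _ _ measurableT _ (fun y => (B * psi y)%:E)).
- apply/measurable_EFinP; apply: measurable_funM => //.
  exact: measurableT_comp (pair1_measurable x).
- move=> y _ /=; rewrite lee_fin normrM.
  apply: le_trans (_ : B * psi y <= _); last exact: ler_norm.
  by apply: ler_pM.
- exact: (integrableZl measurableT B ipsi).
Qed.

Lemma dominated_kernel_bound (a : Y -> R) (B : R) (x : X) :
  measurable_fun setT a -> (forall y, `|a y| <= B) ->
  `|\int[nu]_y (a y * phi (x, y))| <= B * \int[nu]_y psi y.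
Proof.
move=> ma aB; have [mphi phile ipsi] := dk.
have ai := dominated_kernel_integrable x ma aB.
apply: le_trans (le_normr_Rintegral measurableT ai) _.
rewrite -RintegralZl //; apply: le_Rintegral => //.
- exact: (integrable_norm ai).
- exact: (integrableZl measurableT B ipsi).
- by move=> y _; rewrite normrM; apply: ler_pM.
Qed.

End dominated.

Lemma measurable_kernel_transform d1 d2 (X : measurableType d1) (Y : measurableType d2)
    (nu : {sigma_finite_measure set Y -> \bar R})
    (phi : X * Y -> R) (psi : Y -> R) (a : Y -> R) :
  dominated_kernel nu phi psi -> measurable_fun setT a ->
  measurable_fun setT (fun x => \int[nu]_y (a y * phi (x, y))).
Proof.
move=> [mphi _ _] ma.
apply: (measurable_Rintegral2 nu (F := fun z => a z.2 * phi z)).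
by apply: measurable_funM => //; exact: (measurableT_comp ma measurable_snd).
Qed.

Lemma dominated_kernel_prod d1 d2 d3 d4 (X1 : measurableType d1) (X2 : measurableType d2)
    (Y1 : measurableType d3) (Y2 : measurableType d4)
    (nu1 : {sigma_finite_measure set Y1 -> \bar R})
    (nu2 : {sigma_finite_measure set Y2 -> \bar R})
    (phi1 : X1 * Y1 -> R) (psi1 : Y1 -> R) (phi2 : X2 * Y2 -> R) (psi2 : Y2 -> R) :
  dominated_kernel nu1 phi1 psi1 -> dominated_kernel nu2 phi2 psi2 ->
  dominated_kernel (nu1 \x nu2)%E
    (fun z : (X1 * X2) * (Y1 * Y2) => phi1 (z.1.1, z.2.1) * phi2 (z.1.2, z.2.2))
    (fun y => psi1 y.1 * psi2 y.2).
Proof.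
move=> [mphi1 b1 i1] [mphi2 b2 i2]; split.
- have mf11 : measurable_fun setT (fun z : (X1 * X2) * (Y1 * Y2) => (z.1.1, z.2.1)).
    apply: measurable_fun_pair.
      exact: (measurableT_comp measurable_fst measurable_fst).
    exact: (measurableT_comp measurable_fst measurable_snd).
  have mf22 : measurable_fun setT (fun z : (X1 * X2) * (Y1 * Y2) => (z.1.2, z.2.2)).
    apply: measurable_fun_pair.
      exact: (measurableT_comp measurable_snd measurable_fst).
    exact: (measurableT_comp measurable_snd measurable_snd).
  by apply: measurable_funM; [exact: (measurableT_comp mphi1 mf11)|
                              exact: (measurableT_comp mphi2 mf22)].
- by move=> x y /=; rewrite normrM ler_pM.
- exact: integrable_prod_tensor.
Qed.

Section product_kernel.
Context (d1 d2 d3 d4 : measure_display).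
Context (X1 : measurableType d1) (X2 : measurableType d2).
Context (Y1 : measurableType d3) (Y2 : measurableType d4).
Context (mu1 : {sigma_finite_measure set X1 -> \bar R}).
Context (mu2 : {sigma_finite_measure set X2 -> \bar R}).
Context (nu1 : {sigma_finite_measure set Y1 -> \bar R}).
Context (nu2 : {sigma_finite_measure set Y2 -> \bar R}).
Context (phi1 : X1 * Y1 -> R) (psi1 : Y1 -> R) (phi2 : X2 * Y2 -> R) (psi2 : Y2 -> R).
Hypotheses (k1 : dominated_kernel nu1 phi1 psi1) (k2 : dominated_kernel nu2 phi2 psi2).
Context (a : Y1 * Y2 -> R) (B : R).
Hypotheses (ma : measurable_fun setT a) (aB : forall y, `|a y| <= B).

Let g (w : X2 * Y1) := \int[nu2]_y2 (a (w.2, y2) * phi2 (w.1, y2)).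

Let mg : measurable_fun setT g.
Proof.
have [mphi2 _ _] := k2.
apply: (measurable_Rintegral2 nu2
  (F := fun z : (X2 * Y1) * Y2 => a (z.1.2, z.2) * phi2 (z.1.1, z.2))).
apply: measurable_funM.
  apply: (measurableT_comp ma); apply: measurable_fun_pair => //.
  exact: (measurableT_comp measurable_snd measurable_fst).
apply: (measurableT_comp mphi2); apply: measurable_fun_pair => //.
exact: (measurableT_comp measurable_fst measurable_fst).
Qed.

Lemma product_kernel_transform x1 x2 :
  \int[(nu1 \x nu2)%E]_y (a y * (phi1 (x1, y.1) * phi2 (x2, y.2)))
  = \int[nu1]_y1 (g (x2, y1) * phi1 (x1, y1)).
Proof.
have ma1 y1 : measurable_fun setT (fun y2 => a (y1, y2)).
  exact: measurableT_comp (pair1_measurable y1).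
rewrite Rintegral_prod12.
- apply: eq_Rintegral => y1 _; rewrite /g /= -RintegralZr //.
    by apply: eq_Rintegral => y2 _; ring.
  by apply: (dominated_kernel_integrable k2) => // y; exact: aB.
- exact: (dominated_kernel_integrable (dominated_kernel_prod k1 k2) (x1, x2) ma aB).
- move=> y1; apply: (@eq_integrable _ _ _ _ _ measurableT (fun y2 =>
    ((phi1 (x1, y1))%:E * (a (y1, y2) * phi2 (x2, y2))%:E)%E)) => //.
    by move=> y2 _ /=; rewrite -EFinM; congr EFin; ring.
  apply: integrableZl => //.
  by apply: (dominated_kernel_integrable k2) => // y; exact: aB.
Qed.

Lemma measurable_product_kernel_transform :
  measurable_fun setT (fun x : X1 * X2 => \int[(nu1 \x nu2)%E]_y
     (a y * (phi1 (x.1, y.1) * phi2 (x.2, y.2)))).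
Proof.
have [mphi1 _ _] := k1.
under eq_fun do rewrite product_kernel_transform.
apply: (measurable_Rintegral2 nu1
  (F := fun z : (X1 * X2) * Y1 => g (z.1.2, z.2) * phi1 (z.1.1, z.2))).
apply: measurable_funM.
  apply: (measurableT_comp mg); apply: measurable_fun_pair => //.
  exact: (measurableT_comp measurable_snd measurable_fst).
apply: (measurableT_comp mphi1); apply: measurable_fun_pair => //.
exact: (measurableT_comp measurable_fst measurable_fst).
Qed.

(** For fixed x2 the first inequality is applied to the partial transform [g (x2, y1)] as a function
    of y1, which is bounded thanks to the majorant [psi2]. After exchanging the integrals over x2
    and y1, the second inequality is applied for each fixed y1. *)
Lemma bessel_prod (K1 K2 : R) :
  (forall y, 0 <= psi1 y) -> (forall y, 0 <= psi2 y) -> 0 <= K1 -> 0 <= K2 ->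
  bessel mu1 nu1 phi1 psi1 K1 -> bessel mu2 nu2 phi2 psi2 K2 ->
  (\int[(mu1 \x mu2)%E]_x ((\int[(nu1 \x nu2)%E]_y
     (a y * (phi1 (x.1, y.1) * phi2 (x.2, y.2)))) ^+ 2)%:E
   <= (K1 * K2)%:E * \int[(nu1 \x nu2)%E]_y (a y ^+ 2 * (psi1 y.1 * psi2 y.2))%:E)%E.
Proof.
move=> psi10 psi20 K10 K20 b1 b2.
have [_ _ ipsi1] := k1; have [_ _ ipsi2] := k2.
have mpsi1 : measurable_fun setT psi1 by apply/measurable_EFinP; exact: measurable_int ipsi1.
have mpsi2 : measurable_fun setT psi2 by apply/measurable_EFinP; exact: measurable_int ipsi2.
have ma1 y1 : measurable_fun setT (fun y2 => a (y1, y2)).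
  exact: measurableT_comp (pair1_measurable y1).
have gB w : `|g w| <= B * \int[nu2]_y psi2 y.
  by apply: (dominated_kernel_bound k2) => // y; exact: aB.
have mgx x2 : measurable_fun setT (fun y1 => g (x2, y1)).
  exact: measurableT_comp (pair1_measurable x2).
have mT := measurable_product_kernel_transform.
rewrite fubini_tonelli2 //=; first last.
- by move=> x; rewrite lee_fin sqr_ge0.
- by apply/measurable_EFinP; apply: measurable_funX.
pose h (w : X2 * Y1) := ((g w) ^+ 2 * psi1 w.2)%:E.
have mh : measurable_fun setT h.
  apply/measurable_EFinP; apply: measurable_funM; first exact: measurable_funX.
  exact: (measurableT_comp mpsi1 measurable_snd).
have h0 w : (0 <= h w)%E by rewrite lee_fin mulr_ge0 // sqr_ge0.
have step1 x2 : (fubini_G mu1 (fun x : X1 * X2 => ((\int[(nu1 \x nu2)%E]_y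
     (a y * (phi1 (x.1, y.1) * phi2 (x.2, y.2)))) ^+ 2)%:E) x2
   <= K1%:E * fubini_F nu1 h x2)%E.
  rewrite /fubini_G; under eq_integral do rewrite /= product_kernel_transform.
  exact: b1 (mgx x2) (fun y => gB (x2, y)).
apply: (@le_trans _ _ (\int[mu2]_x2 (K1%:E * fubini_F nu1 h x2)))%E.
  apply: ge0_le_integral => //.
  - by move=> x2 _; apply: integral_ge0 => x1 _; rewrite lee_fin sqr_ge0.
  - apply: (@measurable_fun_fubini_tonelli_G _ _ _ _ _ mu1).
      by apply/measurable_EFinP; apply: measurable_funX.
    by move=> x; rewrite lee_fin sqr_ge0.
  - by apply: measurable_funeM; apply: measurable_fun_fubini_tonelli_F.
have F0 x2 : (0 <= fubini_F nu1 h x2)%E by apply: integral_ge0.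
rewrite ge0_integralZl_EFin //; last exact: measurable_fun_fubini_tonelli_F.
rewrite EFinM -muleA; apply: lee_wpmul2l; first by rewrite lee_fin.
rewrite fubini_tonelli //.
pose m (y : Y1 * Y2) := (a y ^+ 2 * (psi1 y.1 * psi2 y.2))%:E.
have mm : measurable_fun setT m.
  apply/measurable_EFinP; apply: measurable_funM; first exact: measurable_funX.
  apply: measurable_funM; first exact: (measurableT_comp mpsi1 measurable_fst).
  exact: (measurableT_comp mpsi2 measurable_snd).
have m0 y : (0 <= m y)%E by rewrite lee_fin; apply: mulr_ge0; [exact: sqr_ge0|exact: mulr_ge0].
rewrite (fubini_tonelli1 m) //.
rewrite -ge0_integralZl_EFin //; last 2 first.
- by move=> y1 _; apply: integral_ge0.
- exact: measurable_fun_fubini_tonelli_F.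
apply: ge0_le_integral => //.
- by move=> y1 _; apply: integral_ge0.
- exact: measurable_fun_fubini_tonelli_G.
- by apply: measurable_funeM; apply: measurable_fun_fubini_tonelli_F.
move=> y1 _; rewrite /fubini_G /fubini_F /h /m /=.
under eq_integral do rewrite mulrC EFinM.
rewrite ge0_integralZl_EFin //; last 2 first.
- by move=> x2 _; rewrite lee_fin sqr_ge0.
- apply/measurable_EFinP; apply: measurable_funX.
  exact: (measurableT_comp mg (pair2_measurable y1)).
have -> : (\int[nu2]_y2 (a (y1, y2) ^+ 2 * (psi1 y1 * psi2 y2))%:E =
    (psi1 y1)%:E * \int[nu2]_y2 (a (y1, y2) ^+ 2 * psi2 y2)%:E)%E.
  rewrite -ge0_integralZl_EFin //.
  - by apply: eq_integral => y2 _; rewrite -EFinM; congr EFin; ring.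
  - by move=> y2 _; rewrite lee_fin mulr_ge0 // sqr_ge0.
  - by apply/measurable_EFinP; apply: measurable_funM => //; apply: measurable_funX.
rewrite muleCA; apply: lee_wpmul2l; first by rewrite lee_fin.
exact: b2 (ma1 y1) (fun y => aB (y1, y)).
Qed.

End product_kernel.

(** (u + e v)^2 <= 2 u^2 + 2 v^2. The sign [e] serves both addition formulas, -1 for the cosine and
    1 for the sine. *)
Lemma bessel_sum d1 d2 (X : measurableType d1) (Y : measurableType d2)
    (mu : {measure set X -> \bar R}) (nu : {measure set Y -> \bar R})
    (phi1 phi2 : X * Y -> R) (psi : Y -> R) (e K1 K2 : R) :
  dominated_kernel nu phi1 psi -> dominated_kernel nu phi2 psi ->
  measurable_transform nu phi1 -> measurable_transform nu phi2 ->
  e ^+ 2 = 1 -> bessel mu nu phi1 psi K1 -> bessel mu nu phi2 psi K2 ->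
  0 <= K1 -> 0 <= K2 ->
  bessel mu nu (fun z => phi1 z + e * phi2 z) psi (2 * K1 + 2 * K2).
Proof.
move=> k1 k2 t1 t2 e1 b1 b2 K10 K20 a B ma aB.
have i1 x := dominated_kernel_integrable k1 x ma aB.
have i2 x := dominated_kernel_integrable k2 x ma aB.
have E x : \int[nu]_y (a y * (phi1 (x, y) + e * phi2 (x, y))) =
  \int[nu]_y (a y * phi1 (x, y)) + e * \int[nu]_y (a y * phi2 (x, y)).
  rewrite -(RintegralZl _ measurableT (i2 x)).
  rewrite -(RintegralD measurableT (i1 x) (integrableZl measurableT e (i2 x))).
  by apply: eq_Rintegral => y _; ring.
have m1 := t1 a B ma aB; have m2 := t2 a B ma aB.
set J := (\int[nu]_y (a y ^+ 2 * psi y)%:E)%E.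
apply: (@le_trans _ _ (\int[mu]_x (2%:E * ((\int[nu]_y (a y * phi1 (x, y))) ^+ 2)%:E
    + 2%:E * ((\int[nu]_y (a y * phi2 (x, y))) ^+ 2)%:E)))%E.
  apply: ge0_le_integral => //.
  - by move=> x _; rewrite lee_fin sqr_ge0.
  - apply/measurable_EFinP; apply: measurable_funX.
    under eq_fun do rewrite E.
    by apply: measurable_funD => //; exact: measurable_funM.
  - by apply: emeasurable_funD; apply: measurable_funeM; apply/measurable_EFinP;
      exact: measurable_funX.
  - move=> x _; rewrite -!EFinM -EFinD lee_fin E.
    set u := \int[nu]_y (a y * phi1 _); set v := \int[nu]_y (a y * phi2 _).
    have := sqr_ge0 (u - e * v); rewrite sqrrB sqrrD exprMn e1; lra.
have n0 (f : X -> R) x : [set: X]%classic x -> (0 <= 2%:E * (f x ^+ 2)%:E :> \bar R)%E.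
  by move=> _; rewrite -EFinM lee_fin mulr_ge0 // sqr_ge0.
have nm (f : X -> R) : measurable_fun setT f ->
    measurable_fun setT (fun x => 2%:E * (f x ^+ 2)%:E : \bar R)%E.
  by move=> mf; apply: measurable_funeM; apply/measurable_EFinP; exact: measurable_funX.
rewrite ge0_integralD //; [|exact: n0|exact: nm|exact: n0|exact: nm].
have nz (f : X -> R) : measurable_fun setT f ->
   (\int[mu]_x (2%:E * (f x ^+ 2)%:E) = 2%:E * \int[mu]_x (f x ^+ 2)%:E)%E.
  move=> mf; rewrite ge0_integralZl_EFin // => [x _|]; first by rewrite lee_fin sqr_ge0.
  by apply/measurable_EFinP; exact: measurable_funX.
rewrite !nz // (EFinD (2 * K1)) [leRHS]ge0_muleDl ?lee_fin ?mulr_ge0 //.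
rewrite !(EFinM 2) -!muleA.
apply: leeD; (apply: lee_wpmul2l; first by rewrite lee_fin).
- exact: b1 ma aB.
- exact: b2 ma aB.
Qed.

End bessel.

(** * The Bessel inequality for sine and cosine transforms *)

Section trigonometric_kernels.
Context {R : realType}.

Lemma Rintegral_FTC (f F : R -> R) (a b : R) : a < b -> continuous f ->
  (forall x : R, is_derive x (1:R) F (f x)) ->
  \int[lebesgue_measure]_(x in `[a, b]) f x = F b - F a.
Proof.
move=> ab cf dF; have cF (x : R) : {for x, continuous F}.
  by apply/differentiable_continuous/derivable1_diffP; have dFx := dF x;
     exact: (@ex_derive _ _ _ _ _ _ _ dFx).
rewrite /Rintegral (@continuous_FTC2 _ f F) //.
- exact: continuous_subspaceT.
- split.
  + by move=> x _; have dFx := dF x; exact: (@ex_derive _ _ _ _ _ _ _ dFx).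
  + by apply: cvg_at_right_filter; exact: cF.
  + by apply: cvg_at_left_filter; exact: cF.
- by move=> x _; have dFx := dF x; rewrite derive1E derive_val.
Qed.

Lemma integrable_itv_continuous (f : R -> R) (a b : R) : continuous f ->
  lebesgue_measure.-integrable `[a, b] (EFin \o f).
Proof.
by move=> cf; apply: continuous_compact_integrable;
  [exact: segment_compact|exact: continuous_subspaceT].
Qed.

Lemma continuous_cosM (z : R) : continuous (fun x : R => cos (x * z)).
Proof.
move=> x; apply: continuous_comp; last exact: continuous_cos.
by apply: cvgMl; exact: cvg_id.
Qed.

(* The antiderivative obtained by two integrations by parts, which gain a factor
   1/z^2 because the weight vanishes at the endpoints. *)
Lemma fejer_kernel_bound (N z : R) : 0 < N ->
  `|\int[lebesgue_measure]_(x in `[- N, N]) ((1 - (x / N) ^+ 2) * cos (x * z))|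
  <= 16 * N / (1 + (N * z) ^+ 2).
Proof.
move=> N0; have NN : - N < N by lra.
have cw : continuous (fun x : R => (1 - (x / N) ^+ 2) * cos (x * z)).
  move=> x; apply: cvgM; last exact: continuous_cosM.
  apply: cvgB; first exact: cvg_cst.
  rewrite expr2; under eq_fun do rewrite expr2.
  by apply: cvgM; apply: cvgMl; exact: cvg_id.
have D0 : 0 < 1 + (N * z) ^+ 2 by rewrite ltr_pwDl // sqr_ge0.
have [Nz|Nz] := leP (N * `|z|) 1.
  apply: le_trans (_ : 2 * N <= _).
    apply: le_trans (le_normr_Rintegral _ _) _ => //; first exact: integrable_itv_continuous.
    apply: le_trans (_ : \int[lebesgue_measure]_(x in `[- N, N]) 1 <= _).
      apply: le_Rintegral => //.
      - by apply: integrable_itv_continuous => x; apply: cvg_norm; exact: cw.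
      - by apply: integrable_itv_continuous; exact: cst_continuous.
      - move=> x; rewrite /= in_itv /= => /andP[x1 x2]; rewrite normrM.
        rewrite -[leRHS]mulr1; apply: ler_pM => //; last exact: cos_max.
        have : 0 <= (x / N) ^+ 2 <= 1.
          rewrite sqr_ge0 /= -real_normK ?num_real // expr_le1 // normrM normfV.
          by rewrite (gtr0_norm N0) ler_pdivrMr // mul1r ler_norml x1 x2.
        by move=> /andP[? ?]; rewrite ler_norml; lra.
    have -> : (fun=> 1) = cst 1 :> (R -> R) by [].
    rewrite Rintegral_cst // /= lebesgue_measure_itv /= lte_fin NN -EFinB /=; lra.
  rewrite ler_pdivlMr //.
  have : (N * z) ^+ 2 <= 1.
    rewrite -real_normK ?num_real // expr_le1 // normrM (gtr0_norm N0) //.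
  by have := sqr_ge0 (N * z); nra.
have z0 : z != 0 by apply: contraTneq Nz => ->; rewrite normr0 mulr0 ltNge ler01.
pose F (x : R) := (1 - (x / N) ^+ 2) * (sin (x * z) / z)
  - 2 * x / N ^+ 2 * (cos (x * z) / z ^+ 2) + 2 / N ^+ 2 * (sin (x * z) / z ^+ 3).
have dF (x : R) : is_derive x (1:R) F ((1 - (x / N) ^+ 2) * cos (x * z)).
  have dxz : is_derive x (1:R) (fun y : R => y * z) z.
    by apply: is_derive_eq; rewrite /GRing.scale /=; ring.
  have dsin : is_derive x (1:R) (fun y : R => sin (y * z)) (z * cos (x * z)).
    by rewrite mulrC; have := is_derive1_comp (is_derive_sin _) dxz.
  have dcos : is_derive x (1:R) (fun y : R => cos (y * z)) (z * - sin (x * z)).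
    by rewrite mulrC; have := is_derive1_comp (is_derive_cos _) dxz.
  apply: is_derive_eq; rewrite /GRing.scale /=; field.
  by rewrite z0 gt_eqF.
rewrite (Rintegral_FTC NN cw dF).
have -> : F N - F (- N) = - (4 / (N * z ^+ 2)) * (cos (N * z) - sin (N * z) / (N * z)).
  rewrite /F !mulNr cosN sinN; field.
  by rewrite z0 gt_eqF.
have P0 : 0 < 4 / (N * z ^+ 2).
  by apply: divr_gt0 => //; apply: mulr_gt0 => //; rewrite exprn_even_gt0.
rewrite normrM normrN (gtr0_norm P0).
have S : `|cos (N * z) - sin (N * z) / (N * z)| <= 2.
  apply: le_trans (ler_normB _ _) _.
  have c1 := cos_max (N * z).
  have : `|sin (N * z) / (N * z)| <= 1.
    rewrite normrM normfV ler_pdivrMr ?mul1r.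
      by apply: le_trans (sin_max _) _; rewrite normrM (gtr0_norm N0) ltW.
    by rewrite normr_gt0 mulf_neq0 // gt_eqF.
  by move=> ?; lra.
apply: le_trans (ler_wpM2l (ltW P0) S) _.
have z2 : 0 < z ^+ 2 by rewrite exprn_even_gt0.
have Nz2 : 1 <= (N * z) ^+ 2.
  by rewrite -real_normK ?num_real // expr_ge1 // normrM (gtr0_norm N0) ltW.
have -> : 4 / (N * z ^+ 2) * 2 = 8 * N / (N * z) ^+ 2.
  by field; rewrite z0 gt_eqF.
rewrite ler_pdivrMr; last by rewrite exprn_even_gt0 //= mulf_neq0 // gt_eqF.
rewrite mulrAC ler_pdivlMr //.
have : 0 <= N * ((N * z) ^+ 2 - 1) by rewrite mulr_ge0 ?subr_ge0 // ltW.
by lra.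
Qed.

(** A difference of two arctangents. The bound does not depend on N, which is what later allows N to
    tend to infinity. *)
Lemma cauchy_kernel_mass (N x : R) : 0 < N ->
  \int[lebesgue_measure]_(y in `[- 1, 1]) (N / (1 + (N * (x - y)) ^+ 2)) <= pi.
Proof.
move=> N0.
have D0 (y : R) : 1 + (N * (x - y)) ^+ 2 != 0.
  by rewrite gt_eqF // ltr_pwDl // sqr_ge0.
have cl : continuous (fun y : R => N * (x - y)).
  by move=> y; apply: cvgMr; apply: cvgB; [exact: cvg_cst|exact: cvg_id].
have dF (y : R) : is_derive y (1:R) (fun y : R => - atan (N * (x - y)))
    (N / (1 + (N * (x - y)) ^+ 2)).
  have dl : is_derive y (1:R) (fun y : R => N * (x - y)) (- N).
    by apply: is_derive_eq; rewrite /GRing.scale /=; ring.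
  have da : is_derive y (1:R) (fun y : R => atan (N * (x - y)))
     ((1 + (N * (x - y)) ^+ 2)^-1 * (- N)).
    by have := is_derive1_comp (is_derive1_atan _) dl.
  by apply: is_derive_eq; ring.
have cf : continuous (fun y : R => N / (1 + (N * (x - y)) ^+ 2)).
  move=> y; apply: cvgM; first exact: cvg_cst.
  apply: cvgV => //; apply: cvgD; first exact: cvg_cst.
  by rewrite expr2; under eq_fun do rewrite expr2; apply: cvgM; exact: cl.
rewrite (Rintegral_FTC _ cf dF); last by lra.
have := atan_ltpi2 (N * (x - (- 1))); have := atan_gtNpi2 (N * (x - 1)); lra.
Qed.

End trigonometric_kernels.

(** * Fubini for functions dominated by a tensor product *)

Section tensor_dominated.
Context {R : realType} d1 d2 (X : measurableType d1) (Y : measurableType d2).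
Context (mu : {sigma_finite_measure set X -> \bar R}).
Context (nu : {sigma_finite_measure set Y -> \bar R}).
Context (F : X * Y -> R) (f : X -> R) (g : Y -> R).
Hypothesis mF : measurable_fun setT F.
Hypothesis Ffg : forall x y, `|F (x, y)| <= f x * g y.
Hypothesis fi : mu.-integrable setT (EFin \o f).
Hypothesis gi : nu.-integrable setT (EFin \o g).

Lemma tensor_dominated_integrable : (mu \x nu)%E.-integrable setT (EFin \o F).
Proof.
apply: le_integrable (integrable_prod_tensor fi gi) => //; first exact/measurable_EFinP.
by move=> [x y] _ /=; rewrite lee_fin (le_trans (Ffg x y)) // ler_norm.
Qed.

Lemma tensor_dominated_integrable_y x : nu.-integrable setT (fun y => (F (x, y))%:E).
Proof.
apply: (@le_integrable _ _ _ _ _ measurableT _ (fun y => (f x * g y)%:E)).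
- by apply/measurable_EFinP; exact: measurableT_comp (pair1_measurable x).
- by move=> y _ /=; rewrite lee_fin (le_trans (Ffg x y)) // ler_norm.
- exact: (integrableZl measurableT (f x) gi).
Qed.

Lemma tensor_dominated_integrable_x y : mu.-integrable setT (fun x => (F (x, y))%:E).
Proof.
apply: (@le_integrable _ _ _ _ _ measurableT _ (fun x => (g y * f x)%:E)).
- by apply/measurable_EFinP; exact: measurableT_comp (pair2_measurable y).
- by move=> x _ /=; rewrite lee_fin mulrC (le_trans (Ffg x y)) // ler_norm.
- exact: (integrableZl measurableT (g y) fi).
Qed.

Lemma tensor_dominated_partial :
  mu.-integrable setT (fun x => (\int[nu]_y F (x, y))%:E).
Proof.
apply: eq_integrable (integrable_fubini_F tensor_dominated_integrable) => // x _.
by rewrite fineK //; apply: integrable_fin_num => //; exact: tensor_dominated_integrable_y.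
Qed.

Lemma Rintegral_swap :
  \int[mu]_x \int[nu]_y F (x, y) = \int[nu]_y \int[mu]_x F (x, y).
Proof.
rewrite -Rintegral_prod12; [|exact: tensor_dominated_integrable|
  exact: tensor_dominated_integrable_y].
rewrite {1}/Rintegral -(integral21_prod_meas1 tensor_dominated_integrable).
rewrite [RHS]/Rintegral; apply: (congr1 fine); apply: eq_integral => y _.
by rewrite fineK //; apply: integrable_fin_num => //; exact: tensor_dominated_integrable_x.
Qed.

End tensor_dominated.

(** * Weighted square integrals of cosine and sine transforms on the line *)

Section weighted_line.
Context {R : realType}.
Local Notation rT := (measurableTypeR R).
Local Notation lm := (@lebesgue_measure R).

Definition unit_box (x : R) : R := \1_(`[- 1, 1]%classic : set R) x.

Lemma unit_box01 x : 0 <= unit_box x <= 1.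
Proof. by rewrite /unit_box indicE; case: (_ \in _); rewrite /= ?lexx ?ler01. Qed.

Lemma unit_box_sqr x : unit_box x * unit_box x = unit_box x.
Proof. by rewrite /unit_box indicE; case: (_ \in _); rewrite ?mul1r ?mul0r. Qed.

Lemma measurable_unit_box : measurable_fun setT (unit_box : rT -> R).
Proof. exact: measurable_indic. Qed.

Lemma integrable_unit_box : lm.-integrable setT (EFin \o unit_box).
Proof. exact: integrable_indic_itv. Qed.

Lemma Rintegral_itv_indic (f : R -> R) (a b : R) :
  \int[lm]_(x in `[a, b]) f x = \int[lm]_x (\1_(`[a, b]%classic : set R) x * f x).
Proof.
rewrite Rintegral_mkcond; apply: eq_Rintegral => x _.
by rewrite patchE indicE; case: ifPn => _; rewrite ?mul1r ?mul0r.
Qed.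

Lemma measurable_mulR : measurable_fun setT (fun z : rT * rT => (z.1 * z.2 : R)).
Proof. by apply: measurable_funM; [exact: measurable_fst|exact: measurable_snd]. Qed.

Lemma measurable_trig2 (u : R -> R) : continuous u ->
  measurable_fun setT (fun z : rT * rT => u (z.1 * z.2)).
Proof.
move=> cu; apply: (measurableT_comp (f := u)); last exact: measurable_mulR.
exact: continuous_measurable_fun.
Qed.

Section weighted.
Context (A : rT -> R) (B : R).
Hypothesis mA : measurable_fun setT A.
Hypothesis AB : forall y, `|A y| <= B * unit_box y.

Let c x := \int[lm]_y (A y * cos (x * y)).
Let s x := \int[lm]_y (A y * sin (x * y)).

Let iB : lm.-integrable setT (EFin \o (fun y : rT => B * unit_box y)).
Proof. exact: (integrableZl measurableT B integrable_unit_box). Qed.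

Lemma trig_integrable (u : R -> R) (x : rT) : continuous u -> (forall y, `|u y| <= 1) ->
  lm.-integrable setT (fun y => (A y * u (x * y))%:E).
Proof.
move=> cu u1; apply: le_integrable iB => //.
- apply/measurable_EFinP; apply: measurable_funM => //.
  exact: (measurableT_comp (measurable_trig2 cu) (pair1_measurable x)).
- move=> y _ /=; rewrite lee_fin normrM; apply: le_trans (ler_norm _).
  by rewrite -[leRHS]mulr1; apply: ler_pM.
Qed.

Lemma measurable_trig_transform (u : R -> R) : continuous u ->
  measurable_fun setT (fun x : rT => \int[lm]_y (A y * u (x * y))).
Proof.
move=> cu; apply: (measurable_Rintegral2 lm (F := fun z : rT * rT => A z.2 * u (z.1 * z.2))).
apply: measurable_funM; first exact: (measurableT_comp mA measurable_snd).
exact: measurable_trig2.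
Qed.

Lemma trig_transform_bound (u : R -> R) (x : R) : continuous u -> (forall y, `|u y| <= 1) ->
  `|\int[lm]_y (A y * u (x * y))| <= \int[lm]_y (B * unit_box y).
Proof.
move=> cu u1; have ti := trig_integrable x cu u1.
apply: le_trans (le_normr_Rintegral measurableT ti) _.
apply: le_Rintegral => //; first exact: (integrable_norm ti).
by move=> y _; rewrite normrM -[leRHS]mulr1; apply: ler_pM.
Qed.

Section weight.
Context (N : R).
Hypothesis N0 : 0 < N.

Let ind x : R := \1_(`[- N, N]%classic : set R) x.
Let h x : R := ind x * (1 - (x / N) ^+ 2).
Let k (y z : R) : R := 16 * N / (1 + (N * (y - z)) ^+ 2).

Let C := \int[lm]_y (B * unit_box y).

Let ind0 x : 0 <= ind x.
Proof. by rewrite /ind indicE; case: (_ \in _); rewrite /= ?lexx ?ler01. Qed.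

Let iind : lm.-integrable setT (EFin \o ind).
Proof. exact: integrable_indic_itv. Qed.

Let h_le x : 0 <= h x <= ind x.
Proof.
rewrite /h /ind indicE; have [xN|_] := boolP (x \in _); last by rewrite /= !mul0r lexx.
move: xN; rewrite inE /= in_itv /= => /andP[x1 x2].
have : 0 <= (x / N) ^+ 2 <= 1.
  rewrite sqr_ge0 /= -real_normK ?num_real // expr_le1 // normrM normfV.
  by rewrite (gtr0_norm N0) ler_pdivrMr // mul1r ler_norml x1 x2.
by move=> /andP[? ?]; rewrite mul1r; apply/andP; split; lra.
Qed.

Let normh x : `|h x| <= ind x.
Proof. by have /andP[h0 h1] := h_le x; rewrite ger0_norm. Qed.

Let mh : measurable_fun setT (h : rT -> R).
Proof.
apply: measurable_funM; first exact: measurable_indic.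
apply: measurable_funB => //; apply: measurable_funX.
by apply: measurable_funM.
Qed.

Let AB0 y : 0 <= B * unit_box y. Proof. exact: le_trans (AB y). Qed.

Let C0 : 0 <= C. Proof. by apply: Rintegral_ge0 => y _. Qed.

Let cC x : `|c x| <= C.
Proof. by apply: trig_transform_bound; [exact: continuous_cos|exact: cos_max]. Qed.

Let sC x : `|s x| <= C.
Proof. by apply: trig_transform_bound; [exact: continuous_sin|exact: sin_max]. Qed.

Let mc : measurable_fun setT (c : rT -> R).
Proof. exact: (measurable_trig_transform (@continuous_cos R)). Qed.

Let ms : measurable_fun setT (s : rT -> R).
Proof. exact: (measurable_trig_transform (@continuous_sin R)). Qed.

Let mh1 : measurable_fun setT (fun z : rT * rT => h z.1).
Proof. exact: (measurableT_comp mh measurable_fst). Qed.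

Let trig_combination x y :
  cos (x * y) * c x + sin (x * y) * s x = \int[lm]_z (A z * cos (x * (y - z))).
Proof.
have ic := trig_integrable x (@continuous_cos R) (@cos_max R).
have is_ := trig_integrable x (@continuous_sin R) (@sin_max R).
rewrite -(RintegralZl _ measurableT ic) -(RintegralZl _ measurableT is_).
rewrite -(RintegralD measurableT (integrableZl measurableT _ ic)
  (integrableZl measurableT _ is_)).
by apply: eq_Rintegral => z _; rewrite mulrBr cosB; ring.
Qed.

(** Each square is written as a double integral, and the integral over x is moved inside, past y and
    then past z. The identity cos(xy) cos(xz) + sin(xy) sin(xz) = cos(x (y - z)) is the reason for
    treating both transforms together. The compact supports of the weight and of [A] give absolute
    convergence. *)
Lemma trig_square_kernel :
  \int[lm]_x (h x * (c x ^+ 2 + s x ^+ 2)) =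
  \int[lm]_y \int[lm]_z (A y * A z * \int[lm]_x (h x * cos (x * (y - z)))).
Proof.
have ic x := trig_integrable x (@continuous_cos R) (@cos_max R).
have is_ x := trig_integrable x (@continuous_sin R) (@sin_max R).
pose G1 (w : rT * rT) : R := h w.1 * (A w.2 *
  (cos (w.1 * w.2) * c w.1 + sin (w.1 * w.2) * s w.1)).
have mA2 : measurable_fun setT (fun z : rT * rT => A z.2).
  exact: (measurableT_comp mA measurable_snd).
have mG1 : measurable_fun setT G1.
  apply: measurable_funM => //; apply: measurable_funM => //.
  apply: measurable_funD; apply: measurable_funM.
  - exact: (measurable_trig2 (@continuous_cos R)).
  - exact: (measurableT_comp mc measurable_fst).
  - exact: (measurable_trig2 (@continuous_sin R)).
  - exact: (measurableT_comp ms measurable_fst).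
have G1le x y : `|G1 (x, y)| <= (2 * C) * ind x * (B * unit_box y).
  rewrite /G1 /= normrM mulrAC mulrC; apply: ler_pM => //.
  rewrite normrM mulrC; apply: ler_pM => //.
  apply: le_trans (ler_normD _ _) _; rewrite !normrM.
  have := ler_pM (normr_ge0 _) (normr_ge0 _) (cos_max (x * y)) (cC x).
  have := ler_pM (normr_ge0 _) (normr_ge0 _) (sin_max (x * y)) (sC x); lra.
have E1 x : h x * (c x ^+ 2 + s x ^+ 2) = \int[lm]_y G1 (x, y).
  rewrite /G1 /= (RintegralZl (h x) measurableT (f := fun y => A y *
    (cos (x * y) * c x + sin (x * y) * s x))); last first.
    apply: eq_integrable (integrableD measurableT
      (integrableZl measurableT (c x) (ic x)) (integrableZl measurableT (s x) (is_ x))) => //.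
    by move=> y _ /=; rewrite -!EFinM -EFinD; congr EFin; ring.
  congr (_ * _); rewrite !expr2.
  rewrite -[X in X + _](RintegralZl _ measurableT (ic x)).
  rewrite -[X in _ + X](RintegralZl _ measurableT (is_ x)).
  rewrite -(RintegralD measurableT (integrableZl measurableT _ (ic x))
    (integrableZl measurableT _ (is_ x))).
  by apply: eq_Rintegral => y _; ring.
under eq_Rintegral do rewrite E1.
rewrite (Rintegral_swap mG1 G1le (integrableZl measurableT (2 * C) iind) iB).
apply: eq_Rintegral => y _.
pose G2 (w : rT * rT) : R := A y * A w.2 * (h w.1 * cos (w.1 * (y - w.2))).
have mG2 : measurable_fun setT G2.
  apply: measurable_funM; first exact: measurable_funM.
  apply: measurable_funM => //; apply: (measurableT_comp (f := @cos R)).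
    exact: continuous_measurable_fun (@continuous_cos R).
  apply: measurable_funM; first exact: measurable_fst.
  by apply: measurable_funB => //; exact: measurable_snd.
have G2le x z : `|G2 (x, z)| <= `|A y| * ind x * (B * unit_box z).
  rewrite /G2 /= (normrM (A y * A z)) (normrM (A y)) (normrM (h x)) -!mulrA; apply: ler_wpM2l => //.
  rewrite mulrCA; apply: ler_pM => //.
  by rewrite -[leRHS]mulr1; apply: ler_pM => //; exact: cos_max.
have E2 x : G1 (x, y) = \int[lm]_z G2 (x, z).
  rewrite /G1 /= trig_combination mulrA.
  rewrite -RintegralZl //; first by apply: eq_Rintegral => z _; rewrite /G2 /=; ring.
  apply: le_integrable iB => //.
    apply/measurable_EFinP; apply: measurable_funM => //.
    apply: (measurableT_comp (f := @cos R)).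
      exact: continuous_measurable_fun (@continuous_cos R).
    by apply: measurable_funM => //; apply: measurable_funB.
  move=> z _ /=; rewrite lee_fin normrM; apply: le_trans (ler_norm _).
  by rewrite -[leRHS]mulr1; apply: ler_pM => //; exact: cos_max.
under eq_Rintegral do rewrite E2.
rewrite (Rintegral_swap mG2 G2le (integrableZl measurableT `|A y| iind) iB).
apply: eq_Rintegral => z _; rewrite -RintegralZl //.
apply: le_integrable iind => //.
  apply/measurable_EFinP; apply: measurable_funM => //.
  apply: (measurableT_comp (f := @cos R)).
    exact: continuous_measurable_fun (@continuous_cos R).
  by apply: measurable_funM.
move=> x _ /=; rewrite lee_fin normrM (ger0_norm (ind0 x)).
by rewrite -[leRHS]mulr1; apply: ler_pM => //; exact: cos_max.
Qed.

Let A_box y : A y * unit_box y = A y.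
Proof.
have := AB y; rewrite /unit_box indicE; case: (_ \in _); rewrite ?mulr1 ?mulr0 //.
by rewrite normr_le0 => /eqP ->.
Qed.

Let iA2 : lm.-integrable setT (fun y : rT => (A y ^+ 2)%:E).
Proof.
apply: le_integrable (integrableZl measurableT B iB) => //.
  by apply/measurable_EFinP; exact: measurable_funX.
move=> y _ /=; rewrite lee_fin; apply: le_trans (ler_norm _).
rewrite normrX expr2; have := AB y; rewrite /unit_box indicE.
case: (_ \in _); rewrite ?mulr1 ?mulr0; first by move=> AyB; exact: ler_pM.
by rewrite normr_le0 => /eqP ->; rewrite normr0 mulr0.
Qed.

Let k0 y z : 0 <= k y z.
Proof. by rewrite /k mulr_ge0 ?mulr_ge0 ?invr_ge0 ?addr_ge0 ?sqr_ge0 // ltW. Qed.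

Let k_le y z : k y z <= 16 * N.
Proof.
rewrite /k ler_pdivrMr ?ltr_pwDl ?sqr_ge0 // ler_peMr ?mulr_ge0 ?(ltW N0) //.
by rewrite lerDl sqr_ge0.
Qed.

Let kC y z : k y z = k z y.
Proof. by rewrite /k -[in RHS]sqrrN -mulrN opprB. Qed.

Let mk : measurable_fun setT (fun w : rT * rT => k w.1 w.2).
Proof.
apply: (measurableT_comp (f := fun u : rT => 16 * N / (1 + (N * u) ^+ 2))).
  apply: continuous_measurable_fun => u; apply: cvgM; first exact: cvg_cst.
  apply: cvgV; first by rewrite gt_eqF // ltr_pwDl ?sqr_ge0.
  apply: cvgD; first exact: cvg_cst.
  by rewrite expr2; under eq_fun do rewrite expr2; apply: cvgM; apply: cvgMr; exact: cvg_id.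
by apply: measurable_funB; [exact: measurable_fst|exact: measurable_snd].
Qed.

Let mass y : \int[lm]_z (unit_box z * k y z) <= 16 * pi.
Proof.
have -> : \int[lm]_z (unit_box z * k y z) =
    16 * \int[lm]_(z in `[- 1, 1]) (N / (1 + (N * (y - z)) ^+ 2)).
  rewrite -RintegralZl //.
    rewrite Rintegral_itv_indic; apply: eq_Rintegral => z _.
    by rewrite /k -mulrA.
  apply: integrable_itv_continuous => z; apply: cvgM; first exact: cvg_cst.
  apply: cvgV; first by rewrite gt_eqF // ltr_pwDl ?sqr_ge0.
  apply: cvgD; first exact: cvg_cst.
  rewrite expr2; under eq_fun do rewrite expr2.
  by apply: cvgM; apply: cvgMr; apply: cvgB; [exact: cvg_cst|exact: cvg_id
                                             |exact: cvg_cst|exact: cvg_id].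
by apply: ler_wpM2l => //; exact: cauchy_kernel_mass.
Qed.

(** This is the Schur test: the kernel is dominated by [k], which is symmetric and whose integral
    over [-1, 1] in either variable is at most 16 pi, uniformly in the other variable and in N. *)
Lemma trig_square_weighted_le :
  \int[lm]_x (h x * (c x ^+ 2 + s x ^+ 2)) <= 16 * pi * \int[lm]_y (A y ^+ 2).
Proof.
rewrite trig_square_kernel.
have iB16 : lm.-integrable setT (EFin \o (fun y : rT => 16 * N * (B * unit_box y))).
  exact: (integrableZl measurableT (16 * N) iB).
pose K u := \int[lm]_x (h x * cos (x * u)).
have Kk y z : `|K (y - z)| <= k y z.
  have := fejer_kernel_bound (y - z) N0; rewrite Rintegral_itv_indic.
  by rewrite /K; under eq_Rintegral do rewrite mulrA.
pose F1 (w : rT * rT) : R := A w.1 * A w.2 * K (w.1 - w.2).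
pose F3 (w : rT * rT) : R := A w.1 ^+ 2 * (unit_box w.2 * k w.1 w.2).
have mA1 : measurable_fun setT (fun z : rT * rT => A z.1).
  exact: (measurableT_comp mA measurable_fst).
have mA2 : measurable_fun setT (fun z : rT * rT => A z.2).
  exact: (measurableT_comp mA measurable_snd).
have mF1 : measurable_fun setT F1.
  apply: measurable_funM; first exact: measurable_funM.
  apply: (measurableT_comp (f := K : rT -> R)).
    apply: (measurable_Rintegral2 lm (F := fun z : rT * rT => h z.2 * cos (z.2 * z.1))).
    apply: measurable_funM; first exact: (measurableT_comp mh measurable_snd).
    apply: (measurableT_comp (f := @cos R)).
      exact: continuous_measurable_fun (@continuous_cos R).
    by apply: measurable_funM; [exact: measurable_snd|exact: measurable_fst].
  by apply: measurable_funB; [exact: measurable_fst|exact: measurable_snd].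
have F1le y z : `|F1 (y, z)| <= B * unit_box y * (16 * N * (B * unit_box z)).
  rewrite /F1 /= !normrM -mulrA; apply: ler_pM => //; rewrite ?mulr_ge0 // mulrC.
  by apply: ler_pM => //; apply: le_trans (Kk y z) (k_le y z).
have mF3 : measurable_fun setT F3.
  apply: measurable_funM; first exact: measurable_funX.
  apply: measurable_funM => //.
  exact: (measurableT_comp measurable_unit_box measurable_snd).
have F3le y z : `|F3 (y, z)| <= A y ^+ 2 * (16 * N * unit_box z).
  have /andP[u0 _] := unit_box01 z.
  rewrite /F3 /= ger0_norm; last by rewrite mulr_ge0 ?sqr_ge0 // mulr_ge0.
  by apply: ler_wpM2l; rewrite ?sqr_ge0 // mulrC ler_wpM2r.
have ibox16 : lm.-integrable setT (EFin \o (fun y : rT => 16 * N * unit_box y)).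
  exact: (integrableZl measurableT (16 * N) integrable_unit_box).
pose F4 (w : rT * rT) : R := F3 (w.2, w.1).
have mF4 : measurable_fun setT F4.
  exact: (measurableT_comp mF3 (@measurable_swap _ _ _ _)).
have F4le y z : `|F4 (y, z)| <= 16 * N * unit_box y * A z ^+ 2.
  by rewrite mulrC; exact: F3le.
(* A(y) A(z) is regrouped as (A(y) box(z)) (A(z) box(y)). Each square then retains the indicator of
   the other variable, so that only the mass of the kernel over [-1, 1] is needed. *)
have F134 y z : F1 (y, z) <= 2^-1 * F3 (y, z) + 2^-1 * F4 (y, z).
  have -> : F1 (y, z) = (A y * unit_box z) * (A z * unit_box y) * K (y - z).
    by rewrite /F1 /= -[in LHS](A_box y) -[in LHS](A_box z); ring.
  set a := A y * unit_box z; set b := A z * unit_box y.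
  have -> : F3 (y, z) = a ^+ 2 * k y z.
    by rewrite /F3 /= /a exprMn [unit_box z ^+ 2]expr2 unit_box_sqr mulrA.
  have -> : F4 (y, z) = b ^+ 2 * k y z.
    by rewrite /F4 /F3 /= /b exprMn [unit_box y ^+ 2]expr2 unit_box_sqr mulrA (kC z).
  apply: le_trans (ler_norm _) _; rewrite normrM.
  apply: le_trans (ler_wpM2l (normr_ge0 _) (Kk y z)) _.
  rewrite -mulrDr -mulrDl mulrA; apply: ler_wpM2r => //.
  have := sqr_ge0 (a - b); have := sqr_ge0 (a + b); rewrite ler_norml sqrrB sqrrD.
  by move=> *; apply/andP; split; lra.
have i1 := tensor_dominated_partial mF1 F1le iB iB16.
have i3 := tensor_dominated_partial mF3 F3le iA2 ibox16.
have i4 := tensor_dominated_partial mF4 F4le ibox16 iA2.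
have j1 y := tensor_dominated_integrable_y mF1 F1le iB16 y.
have j3 y := tensor_dominated_integrable_y mF3 F3le ibox16 y.
have j4 y := tensor_dominated_integrable_y mF4 F4le iA2 y.
have half (f : rT -> R) : lm.-integrable setT (fun y => (f y)%:E) ->
   lm.-integrable setT (fun y => (2^-1 * f y)%:E).
  by move=> fi; exact: (integrableZl measurableT 2^-1 fi).
apply: (@le_trans _ _ (\int[lm]_y (2^-1 * \int[lm]_z F3 (y, z)
    + 2^-1 * \int[lm]_z F4 (y, z)))).
  apply: le_Rintegral; [exact: measurableT|exact: i1
    |exact: (integrableD measurableT (half _ i3) (half _ i4))|].
  move=> y _; rewrite -(RintegralZl _ measurableT (j3 y)) -(RintegralZl _ measurableT (j4 y)).
  rewrite -(RintegralD measurableT (half _ (j3 y)) (half _ (j4 y))).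
  apply: le_Rintegral; [exact: measurableT|exact: j1
    |exact: (integrableD measurableT (half _ (j3 y)) (half _ (j4 y)))|].
  by move=> z _; exact: F134.
rewrite (RintegralD measurableT (half _ i3) (half _ i4)).
rewrite (RintegralZl _ measurableT i3) (RintegralZl _ measurableT i4).
rewrite (Rintegral_swap mF4 F4le ibox16 iA2).
have -> : \int[lm]_y \int[lm]_x F4 (x, y) = \int[lm]_y \int[lm]_z F3 (y, z) by [].
rewrite -mulrDl (_ : 2^-1 + 2^-1 = 1) ?mul1r; last by lra.
rewrite -(RintegralZl _ measurableT iA2); apply: le_Rintegral => //.
  exact: (integrableZl measurableT (16 * pi) iA2).
move=> y _; rewrite /F3 /= RintegralZl //.
  by rewrite mulrC ler_wpM2r ?sqr_ge0.
apply: le_integrable ibox16 => //.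
  apply/measurable_EFinP; apply: measurable_funM; first exact: measurable_unit_box.
  exact: (measurableT_comp mk (pair1_measurable y)).
move=> z _ /=; rewrite lee_fin; apply: le_trans (ler_norm _).
have /andP[u0 _] := unit_box01 z.
by rewrite normrM (ger0_norm u0) (ger0_norm (k0 y z)) mulrC ler_wpM2r.
Qed.

End weight.
End weighted.
End weighted_line.

(** * The Bessel inequality on the line *)

Section bessel_line.
Context {R : realType}.
Local Notation rT := (measurableTypeR R).
Local Notation lm := (@lebesgue_measure R).
Local Notation mun n := (@lebesgue_tuple R n).

Lemma le_integral_exhaustion (g : rT -> R) (C : R) :
  measurable_fun setT g -> (forall x, 0 <= g x) ->
  (forall k : nat, \int[lm]_(x in `[(- k%:R)%R, (k%:R)%R]) (g x)%:E <= C%:E)%E ->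
  (\int[lm]_x (g x)%:E <= C%:E)%E.
Proof.
move=> mg g0 gC; pose F (k : nat) : set rT := `[- k%:R, k%:R]%classic.
have ndF : nondecreasing_seq F.
  move=> i j ij; apply/subsetPset => x; rewrite /F /= !in_itv /= => /andP[x1 x2].
  have h : i%:R <= j%:R :> R by rewrite ler_nat.
  by apply/andP; split; lra.
have mF k : measurable (F k) by exact: measurable_itv.
have mfF k : measurable_fun (F k) (EFin \o g).
  by apply: measurable_funTS; exact/measurable_EFinP.
have := @ge0_nondecreasing_set_cvg_integral _ _ _ F (EFin \o g) lm ndF mF mfF
  (fun i x _ => g0 x).
rewrite (_ : \bigcup_i F i = setT)%classic; last first.
  apply/seteqP; split => // x _; have [k xk] : exists k : nat, `|x| <= k%:R.
    by exists (Num.truncn `|x|).+1; exact/ltW/truncnS_gt.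
  by exists k => //; rewrite /F /= in_itv /= -ler_norml.
move=> cv; rewrite -(cvg_lim _ cv) //; apply: lime_le.
  by apply/cvg_ex; eexists; exact: cv.
by near=> k; exact: gC.
Unshelve. all: by end_near. Qed.

Lemma trig_square_le (A : rT -> R) (B : R) :
  measurable_fun setT A -> (forall y, `|A y| <= B * unit_box y) ->
  (\int[lm]_x ((\int[lm]_y (A y * cos (x * y))) ^+ 2 +
               (\int[lm]_y (A y * sin (x * y))) ^+ 2)%:E
   <= (32 * pi * \int[lm]_y (A y ^+ 2))%:E)%E.
Proof.
move=> mA AB.
have mc := measurable_trig_transform mA (@continuous_cos R).
have ms := measurable_trig_transform mA (@continuous_sin R).
set c := fun x : rT => \int[lm]_y (A y * cos (x * y)).
set s := fun x : rT => \int[lm]_y (A y * sin (x * y)).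
have mg : measurable_fun setT (fun x => c x ^+ 2 + s x ^+ 2).
  by apply: measurable_funD; apply: measurable_funX.
have g0 x : 0 <= c x ^+ 2 + s x ^+ 2 by rewrite addr_ge0 ?sqr_ge0.
apply: le_integral_exhaustion => // k.
(* With this width the weight is at least 1/2 on [-k, k], whence 32 pi in place of 16 pi. The
   successor keeps [N] positive for k = 0. *)
pose N : R := 2 * k.+1%:R.
have k0 : 0 <= k%:R :> R by [].
have kN : k%:R <= N / 2 by rewrite /N mulrC mulKf // ler_nat.
have N0 : 0 < N by rewrite mulr_gt0 // ltr0n.
have Hw := trig_square_weighted_le mA AB N0.
set J := \int[lm]_y (A y ^+ 2) in Hw *.
pose h x : R := \1_(`[- N, N]%classic : set R) x * (1 - (x / N) ^+ 2).
have mh : measurable_fun setT (h : rT -> R).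
  apply: measurable_funM; first exact: measurable_indic.
  by apply: measurable_funB => //; apply: measurable_funX; exact: measurable_funM.
have h0 x : 0 <= h x.
  rewrite /h indicE; have [xN|_] := boolP (x \in _); last by rewrite mul0r.
  move: xN; rewrite inE /= in_itv /= => /andP[x1 x2].
  rewrite mul1r subr_ge0 -real_normK ?num_real // expr_le1 // normrM normfV.
  by rewrite (gtr0_norm N0) ler_pdivrMr // mul1r ler_norml x1 x2.
have hhalf x : x \in (`[- k%:R, k%:R] : interval R) -> 2^-1 <= h x.
  rewrite in_itv /= => /andP[x1 x2]; rewrite /h indicE mem_set ?mul1r; last first.
    by rewrite /= in_itv /=; apply/andP; split; lra.
  have : (x / N) ^+ 2 <= 2^-1 ^+ 2.
    rewrite -[(x / N) ^+ 2]real_normK ?num_real //; apply: lerXn2r; rewrite ?nnegrE //.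
    rewrite normrM normfV (gtr0_norm N0) ler_pdivrMr // ler_norml.
    by apply/andP; split; lra.
  by rewrite [2^-1 ^+ 2]expr2; lra.
have mhg : measurable_fun setT (fun x : rT => h x * (c x ^+ 2 + s x ^+ 2)).
  exact: measurable_funM.
apply: (@le_trans _ _ (\int[lm]_x (2 * (h x * (c x ^+ 2 + s x ^+ 2)))%:E)%E).
  apply: (@le_trans _ _ (\int[lm]_(x in `[(- k%:R)%R, (k%:R)%R])
     (2 * (h x * (c x ^+ 2 + s x ^+ 2)))%:E)%E).
    apply: ge0_le_integral => //.
    - by move=> x _; rewrite lee_fin; exact: g0.
    - by apply/measurable_EFinP; exact: measurable_funTS.
    - by apply/measurable_EFinP; apply: measurable_funTS; exact: measurable_funM.
    - move=> x xk; rewrite lee_fin mulrA; apply: ler_peMl; first exact: g0.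
      by have hx := hhalf x xk; lra.
  apply: ge0_subset_integral => //.
  - by apply/measurable_EFinP; exact: measurable_funM.
  - by move=> x _; rewrite lee_fin mulr_ge0 // mulr_ge0.
have cC x : `|c x| <= \int[lm]_y (B * unit_box y).
  exact: (trig_transform_bound mA AB x (@continuous_cos R) (@cos_max R)).
have sC x : `|s x| <= \int[lm]_y (B * unit_box y).
  exact: (trig_transform_bound mA AB x (@continuous_sin R) (@sin_max R)).
set C := \int[lm]_y (B * unit_box y) in cC sC.
have C0 : 0 <= C by exact: le_trans (cC 0).
have hi : lm.-integrable setT (fun x : rT => (h x * (c x ^+ 2 + s x ^+ 2))%:E).
  have ii : lm.-integrable setT (EFin \o \1_(`[- N, N]%classic : set R)).
    exact: integrable_indic_itv.
  apply: le_integrable (integrableZl measurableT (2 * C ^+ 2) ii) => //.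
    exact/measurable_EFinP.
  move=> x _ /=; rewrite lee_fin; apply: le_trans (ler_norm _).
  rewrite normrM mulrC; apply: ler_pM => //.
    rewrite ger0_norm //; have sq (u : R) : `|u| <= C -> u ^+ 2 <= C ^+ 2.
      by move=> uC; rewrite -[u ^+ 2]real_normK ?num_real //; apply: lerXn2r; rewrite ?nnegrE.
    by have := sq _ (cC x); have := sq _ (sC x); lra.
  rewrite ger0_norm // /h indicE; case: (_ \in _); rewrite ?mul0r ?mul1r //.
  by rewrite lerBlDr lerDl sqr_ge0.
have -> : (\int[lm]_x (2 * (h x * (c x ^+ 2 + s x ^+ 2)))%:E =
   (2 * \int[lm]_x (h x * (c x ^+ 2 + s x ^+ 2)))%:E)%E.
  rewrite EFinM fineK; last by apply: integrable_fin_num.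
  rewrite -ge0_integralZl_EFin //; last exact/measurable_EFinP.
  by move=> x _; rewrite lee_fin mulr_ge0.
by rewrite lee_fin; move: Hw; rewrite -/h; lra.
Qed.

Lemma trig_kernel_dominated (u : R -> R) : continuous u -> (forall y, `|u y| <= 1) ->
  dominated_kernel lm (fun z : rT * rT => u (z.1 * z.2) * unit_box z.2) unit_box.
Proof.
move=> cu u1; split; last exact: integrable_unit_box.
- apply: measurable_funM; first exact: measurable_trig2.
  exact: (measurableT_comp measurable_unit_box measurable_snd).
- move=> x y /=; rewrite normrM -[leRHS]mul1r; apply: ler_pM => //.
  by rewrite ger0_norm //; have /andP[] := unit_box01 y.
Qed.

Lemma bessel_line (u : R -> R) : u = cos \/ u = sin ->
  bessel lm lm (fun z : rT * rT => u (z.1 * z.2) * unit_box z.2) unit_box (32 * pi).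
Proof.
move=> ucs a B ma aB.
pose A (y : rT) := a y * unit_box y.
have mA : measurable_fun setT A.
  by apply: measurable_funM => //; exact: measurable_unit_box.
have AB y : `|A y| <= B * unit_box y.
  have /andP[u0 _] := unit_box01 y.
  by rewrite normrM (ger0_norm u0) ler_wpM2r.
have H := trig_square_le mA AB.
have iA2 : lm.-integrable setT (fun y : rT => (A y ^+ 2)%:E).
  have B0 : 0 <= B by exact: le_trans (aB 0).
  apply: le_integrable (integrableZl measurableT (B ^+ 2) integrable_unit_box) => //.
    by apply/measurable_EFinP; exact: measurable_funX.
  move=> y _ /=; rewrite lee_fin; apply: le_trans (ler_norm _).
  rewrite /A exprMn normrM [unit_box y ^+ 2]expr2 unit_box_sqr.
  have /andP[u0 _] := unit_box01 y; rewrite (ger0_norm u0) ler_wpM2r //.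
  by rewrite normrX; apply: lerXn2r; rewrite ?nnegrE //; exact: aB.
have -> : (\int[lm]_y (a y ^+ 2 * unit_box y)%:E = (\int[lm]_y (A y ^+ 2))%:E)%E.
  rewrite fineK; last by apply: integrable_fin_num.
  apply: eq_integral => y _; congr EFin.
  by rewrite /A exprMn [unit_box y ^+ 2]expr2 unit_box_sqr.
rewrite -EFinM; apply: le_trans H; apply: ge0_le_integral => //.
- by move=> x _; rewrite lee_fin sqr_ge0.
- apply/measurable_EFinP; apply: measurable_funX.
  apply: measurable_kernel_transform (trig_kernel_dominated _ _) ma.
  + by case: ucs => ->; [exact: continuous_cos|exact: continuous_sin].
  + by case: ucs => -> y; [exact: cos_max|exact: sin_max].
- apply/measurable_EFinP; apply: measurable_funD; apply: measurable_funX.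
  + have mc := measurable_trig_transform mA (@continuous_cos R).
    exact: mc.
  + have ms := measurable_trig_transform mA (@continuous_sin R).
    exact: ms.
- move=> x _; rewrite lee_fin.
  have -> : \int[lm]_y (a y * (u (x * y) * unit_box y)) = \int[lm]_y (A y * u (x * y)).
    by apply: eq_Rintegral => y _; rewrite /A; ring.
  by case: ucs => ->; rewrite ?lerDl ?lerDr sqr_ge0.
Qed.

End bessel_line.

(** * Tensorisation of the Bessel inequality *)

Section bessel_tuple.
Context {R : realType}.
Local Notation rT := (measurableTypeR R).
Local Notation lm := (@lebesgue_measure R).
Local Notation mun n := (@lebesgue_tuple R n).

Definition tdot n (x y : n.-tuple rT) : R := \sum_(i < n) tnth x i * tnth y i.

Definition unit_cube n (y : n.-tuple rT) : R := \prod_(i < n) unit_box (tnth y i).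

Lemma unit_cube01 n (y : n.-tuple rT) : 0 <= unit_cube y <= 1.
Proof.
apply: (big_ind (fun x => 0 <= x <= 1)); first by rewrite lexx ler01.
  by move=> u v /andP[u0 u1] /andP[v0 v1]; rewrite mulr_ge0 //= mulr_ile1.
by move=> i _; exact: unit_box01.
Qed.

Lemma unit_cube_sqr n (y : n.-tuple rT) : unit_cube y * unit_cube y = unit_cube y.
Proof.
by rewrite /unit_cube -big_split; apply: eq_bigr => i _; exact: unit_box_sqr.
Qed.

Lemma measurable_unit_cube n : measurable_fun setT (@unit_cube n).
Proof. exact: measurable_tuple_prod measurable_unit_box. Qed.

Lemma integral_unit_cube n : (\int[mun n]_y (unit_cube y)%:E = (2 ^+ n)%:E)%E.
Proof.
apply: integral_tuple_prod; first exact: measurable_unit_box.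
- by move=> x; have /andP[] := unit_box01 x.
- rewrite integral_indic // setIT.
  apply: etrans (lebesgue_measure_itv `[(- 1 : R), 1]) _.
  by rewrite /= lte_fin ifT -?EFinB; [congr EFin; ring|lra].
Qed.

Lemma integrable_unit_cube n : (mun n).-integrable setT (EFin \o @unit_cube n).
Proof.
apply/integrableP; split; first by apply/measurable_EFinP; exact: measurable_unit_cube.
under eq_integral => y _.
  rewrite /= ger0_norm; last by have /andP[] := unit_cube01 y.
  over.
by rewrite /= integral_unit_cube ltry.
Qed.

Lemma measurable_tdot n :
  measurable_fun setT (fun z : n.-tuple rT * n.-tuple rT => tdot z.1 z.2).
Proof.
apply: measurable_sum => i; apply: measurable_funM.
  exact: (measurableT_comp (measurable_tnth i) measurable_fst).
exact: (measurableT_comp (measurable_tnth i) measurable_snd).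
Qed.

Lemma tdot_tcons n (x y : rT * n.-tuple rT) :
  tdot (tcons x) (tcons y) = x.1 * y.1 + tdot x.2 y.2.
Proof.
rewrite /tdot big_ord_recl; congr (_ + _).
by apply: eq_bigr => i _; rewrite /tcons /= !(tnth_nth x.1).
Qed.

Lemma unit_cube_tcons n (y : rT * n.-tuple rT) :
  unit_cube (tcons y) = unit_box y.1 * unit_cube y.2.
Proof.
rewrite /unit_cube big_ord_recl; congr (_ * _).
by apply: eq_bigr => i _; rewrite /tcons /= !(tnth_nth y.1).
Qed.

Definition trig_kernel (u : R -> R) n (z : n.-tuple rT * n.-tuple rT) : R :=
  u (tdot z.1 z.2) * unit_cube z.2.

Lemma trig_kernel_tuple_dominated (u : R -> R) n :
  continuous u -> (forall y, `|u y| <= 1) ->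
  dominated_kernel (mun n) (@trig_kernel u n) (@unit_cube n).
Proof.
move=> cu u1; split; last exact: integrable_unit_cube.
- apply: measurable_funM.
    apply: (measurableT_comp (f := u)); last exact: measurable_tdot.
    exact: continuous_measurable_fun.
  exact: (measurableT_comp (@measurable_unit_cube n) measurable_snd).
- move=> x y /=; rewrite normrM -[leRHS]mul1r; apply: ler_pM => //.
  by rewrite ger0_norm //; have /andP[] := unit_cube01 y.
Qed.

Lemma bessel_tcons n (phi : n.+1.-tuple rT * n.+1.-tuple rT -> R) (psi : n.+1.-tuple rT -> R)
    (K : R) :
  dominated_kernel (mun n.+1) phi psi ->
  bessel (lm \x mun n)%E (lm \x mun n)%E
    (fun z => phi (tcons z.1, tcons z.2)) (fun y => psi (tcons y)) K ->
  bessel (mun n.+1) (mun n.+1) phi psi K.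
Proof.
move=> dk b a B ma aB; have [mphi phile ipsi] := dk.
have mpsi : measurable_fun setT psi by apply/measurable_EFinP; exact: measurable_int ipsi.
have psi0 y : 0 <= psi y := dominated_psi_ge0 dk y y.
rewrite ge0_integral_tupleS; last 2 first.
- apply/measurable_EFinP; apply: measurable_funX.
  exact: measurable_kernel_transform dk ma.
- by move=> x; rewrite lee_fin sqr_ge0.
rewrite [leRHS]muleC ge0_integral_tupleS; last 2 first.
- apply/measurable_EFinP; apply: measurable_funM => //; exact: measurable_funX.
- by move=> y; rewrite lee_fin mulr_ge0 // sqr_ge0.
rewrite muleC; under eq_integral => x _.
  rewrite Rintegral_tupleS; last first.
    by apply: measurable_funM => //; exact: measurableT_comp (pair1_measurable _).
  over.
by apply: (b (fun y => a (tcons y)) B) => //; exact: measurableT_comp (@measurable_tcons R n).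
Qed.

(** This is (128 pi)^n: each coordinate contributes 32 pi from the line and a factor 4 from the two
    products in the addition formula. *)
Fixpoint bessel_cst (n : nat) : R :=
  if n is n'.+1 then 2 * (32 * pi * bessel_cst n') + 2 * (32 * pi * bessel_cst n') else 1.

Lemma bessel_cst_ge0 n : 0 <= bessel_cst n.
Proof.
elim: n => //= n IH; have p0 : 0 <= 32 * pi * bessel_cst n.
  by rewrite !mulr_ge0 // pi_ge0.
by rewrite addr_ge0 // mulr_ge0.
Qed.

Lemma bessel_tuple n (u : R -> R) : u = cos \/ u = sin ->
  bessel (mun n) (mun n) (@trig_kernel u n) (@unit_cube n) (bessel_cst n).
Proof.
have cs (v : R -> R) : v = cos \/ v = sin -> continuous v /\ (forall y, `|v y| <= 1).
  by case=> ->; split; [exact: continuous_cos|exact: cos_max|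
                        exact: continuous_sin|exact: sin_max].
have dk k (v : R -> R) : v = cos \/ v = sin ->
    dominated_kernel (mun k) (@trig_kernel v k) (@unit_cube k).
  by move=> /cs[cv v1]; exact: trig_kernel_tuple_dominated.
(* The induction runs over both functions at once, because each addition formula involves both. *)
elim: n u => [|n IH] u ucs.
  move=> a B ma aB; rewrite mul1e.
  rewrite ge0_integral_tuple0; last first.
    by apply/measurable_EFinP/measurable_funX; exact: measurable_kernel_transform (dk _ _ ucs) ma.
  rewrite ge0_integral_tuple0; last first.
    apply/measurable_EFinP; apply: measurable_funM; first exact: measurable_funX.
    exact: measurable_unit_cube.
  have -> : \int[mun 0]_y (a y * trig_kernel u ([tuple], y)) =
      a [tuple] * trig_kernel u ([tuple], [tuple]).
    rewrite /Rintegral integral_dirac ?diracT ?mul1e //.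
    apply/measurable_EFinP; apply: measurable_funM => //.
    have [mk _ _] := dk 0%N _ ucs; exact: measurableT_comp (pair1_measurable _).
  rewrite lee_fin /trig_kernel /unit_cube !big_ord0 !mulr1 exprMn.
  apply: ler_piMr; first exact: sqr_ge0.
  by rewrite -real_normK ?num_real // expr_le1 //; have [_ ->] := cs _ ucs.
apply: bessel_tcons; first exact: dk.
pose k1 (v : R -> R) (z : rT * rT) : R := v (z.1 * z.2) * unit_box z.2.
pose P (v1 v2 : R -> R) (z : (rT * n.-tuple rT) * (rT * n.-tuple rT)) : R :=
  k1 v1 (z.1.1, z.2.1) * trig_kernel v2 (z.1.2, z.2.2).
pose Q (y : rT * n.-tuple rT) : R := unit_box y.1 * unit_cube y.2.
have dk1 v : v = cos \/ v = sin -> dominated_kernel lm (k1 v) unit_box.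
  by move=> /cs[cv v1]; exact: trig_kernel_dominated.
have dP v1 v2 : v1 = cos \/ v1 = sin -> v2 = cos \/ v2 = sin ->
    dominated_kernel (lm \x mun n)%E (P v1 v2) Q.
  by move=> h1 h2; exact: dominated_kernel_prod (dk1 _ h1) (dk _ _ h2).
have pi32 : 0 <= 32 * pi :> R by rewrite mulr_ge0 // pi_ge0.
have bP v1 v2 : v1 = cos \/ v1 = sin -> v2 = cos \/ v2 = sin ->
    bessel (lm \x mun n)%E (lm \x mun n)%E (P v1 v2) Q (32 * pi * bessel_cst n).
  move=> h1 h2 a B ma aB.
  apply: (bessel_prod (dk1 _ h1) (dk _ _ h2) ma aB _ _ pi32 (bessel_cst_ge0 n)).
  - by move=> y; have /andP[] := unit_box01 y.
  - by move=> y; have /andP[] := unit_cube01 y.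
  - exact: bessel_line.
  - exact: IH.
have tP v1 v2 : v1 = cos \/ v1 = sin -> v2 = cos \/ v2 = sin ->
    measurable_transform (lm \x mun n)%E (P v1 v2).
  move=> h1 h2 a B ma aB.
  exact: (measurable_product_kernel_transform (dk1 _ h1) (dk _ _ h2) ma aB).
have QE : (fun y => unit_cube (tcons y)) = Q by apply/funext => y; exact: unit_cube_tcons.
have c0 : 0 <= 32 * pi * bessel_cst n by rewrite mulr_ge0 // bessel_cst_ge0.
have lc : @cos R = cos \/ @cos R = sin by left.
have rs : @sin R = cos \/ @sin R = sin by right.
rewrite QE /=; case: ucs => ->.
- rewrite (_ : (fun z => _) = (fun z => P cos cos z + (- 1) * P sin sin z)).
    have e1 : (- 1) ^+ 2 = 1 :> R by rewrite sqrrN expr1n.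
    exact: (bessel_sum (dP _ _ lc lc) (dP _ _ rs rs) (tP _ _ lc lc) (tP _ _ rs rs) e1 (bP _ _ lc lc) (bP _ _ rs rs) c0 c0).
  apply/funext => -[x y]; rewrite /trig_kernel /P /k1 /= tdot_tcons unit_cube_tcons cosD.
  by rewrite /trig_kernel /=; ring.
- rewrite (_ : (fun z => _) = (fun z => P sin cos z + 1 * P cos sin z)).
    have e1 : 1 ^+ 2 = 1 :> R by rewrite expr1n.
    exact: (bessel_sum (dP _ _ rs lc) (dP _ _ lc rs) (tP _ _ rs lc) (tP _ _ lc rs) e1 (bP _ _ rs lc) (bP _ _ lc rs) c0 c0).
  apply/funext => -[x y]; rewrite /trig_kernel /P /k1 /= tdot_tcons unit_cube_tcons sinD.
  by rewrite /trig_kernel /=; ring.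
Qed.

End bessel_tuple.

(** * From L^p to L^2 by duality *)

Section lnorm_tools.
Context {R : realType} d (T : measurableType d) (mu : {measure set T -> \bar R}).
Local Open Scope ereal_scope.

(** Pointwise |H|^q <= B^(q - 2) H^2. The exponents are expressed through 1/q so that the same
    formula covers q = +oo, where 1/q is 0 and the bound is B. *)
Lemma Lnorm_interpolation (H : T -> R) (A B : R) (q : \bar R) :
  measurable_fun setT H -> (0 <= A)%R -> (0 <= B)%R -> 2%:E <= q ->
  (forall x, `|H x| <= B)%R -> \int[mu]_x (H x ^+ 2)%:E <= (A ^+ 2)%:E ->
  Lnorm mu q (EFin \o H) <= (B `^ (1 - 2 * fine q^-1) * A `^ (2 * fine q^-1))%:E.
Proof.
move=> mH A0 B0; case: q => [r|_|//] => [|HB _]; last first.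
  rewrite invey /= mulr0 subr0 powRr1 // powRr0 mulr1 unlock.
  case: ifPn => [mu0|_]; last by rewrite lee_fin.
  by apply/ess_supP; apply: aeW => x /=; rewrite lee_fin; exact: HB.
rewrite lee_fin => r2 HB HA; have r0 : (0 < r)%R by apply: lt_le_trans r2.
have rn0 : r != 0%R by rewrite gt_eqF.
rewrite inver (negbTE rn0) /= unlock.
have step : \int[mu]_x (`|(EFin \o H) x| `^ r) <= (B `^ (r - 2) * A ^+ 2)%:E.
  apply: (@le_trans _ _ (\int[mu]_x ((B `^ (r - 2))%:E * (H x ^+ 2)%:E))).
    apply: ge0_le_integral => //.
    - by move=> x _; exact: poweR_ge0.
    - rewrite (_ : (fun x => _) = (fun x => (`|H x| `^ r)%:E)); last by apply/funext.
      apply/measurable_EFinP; apply: (measurableT_comp (measurable_powR r)).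
      exact: measurableT_comp.
    - by apply: measurable_funeM; apply/measurable_EFinP; exact: measurable_funX.
    - move=> x _; rewrite (_ : `|_| `^ r = (`|H x| `^ r)%:E) // -EFinM lee_fin.
      have [->|Hx] := eqVneq (H x) 0%R.
        by rewrite normr0 powR0 // mulr_ge0 ?powR_ge0 ?sqr_ge0.
      have Hx0 : (0 < `|H x|)%R by rewrite normr_gt0.
      have -> : r = ((r - 2) + 2)%R by rewrite subrK.
      rewrite powRD; last by rewrite (gt_eqF Hx0) implybT.
      rewrite (powR_mulrn 2) // real_normK ?num_real //.
      apply: ler_wpM2r; first exact: sqr_ge0.
      have -> : (r - 2 + 2 - 2 = r - 2)%R by rewrite addrK.
      by apply: ge0_ler_powR; rewrite ?subr_ge0 ?nnegrE //; exact: HB.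
  rewrite ge0_integralZl_EFin ?powR_ge0 //.
  - by rewrite EFinM; apply: lee_wpmul2l; rewrite ?lee_fin ?powR_ge0.
  - by move=> x _; rewrite lee_fin sqr_ge0.
  - by apply/measurable_EFinP; exact: measurable_funX.
apply: le_trans (gt0_ler_poweR _ _ _ step) _.
- by rewrite invr_ge0 ltW.
- rewrite in_itv /= leey andbT; apply: integral_ge0 => x _.
  by rewrite lee_fin; exact: powR_ge0.
- by rewrite in_itv /= leey andbT lee_fin mulr_ge0 ?powR_ge0 ?sqr_ge0.
rewrite poweR_EFin lee_fin powRM ?powR_ge0 ?sqr_ge0 //.
rewrite -powR_mulrn // -!powRrM mulrBl mulfV //.
Qed.

Lemma Lnorm2_le (f : T -> R) (F : R) : (0 <= F)%R ->
  \int[mu]_x (f x ^+ 2)%:E <= (F ^+ 2)%:E -> Lnorm mu 2%:E (EFin \o f) <= F%:E.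
Proof.
move=> F0 fF; rewrite unlock.
have -> : \int[mu]_x (`|(EFin \o f) x| `^ 2) = \int[mu]_x (f x ^+ 2)%:E.
  apply: eq_integral => x _.
  by rewrite (_ : `|_| `^ 2 = (`|f x| `^ 2)%:E) // (powR_mulrn 2) // real_normK ?num_real.
apply: le_trans (gt0_ler_poweR _ _ _ fF) _.
- by rewrite invr_ge0.
- by rewrite in_itv /= leey andbT; apply: integral_ge0 => x _; rewrite lee_fin sqr_ge0.
- by rewrite in_itv /= leey andbT lee_fin sqr_ge0.
by rewrite poweR_EFin lee_fin -powR_mulrn // -powRrM mulfV // powRr1.
Qed.

Lemma integral_CauchySchwarz (f g : T -> R) (F G : R) :
  measurable_fun setT f -> measurable_fun setT g -> (0 <= F)%R -> (0 <= G)%R ->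
  \int[mu]_x (f x ^+ 2)%:E <= (F ^+ 2)%:E ->
  \int[mu]_x (g x ^+ 2)%:E <= (G ^+ 2)%:E ->
  \int[mu]_x (`|f x * g x|)%:E <= (F * G)%:E.
Proof.
move=> mf mg F0 G0 fF gG.
have h2 : (2^-1 + 2^-1 = 1 :> R)%R by lra.
have := @hoelder _ _ _ mu f g 2 2 mf mg (ltr0n _ 2) (ltr0n _ 2) h2.
rewrite Lnorm1 => /le_trans; apply; rewrite EFinM; apply: lee_pmul.
- exact: Lnorm_ge0.
- exact: Lnorm_ge0.
- exact: Lnorm2_le.
- exact: Lnorm2_le.
Qed.

End lnorm_tools.

Section restriction.
Context {R : realType}.

Lemma conjugate_exponent (p : R) : 1 < p -> p <= 2 ->
  let q := p / (p - 1) in [/\ 0 < p, 0 < q, 2 <= q & p^-1 + q^-1 = 1].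
Proof.
move=> p1 p2 q; have p0 : 0 < p by lra.
have p10 : 0 < p - 1 by lra.
have q2 : 2 <= q by rewrite /q ler_pdivlMr //; lra.
split => //; first by lra.
by rewrite /q invf_div -[X in X + _]mul1r -mulrDl addrC subrK divff ?gt_eqF.
Qed.

Local Notation rT := (measurableTypeR R).
Local Notation mun n := (@lebesgue_tuple R n).

Definition trig_transform (u : R -> R) n (g : n.-tuple rT -> R) (y : n.-tuple rT) : R :=
  \int[mun n]_x (g x * u (tdot x y)).

Lemma tdotC n (x y : n.-tuple rT) : tdot x y = tdot y x.
Proof. by apply: eq_bigr => i _; rewrite mulrC. Qed.

Lemma measurable_trig_tdot (u : R -> R) n (y : n.-tuple rT) : continuous u ->
  measurable_fun setT (fun x : n.-tuple rT => u (tdot x y)).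
Proof.
move=> cu; apply: (measurableT_comp (f := u)); first exact: continuous_measurable_fun.
exact: (measurableT_comp (@measurable_tdot R n) (pair2_measurable y)).
Qed.

Lemma cos_sin_bounded (u : R -> R) : u = cos \/ u = sin ->
  continuous u /\ (forall y, `|u y| <= 1).
Proof.
by case=> ->; split; [exact: continuous_cos|exact: cos_max|
                      exact: continuous_sin|exact: sin_max].
Qed.

Section transform.
Context (u : R -> R) (n : nat) (g : n.-tuple rT -> R).
Hypotheses (ucs : u = cos \/ u = sin) (gi : (mun n).-integrable setT (EFin \o g)).

Let mg : measurable_fun setT g.
Proof. by apply/measurable_EFinP; exact: measurable_int gi. Qed.

Lemma measurable_trig_transform_tuple : measurable_fun setT (trig_transform u g).
Proof.
have [cu _] := cos_sin_bounded ucs.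
apply: (measurable_Rintegral2 (mun n)
  (F := fun z : n.-tuple rT * n.-tuple rT => g z.2 * u (tdot z.2 z.1))).
apply: measurable_funM; first exact: (measurableT_comp mg measurable_snd).
apply: (measurableT_comp (f := u)); first exact: continuous_measurable_fun.
exact: (measurableT_comp (@measurable_tdot R n) (@measurable_swap _ _ _ _)).
Qed.

Lemma trig_transform_tuple_bound y : `|trig_transform u g y| <= \int[mun n]_x `|g x|.
Proof.
have [cu u1] := cos_sin_bounded ucs.
have gui : (mun n).-integrable setT (fun x => (g x * u (tdot x y))%:E).
  apply: le_integrable gi => //.
    apply/measurable_EFinP; apply: measurable_funM => //.
    exact: measurable_trig_tdot.
  by move=> x _ /=; rewrite lee_fin normrM -[leRHS]mulr1 ler_pM.
apply: le_trans (le_normr_Rintegral measurableT gui) _.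
apply: le_Rintegral => //; [exact: (integrable_norm gui)|exact: (integrable_norm gi)|].
by move=> x _; rewrite normrM -[leRHS]mulr1 ler_pM.
Qed.

End transform.

Section dual.
Context (n : nat) (u : R -> R) (g m : n.-tuple rT -> R) (p L M2 Moo : R).
Hypotheses (ucs : u = cos \/ u = sin) (gi : (mun n).-integrable setT (EFin \o g)).
Hypotheses (mm : measurable_fun setT m) (m0 : forall y, 0 <= m y).
Hypotheses (mle : forall y, m y <= Moo * unit_cube y) (Moo0 : 0 <= Moo).
Hypotheses (M20 : 0 <= M2) (mM2 : (\int[mun n]_y (m y ^+ 2)%:E <= (M2 ^+ 2)%:E)%E).
Hypotheses (p1 : 1 <= p) (p2 : p <= 2).
Hypotheses (L0 : 0 <= L) (gL : (Lnorm (mun n) p%:E (EFin \o g) <= L%:E)%E).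

Let A := trig_transform u g.
Let G := \int[mun n]_x `|g x|.
Let a y := m y ^+ 2 * A y.
Let H x := \int[mun n]_y (a y * trig_kernel u (x, y)).

Let mg : measurable_fun setT g.
Proof. by apply/measurable_EFinP; exact: measurable_int gi. Qed.

Let mA : measurable_fun setT A. Proof. exact: measurable_trig_transform_tuple. Qed.

Let AG y : `|A y| <= G. Proof. exact: trig_transform_tuple_bound. Qed.

Let G0 : 0 <= G. Proof. by apply: Rintegral_ge0. Qed.

Let m_cube y : m y * unit_cube y = m y.
Proof.
have [->|/eqP] := eqVneq (unit_cube y) 1; first by rewrite mulr1.
(* An idempotent real number is 0 or 1; where the indicator is 0, the bound [mle] forces m to
   vanish. *)
have := unit_cube_sqr y; move=> /eqP; rewrite -subr_eq0 -{3}[unit_cube y]mulr1 -mulrBr.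
rewrite mulf_eq0 => /orP[/eqP c0 _|/eqP/subr0_eq-> //].
by have := mle y; have := m0 y; rewrite c0 !mulr0 => *; apply/eqP; rewrite eq_le; apply/andP.
Qed.

Let m_le y : m y <= Moo.
Proof.
apply: le_trans (mle y) _; rewrite -[leRHS]mulr1; apply: ler_wpM2l => //.
by have /andP[] := unit_cube01 y.
Qed.

Let ma : measurable_fun setT a.
Proof. by apply: measurable_funM => //; exact: measurable_funX. Qed.

Let a_le y : `|a y| <= Moo ^+ 2 * G * unit_cube y.
Proof.
have c : m y ^+ 2 <= Moo ^+ 2 * unit_cube y.
  by rewrite expr2 [Moo ^+ 2]expr2 -mulrA; apply: ler_pM => //; exact: mle.
rewrite /a normrM (ger0_norm (sqr_ge0 (m y))) [leRHS]mulrAC.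
exact: ler_pM (sqr_ge0 _) (normr_ge0 _) c (AG y).
Qed.

Let aB y : `|a y| <= Moo ^+ 2 * G.
Proof.
apply: le_trans (a_le y) _; rewrite -[leRHS]mulr1; apply: ler_wpM2l.
  by rewrite mulr_ge0 // sqr_ge0.
by have /andP[] := unit_cube01 y.
Qed.

Let N := \int[mun n]_y ((m y * A y) ^+ 2).

Let iN : (mun n).-integrable setT (fun y => ((m y * A y) ^+ 2)%:E).
Proof.
apply: le_integrable
  (integrableZl measurableT ((Moo * G) ^+ 2) (integrable_unit_cube n)) => //.
  by apply/measurable_EFinP/measurable_funX; exact: measurable_funM.
move=> y _ /=; rewrite lee_fin; apply: le_trans (ler_norm _).
have h : `|m y * A y| <= Moo * G * unit_cube y.
  rewrite normrM (ger0_norm (m0 y)) [leRHS]mulrAC.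
  exact: ler_pM (m0 y) (normr_ge0 _) (mle y) (AG y).
have -> : (Moo * G) ^+ 2 * unit_cube y = (Moo * G * unit_cube y) ^+ 2.
  by rewrite [RHS]exprMn [unit_cube y ^+ 2]expr2 unit_cube_sqr.
rewrite normrX; apply: lerXn2r; rewrite ?nnegrE //.
exact: le_trans (normr_ge0 _) h.
Qed.

Let N0 : 0 <= N. Proof. by apply: Rintegral_ge0 => y _; exact: sqr_ge0. Qed.

Let EN : (\int[mun n]_y ((m y * A y) ^+ 2)%:E = N%:E)%E.
Proof. by rewrite fineK //; exact: integrable_fin_num. Qed.

Let dk : dominated_kernel (mun n) (@trig_kernel R u n) (@unit_cube R n).
Proof. by have [cu u1] := cos_sin_bounded ucs; exact: trig_kernel_tuple_dominated. Qed.

Let mH : measurable_fun setT H.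
Proof. exact: measurable_kernel_transform dk ma. Qed.

Lemma dual_pairing : N = \int[mun n]_x (g x * H x).
Proof.
have [cu u1] := cos_sin_bounded ucs; have [mk kle _] := dk.
pose F (z : n.-tuple rT * n.-tuple rT) := g z.1 * (a z.2 * trig_kernel u z).
have mF : measurable_fun setT F.
  apply: measurable_funM; first exact: (measurableT_comp mg measurable_fst).
  by apply: measurable_funM => //; exact: (measurableT_comp ma measurable_snd).
have Fle x y : `|F (x, y)| <= `|g x| * (Moo ^+ 2 * G * unit_cube y).
  rewrite /F /= normrM; apply: ler_wpM2l => //; rewrite normrM.
  by apply: ler_pM.
have i2 : (mun n).-integrable setT (EFin \o (fun y => Moo ^+ 2 * G * unit_cube y)).
  exact: (integrableZl measurableT (Moo ^+ 2 * G) (integrable_unit_cube n)).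
transitivity (\int[mun n]_x \int[mun n]_y F (x, y)); last first.
  apply: eq_Rintegral => x _; rewrite /F /= RintegralZl //.
  exact: (dominated_kernel_integrable dk x ma aB).
rewrite (Rintegral_swap mF Fle (integrable_norm gi) i2).
apply: eq_Rintegral => y _; rewrite /F /=.
transitivity (\int[mun n]_x (m y ^+ 2 * A y * (g x * u (tdot x y)))).
  rewrite RintegralZl //; first by rewrite -/(trig_transform u g y) -/A; ring.
  apply: le_integrable gi => //.
    apply/measurable_EFinP; apply: measurable_funM => //.
    exact: measurable_trig_tdot.
  by move=> x _ /=; rewrite lee_fin normrM -[leRHS]mulr1 ler_pM.
apply: eq_Rintegral => x _; rewrite /a /trig_kernel /=.
by rewrite -{1}(m_cube y) exprMn [unit_cube y ^+ 2]expr2 unit_cube_sqr; ring.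
Qed.

Let n0 := Num.sqrt N.

Let n0E : n0 ^+ 2 = N. Proof. by rewrite sqr_sqrtr. Qed.

Lemma dual_sup x : `|H x| <= M2 * n0.
Proof.
have ti := dominated_kernel_integrable dk x ma aB.
have [_ kle _] := dk; have [_ u1] := cos_sin_bounded ucs.
apply: le_trans (le_normr_Rintegral measurableT ti) _.
rewrite -lee_fin fineK; last by apply: integrable_fin_num => //; exact: (integrable_norm ti).
have mmA : measurable_fun setT (fun y => m y * A y) by exact: measurable_funM.
have CS := @integral_CauchySchwarz _ _ _ (mun n) m (fun y => m y * A y) M2 n0 mm mmA
  M20 (sqrtr_ge0 _) mM2.
apply: le_trans _ (CS _); last by rewrite EN n0E.
apply: ge0_le_integral => //.
- have mti := measurable_int _ ti; apply/measurable_EFinP; apply: measurableT_comp => //.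
  by apply/measurable_EFinP.
- by apply/measurable_EFinP; apply: measurableT_comp => //; exact: measurable_funM.
- move=> y _; rewrite lee_fin (_ : m y * (m y * A y) = a y); last by rewrite /a; ring.
  rewrite normrM; apply: ler_piMr => //.
  by apply: le_trans (kle x y) _; have /andP[] := unit_cube01 y.
Qed.

Lemma dual_square :
  (\int[mun n]_x (H x ^+ 2)%:E <= ((Num.sqrt (bessel_cst n) * Moo * n0) ^+ 2)%:E)%E.
Proof.
have := @bessel_tuple R n u ucs a _ ma aB; rewrite -/H => /le_trans; apply.
rewrite !exprMn n0E sqr_sqrtr ?bessel_cst_ge0 // -mulrA EFinM.
apply: lee_wpmul2l; first by rewrite lee_fin bessel_cst_ge0.
rewrite EFinM -EN -ge0_integralZl_EFin ?sqr_ge0 //; last 2 first.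
- by move=> y _; rewrite lee_fin sqr_ge0.
- exact: measurable_int iN.
apply: ge0_le_integral => //.
- by move=> y _; rewrite lee_fin mulr_ge0 ?sqr_ge0 //; have /andP[] := unit_cube01 y.
- apply/measurable_EFinP; apply: measurable_funM; first exact: measurable_funX.
  exact: measurable_unit_cube.
- by apply: measurable_funeM; exact: measurable_int iN.
- move=> y _; rewrite -EFinM lee_fin.
  apply: le_trans (_ : a y ^+ 2 <= _).
    by apply: ler_piMr; [exact: sqr_ge0|have /andP[] := unit_cube01 y].
  have -> : a y = m y * (m y * A y) by rewrite /a; ring.
  rewrite exprMn; apply: ler_wpM2r; first exact: sqr_ge0.
  by apply: lerXn2r; rewrite ?nnegrE.
Qed.

(** The exponents are 1 - 2/q and 2/q for the exponent q conjugate to p. Written in terms of p they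
    are also correct for p = 1. *)
Definition dual_constant :=
  M2 `^ (2 / p - 1) * (Num.sqrt (bessel_cst n) * Moo) `^ (2 - 2 / p).

Lemma dual_bound :
  (\int[mun n]_y ((m y * trig_transform u g y) ^+ 2)%:E
   <= ((dual_constant * L) ^+ 2)%:E)%E.
Proof.
rewrite EN lee_fin.
have K0 : 0 <= dual_constant by rewrite mulr_ge0 ?powR_ge0.
have n00 : 0 <= n0 by exact: sqrtr_ge0.
(* Dividing by [n0] closes the duality argument. This is legitimate because N is finite: [A] is
   bounded, as g is integrable, and m is bounded and supported in the cube. *)
suff NS : N <= n0 * (dual_constant * L).
  have [n0z|n0n] := eqVneq n0 0; first by rewrite -n0E n0z expr0n sqr_ge0.
  have n0p : 0 < n0 by rewrite lt0r n0n.
  have : n0 * n0 <= n0 * (dual_constant * L) by rewrite -expr2 n0E.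
  rewrite (ler_pM2l n0p) => h; rewrite -n0E; apply: lerXn2r => //.
  by rewrite nnegrE mulr_ge0.
rewrite -lee_fin.
apply: (@le_trans _ _ (Lnorm (mun n) 1 (EFin \o (g \* H)%R)))%E.
  rewrite Lnorm1 dual_pairing.
  have gHi : (mun n).-integrable setT (fun x => (g x * H x)%:E).
    apply: le_integrable (integrableZl measurableT (M2 * n0) gi) => //.
      by apply/measurable_EFinP; exact: measurable_funM.
    move=> x _ /=; rewrite lee_fin !normrM mulrC ler_wpM2r //.
    by apply: le_trans (dual_sup x) _; rewrite -normrM ler_norm.
  rewrite fineK; last exact: integrable_fin_num.
  apply: le_trans (lee_abs _) _; apply: le_abse_integral => //.
  exact: measurable_int gHi.
(* For p = 1 the conjugate exponent is infinite while p / (p - 1) would be 0; the supremum bound of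
   H is then paired with the L^1 norm of g directly. *)
have [pe1|pn1] := eqVneq p 1.
  rewrite Lnorm1.
  apply: (@le_trans _ _ (\int[mun n]_x ((M2 * n0)%:E * (`|g x|)%:E)))%E.
    apply: ge0_le_integral => //.
    - apply: measurableT_comp => //; apply/measurable_EFinP; exact: measurable_funM.
    - by apply: measurable_funeM; apply/measurable_EFinP; exact: measurableT_comp.
    - by move=> x _; rewrite -EFinM lee_fin /= normrM mulrC ler_wpM2r // dual_sup.
  rewrite ge0_integralZl_EFin //; [|by apply/measurable_EFinP; exact: measurableT_comp
                                   |exact: mulr_ge0].
  have n1 : (\int[mun n]_x (`|g x|)%:E <= L%:E)%E by move: gL; rewrite pe1 Lnorm1.
  apply: le_trans (lee_wpmul2l _ n1) _; first by rewrite lee_fin mulr_ge0.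
  rewrite -EFinM lee_fin /dual_constant pe1 divr1 subrr powRr0 mulr1.
  by rewrite (_ : 2 - 1 = 1 :> R) ?powRr1 // ?mulrA; [rewrite (mulrC M2)|ring].
have pgt1 : 1 < p by rewrite lt_neqAle eq_sym pn1.
pose q := p / (p - 1).
have [p0 q0 q2 pq] := conjugate_exponent pgt1 p2.
apply: le_trans (hoelder (mun n) mg mH p0 q0 pq) _.
have C0 : 0 <= Num.sqrt (bessel_cst n) * Moo by rewrite mulr_ge0 ?sqrtr_ge0.
have B0 : 0 <= M2 * n0 by exact: mulr_ge0.
have D0 : 0 <= Num.sqrt (bessel_cst n) * Moo * n0 by exact: mulr_ge0.
have HH := Lnorm_interpolation mH D0 B0 (_ : (2%:E <= q%:E)%E) dual_sup dual_square.
apply: le_trans (lee_pmul (Lnorm_ge0 _ _ _) (Lnorm_ge0 _ _ _) gL (HH _)) _.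
  by rewrite lee_fin.
rewrite -EFinM lee_fin inver gt_eqF //= powRM // powRM // /dual_constant.
have -> : 2 * q^-1 = 2 - 2 / p by rewrite -[X in X - _]mulr1 -pq mulrDr addrAC subrr add0r.
have -> : 1 - (2 - 2 / p) = 2 / p - 1 by ring.
set x := M2 `^ _; set y := (_ * _) `^ _.
rewrite (_ : L * _ = (n0 `^ (2 / p - 1) * n0 `^ (2 - 2 / p)) * (x * y * L)); last by ring.
have e1 : 2 / p - 1 + (2 - 2 / p) = 1 by ring.
by rewrite -powRD e1 ?oner_eq0 // powRr1.
Qed.

End dual.
End restriction.

(** * Decay of the radial weights *)

Section decay.
Context {R : realType}.
Local Notation rT := (measurableTypeR R).
Local Notation lm := (@lebesgue_measure R).
Local Notation mun n := (@lebesgue_tuple R n).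

Lemma powR1r (r : R) : 1 `^ r = 1.
Proof. by rewrite powR1. Qed.

Lemma ler_powR2 (r x y : R) : 0 <= r -> 0 <= x -> x <= y -> x `^ r <= y `^ r.
Proof.
move=> r0 x0 xy; apply: ge0_ler_powR => //; rewrite nnegrE //.
exact: le_trans xy.
Qed.

(** This is x <= expR x at x = c y / (al + 1), raised to the power al. Dividing by al + 1 instead of
    al includes al = 0. *)
Lemma powR_le_expR (al c y : R) : 0 <= al -> 0 < c -> 0 <= y ->
  y `^ al <= ((al + 1) / c) `^ al * expR (c * y).
Proof.
move=> al0 c0 y0; have al1 : 0 < al + 1 by lra.
have k0 : 0 <= (al + 1) / c by rewrite divr_ge0 // ltW.
pose x := c * y / (al + 1).
have x0 : 0 <= x by rewrite /x divr_ge0 ?(ltW al1) // mulr_ge0 // ltW.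
have yE : y = (al + 1) / c * x by rewrite /x; field; rewrite !gt_eqF.
have yle : y <= (al + 1) / c * expR x.
  rewrite {1}yE; apply: ler_wpM2l => //.
  by have := expR_ge1Dx x; lra.
apply: le_trans (_ : ((al + 1) / c * expR x) `^ al <= _).
  exact: ler_powR2.
rewrite powRM ?expR_ge0 //; apply: ler_wpM2l; first exact: powR_ge0.
rewrite -expRM ler_expR.
have -> : c * y = x * (al + 1) by rewrite /x mulfVK // gt_eqF.
by apply: ler_wpM2l => //; lra.
Qed.

(** With y = (1 + t) r^k one has r^a = y^(a/k) (1 + t)^(- a/k), and the exponential controls the
    power of y. Passing from t to 1 + t in the exponential costs a factor expR c at most, since r <=
    1. *)
Lemma radial_sup_decay (a c k : R) : 0 <= a -> 0 < c -> 0 < k ->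
  exists2 C : R, 0 < C & forall r t : R, 0 <= r -> r <= 1 -> 0 <= t ->
  r `^ a * expR (- (c * r `^ k * t)) <= C * (1 + t) `^ (- (a / k)).
Proof.
move=> a0 c0 k0; pose al := a / k.
have al0 : 0 <= al by rewrite divr_ge0 // ltW.
have C0 : 0 < ((al + 1) / c) `^ al.
  by apply: powR_gt0; apply: divr_gt0 => //; lra.
exists (((al + 1) / c) `^ al * expR c); first by rewrite mulr_gt0 ?expR_gt0.
move=> r t r0 r1 t0; have t1 : 0 < 1 + t by lra.
pose y := (1 + t) * r `^ k.
have rk0 : 0 <= r `^ k by exact: powR_ge0.
have rk1 : r `^ k <= 1.
  by rewrite -(powR1r k); apply: ler_powR2 => //; exact: ltW.
have y0 : 0 <= y by rewrite mulr_ge0 // ltW.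
have -> : r `^ a = y `^ al * (1 + t) `^ (- al).
  rewrite /y powRM ?(ltW t1) // -powRrM mulrC mulrA -powRD.
    by rewrite addNr powRr0 mul1r /al mulrC mulfVK // gt_eqF.
  by rewrite (gt_eqF t1) implybT.
set K := ((al + 1) / c) `^ al in C0 *.
have h : y `^ al * expR (- (c * r `^ k * t)) <= K * expR c.
  apply: le_trans (ler_wpM2r (expR_ge0 _) (powR_le_expR al0 c0 y0)) _.
  rewrite -/K -[leLHS]mulrA; apply: ler_wpM2l; first exact: ltW.
  rewrite -expRD ler_expR /y.
  have -> : c * ((1 + t) * r `^ k) - c * r `^ k * t = c * r `^ k by ring.
  by rewrite ler_piMr // ltW.
by rewrite [leLHS]mulrAC; apply: ler_wpM2r => //; exact: powR_ge0.
Qed.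

(** At r = |z| the right-hand side is dominated by a product of one-dimensional profiles 1 / (1 + (l
    z_i)^2) with explicit integrals; this replaces polar coordinates. The condition 2 <= k enters
    through (l r)^2 = y^(2/k) <= 1 + y. *)
Lemma radial_product_decay (n : nat) (c k : R) : 0 < c -> 2 <= k ->
  exists2 C : R, 0 < C & forall r t : R, 0 <= r -> r <= 1 -> 0 <= t ->
  expR (- (c * r `^ k * t)) <= C / (1 + ((1 + t) `^ k^-1 * r) ^+ 2) ^+ n.
Proof.
move=> c0 k2; have k0 : 0 < k by lra.
(* The exponential is cut into n + 1 equal factors, of which n pay for the n factors of the
   denominator; n + 1 in place of n keeps the quotient meaningful for n = 0. *)
pose n1 : R := n.+1%:R; have n10 : 0 < n1 by rewrite /n1 ltr0n.
have D0 : 0 < 2 + n1 / c by have := divr_gt0 n10 c0; lra.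
exists ((2 + n1 / c) ^+ n * expR c).
  by rewrite mulr_gt0 ?expR_gt0 // exprn_gt0.
move=> r t r0 r1 t0; have t1 : 0 < 1 + t by lra.
pose y := (1 + t) * r `^ k.
have rk0 : 0 <= r `^ k by exact: powR_ge0.
have rk1 : r `^ k <= 1.
  by rewrite -(powR1r k); apply: ler_powR2 => //; exact: ltW.
have y0 : 0 <= y by rewrite mulr_ge0 // ltW.
set l := (1 + t) `^ k^-1.
have l0 : 0 <= l by exact: powR_ge0.
have lr : (l * r) ^+ 2 <= 1 + y.
  have lrE : l * r = y `^ k^-1.
    by rewrite /y powRM ?(ltW t1) // -powRrM mulfV ?gt_eqF // powRr1.
  rewrite lrE -powR_mulrn ?powR_ge0 // -powRrM.
  have [y1|y1] := leP y 1.
    apply: le_trans (_ : 1 <= _); last by lra.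
    have e0 : 0 <= k^-1 * 2%:R by rewrite mulr_ge0 ?invr_ge0 // ltW.
    by have := ler_powR2 e0 y0 y1; rewrite powR1r.
  apply: le_trans (_ : y `^ 1 <= _); last by rewrite powRr1; lra.
  apply: ler_powR; first exact: ltW.
  by rewrite mulrC ler_pdivrMr // mul1r.
have P0 : 0 < 1 + (l * r) ^+ 2 by rewrite ltr_pwDl ?sqr_ge0.
rewrite ler_pdivlMr ?exprn_gt0 //.
have ey : 1 + (l * r) ^+ 2 <= (2 + n1 / c) * expR (c * y / n1).
  have h1 := expR_ge1Dx (c * y / n1).
  apply: le_trans (ler_wpM2l (ltW D0) h1).
  have -> : (2 + n1 / c) * (1 + c * y / n1) = 2 + y + n1 / c + 2 * (c * y / n1).
    by field; rewrite !gt_eqF.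
  have a1 : 0 <= n1 / c by rewrite divr_ge0 // ltW.
  have a2 : 0 <= c * y / n1 by rewrite divr_ge0 ?mulr_ge0 // ltW.
  apply: le_trans (_ : 2 + y <= _).
    by rewrite (_ : 2 + y = 1 + (1 + y)) ?lerD2l //; ring.
  by rewrite -[leRHS]addrA lerDl addr_ge0 // mulr_ge0.
have := lerXn2r n (_ : _ \is Num.nneg) (_ : _ \is Num.nneg) ey.
rewrite !nnegrE (ltW P0) mulr_ge0 ?expR_ge0 ?(ltW D0) // => /(_ isT isT) eyn.
apply: le_trans (ler_wpM2l (expR_ge0 _) eyn) _.
rewrite exprMn mulrCA; apply: ler_wpM2l; first by rewrite exprn_ge0 // ltW.
rewrite -expRM_natr -expRD ler_expR.
have h : c * y / n1 * n%:R <= c * y.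
  rewrite -mulrA; apply: ler_piMr; first by rewrite mulr_ge0 // ltW.
  by rewrite mulrC ler_pdivrMr // mul1r /n1 ler_nat.
have e : c * y = c * r `^ k * t + c * r `^ k by rewrite /y; ring.
rewrite addrC lerBlDr; apply: le_trans h _; rewrite e addrC lerD2r.
by rewrite ler_piMr // ltW.
Qed.

Lemma cauchy_integral (l : R) : 0 < l ->
  exists2 I : R, 0 <= I <= pi / l &
  (\int[lm]_x ((1 + (l * x) ^+ 2)^-1)%:E = I%:E)%E.
Proof.
move=> l0.
have D0 (x : R) : 0 < 1 + (l * x) ^+ 2 by rewrite ltr_pwDl ?sqr_ge0.
have cf : continuous (fun x : R => (1 + (l * x) ^+ 2)^-1).
  move=> x; apply: cvgV; first by rewrite gt_eqF.
  apply: cvgD; first exact: cvg_cst.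
  by rewrite expr2; under eq_fun do rewrite expr2; apply: cvgM; apply: cvgMr; exact: cvg_id.
have dF (x : R) : is_derive x (1:R) (fun x : R => atan (l * x) / l) ((1 + (l * x) ^+ 2)^-1).
  have dl : is_derive x (1:R) (fun x : R => l * x) l.
    by apply: is_derive_eq; rewrite /GRing.scale /=; ring.
  have da : is_derive x (1:R) (fun x : R => atan (l * x)) ((1 + (l * x) ^+ 2)^-1 * l).
    by have := is_derive1_comp (is_derive1_atan _) dl.
  by apply: is_derive_eq; rewrite /GRing.scale /=; field; rewrite !gt_eqF.
have g0 (x : R) : 0 <= (1 + (l * x) ^+ 2)^-1 by rewrite invr_ge0 ltW.
have mf : measurable_fun setT (fun x : rT => (1 + (l * x) ^+ 2)^-1).
  exact: continuous_measurable_fun.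
have I0 : (0 <= \int[lm]_x ((1 + (l * x) ^+ 2)^-1)%:E)%E.
  by apply: integral_ge0 => x _; rewrite lee_fin.
have Ipi : (\int[lm]_x ((1 + (l * x) ^+ 2)^-1)%:E <= (pi / l)%:E)%E.
  apply: le_integral_exhaustion => // k.
  have [->|k0] := eqVneq k 0%N.
    by rewrite oppr0 set_itv1 integral_set1 lee_fin divr_ge0 ?pi_ge0 // ltW.
  have kp : 0 < k%:R :> R by rewrite lt0r pnatr_eq0 k0 ler0n.
  have kk : - k%:R < k%:R :> R by rewrite (lt_trans _ kp) // oppr_lt0.
  have -> : (\int[lm]_(x in `[(- k%:R)%R, (k%:R)%R]) ((1 + (l * x) ^+ 2)^-1)%:E)%E =
    (\int[lm]_(x in `[- k%:R, k%:R]) (1 + (l * x) ^+ 2)^-1)%:E.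
    by rewrite fineK //; apply: integrable_fin_num => //; exact: integrable_itv_continuous.
  rewrite lee_fin (Rintegral_FTC kk cf dF) -mulrBl; apply: ler_wpM2r.
    by rewrite invr_ge0 ltW.
  by have := atan_ltpi2 (l * k%:R); have := atan_gtNpi2 (l * - k%:R); lra.
have fn : (\int[lm]_x ((1 + (l * x) ^+ 2)^-1)%:E)%E \is a fin_num.
  by rewrite ge0_fin_numE // (le_lt_trans Ipi) ?ltry.
exists (fine (\int[lm]_x ((1 + (l * x) ^+ 2)^-1)%:E)%E); last by rewrite fineK.
by rewrite fine_ge0 //= -lee_fin fineK.
Qed.

End decay.

(** * Measurability and integrability on tuples *)

Section tuple_measurability.
Context {R : realType}.
Local Notation rT := (measurableTypeR R).
Local Notation lm := (@lebesgue_measure R).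
Local Notation mun n := (@lebesgue_tuple R n).

(** * Approximation by grids of mesh 1 / (k + 1) *)

Section discretization.
Local Open Scope classical_set_scope.
Local Open Scope ring_scope.
Context (n k : nat).

Definition grid_floor (z : n.-tuple rT) : 'rV[int]_n :=
  \row_i Num.floor (k.+1%:R * (tnth z i : R)).

Definition grid_point (q : 'rV[int]_n) : 'rV[R]_n := \row_i ((q 0 i)%:~R / k.+1%:R).

Lemma measurable_grid_fiber (q : 'rV[int]_n) :
  measurable [set z : n.-tuple rT | grid_floor z = q].
Proof.
have -> : [set z : n.-tuple rT | grid_floor z = q] =
    \bigcap_(i in [set: 'I_n]) ((fun z : n.-tuple rT => k.+1%:R * (tnth z i : R)) @^-1`
      `[(q 0 i)%:~R, (q 0 i + 1)%:~R[%classic).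
  apply/seteqP; split => z /=.
    move=> <- i _ /=; rewrite mxE in_itv /=; apply/andP; split.
      by apply: real_floor_le; exact: num_real.
    by apply: real_floorD1_gt; exact: num_real.
  move=> h; apply/rowP => i; rewrite mxE; have := h i I; rewrite /= in_itv /=.
  exact: floor_def.
apply: fin_bigcap_measurable => //.
move=> i _; rewrite -[X in measurable X]setTI.
by apply: measurable_funM => //; exact: measurable_tnth.
Qed.

(** A function of the grid point has countably many values, each attained on a union of boxes;
    [unpickle] enumerates the integer vectors. *)
Lemma measurable_grid_fun (f : 'rV[R]_n -> R) :
  measurable_fun setT (fun z : n.-tuple rT => f (grid_point (grid_floor z))).
Proof.
move=> _ Y mY; rewrite setTI.
pose P q := f (grid_point q) \in Y.
have -> : (fun z : n.-tuple rT => f (grid_point (grid_floor z))) @^-1` Y =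
    \bigcup_(j : nat) (if unpickle j is Some q then
       if P q then [set z : n.-tuple rT | grid_floor z = q] else set0 else set0).
  apply/seteqP; split => z /=.
    move=> Yz; exists (pickle (grid_floor z)) => //; rewrite pickleK.
    by rewrite /P mem_set.
  move=> [j _]; case: unpickle => // q; case: ifPn => // Pq /= ->.
  by move: Pq; rewrite /P inE.
apply: bigcupT_measurable => j; case: unpickle => // q; case: ifPn => // _.
exact: measurable_grid_fiber.
Qed.

Lemma grid_point_dist (z : n.-tuple rT) :
  `|row_of_tuple z - grid_point (grid_floor z)| <= k.+1%:R^-1.
Proof.
have k0 : 0 < k.+1%:R :> R by rewrite ltr0n.
have k0' : 0 <= k.+1%:R^-1 :> R by rewrite invr_ge0 ltW.
rewrite -[leLHS]/(mx_norm _) mx_normrE; apply: bigmax_le => // -[i j] _ /=.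
rewrite !mxE; set x : R := tnth z j.
have h1 : (Num.floor (k.+1%:R * x))%:~R <= k.+1%:R * x.
  by apply: real_floor_le; exact: num_real.
have h2 : k.+1%:R * x < (Num.floor (k.+1%:R * x))%:~R + 1.
  by have := real_floorD1_gt (num_real (k.+1%:R * x)); rewrite intrD.
set q := (Num.floor _)%:~R in h1 h2 *.
have -> : x - q / k.+1%:R = (k.+1%:R * x - q) / k.+1%:R.
  by rewrite mulrBl mulrAC divff ?mul1r // gt_eqF.
rewrite normrM (ger0_norm k0') -[leRHS]mul1r; apply: ler_wpM2r => //.
by rewrite ler_norml; apply/andP; split; lra.
Qed.

End discretization.

(** Continuity refers to row vectors and measurability to tuples. The link is that f is the
    pointwise limit of its values at grid points, which are measurable in the tuple. *)
Lemma measurable_continuous_row n (f : 'rV[R]_n -> R) : continuous f ->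
  measurable_fun setT (fun z : n.-tuple rT => f (row_of_tuple z)).
Proof.
move=> cf; apply: (@measurable_fun_cvg _ _ _ _
  (fun k z => f (grid_point k (grid_floor k z)))) => //.
  by move=> k; exact: measurable_grid_fun.
move=> z _; apply: (@cvg_comp _ _ _ (fun k => grid_point k (grid_floor k z)) f
  _ (nbhs (row_of_tuple z))); last exact: cf.
apply/cvgrPdist_le => e e0; near=> k.
apply: le_trans (grid_point_dist k z) _; apply: ltW.
by near: k; exact: near_infty_natSinv_lt (PosNum e0).
Unshelve. all: by end_near. Qed.

Lemma dot_row_of_tuple n (x y : n.-tuple rT) :
  dot (row_of_tuple x) (row_of_tuple y) = tdot x y.
Proof. by apply: eq_bigr => i _; rewrite !mxE. Qed.

Lemma enorm_ge0 n (x : 'rV[R]_n) : 0 <= enorm x.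
Proof. exact: sqrtr_ge0. Qed.

Lemma enorm_sqr n (x : 'rV[R]_n) : enorm x ^+ 2 = \sum_(i < n) x 0 i ^+ 2.
Proof.
rewrite sqr_sqrtr; first by apply: eq_bigr => i _; rewrite expr2.
by apply: sumr_ge0 => i _; rewrite -expr2 sqr_ge0.
Qed.

Lemma coord_le_enorm n (x : 'rV[R]_n) i : x 0 i ^+ 2 <= enorm x ^+ 2.
Proof.
rewrite enorm_sqr (bigD1 i) //= lerDl.
by apply: sumr_ge0 => j _; exact: sqr_ge0.
Qed.

Lemma measurable_enorm n : measurable_fun setT (fun z : n.-tuple rT => enorm (row_of_tuple z)).
Proof.
apply: (measurableT_comp (f := @Num.sqrt R)).
  by apply: continuous_measurable_fun; exact: sqrt_continuous.
apply: measurable_sum => i.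
rewrite (_ : (fun z => _) = (fun z : n.-tuple rT => tnth z i * tnth z i)).
  by apply: measurable_funM; exact: measurable_tnth.
by apply/funext => z; rewrite !mxE.
Qed.

Lemma unit_cube_enorm n (z : n.-tuple rT) : enorm (row_of_tuple z) <= 1 -> unit_cube z = 1.
Proof.
move=> z1; apply: big1 => i _; rewrite /unit_box indicE mem_set //= in_itv /=.
rewrite -ler_norml -(expr_le1 (n := 2)) // real_normK ?num_real //.
have := coord_le_enorm (row_of_tuple z) i; rewrite mxE => /le_trans; apply.
by rewrite expr_le1 // enorm_ge0.
Qed.

Lemma schwartz_Re_continuous n (f : 'rV[R]_n -> R[i]) : schwartz f ->
  continuous (fun x => complex.Re (f x)).
Proof. by move=> [sf _ _] x; apply: differentiable_continuous; exact: (sf [::] x). Qed.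

Lemma schwartz_Im_continuous n (f : 'rV[R]_n -> R[i]) : schwartz f ->
  continuous (fun x => complex.Im (f x)).
Proof. by move=> [_ sf _] x; apply: differentiable_continuous; exact: (sf [::] x). Qed.

Lemma integral_product_decay n (l : R) : 0 < l ->
  (\int[mun n]_z (\prod_(i < n) (1 + (l * tnth z i) ^+ 2)^-1)%:E <= ((pi / l) ^+ n)%:E)%E.
Proof.
move=> l0; have [I /andP[I0 Il] IE] := cauchy_integral l0.
rewrite (integral_tuple_prod n (h := fun x => (1 + (l * x) ^+ 2)^-1) _ _ IE).
- by rewrite lee_fin; apply: lerXn2r; rewrite ?nnegrE // (le_trans I0).
- apply: (continuous_measurable_fun (f := fun x : R => (1 + (l * x) ^+ 2)^-1)) => x.
  apply: cvgV; first by rewrite gt_eqF // ltr_pwDl ?sqr_ge0.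
  apply: cvgD; first exact: cvg_cst.
  by rewrite expr2; under eq_fun do rewrite expr2; apply: cvgM; apply: cvgMr; exact: cvg_id.
- by move=> x; rewrite invr_ge0 addr_ge0 ?sqr_ge0.
Qed.

Lemma prod_coord_le n (l : R) (z : n.-tuple rT) :
  ((1 + (l * enorm (row_of_tuple z)) ^+ 2) ^+ n)^-1
  <= \prod_(i < n) (1 + (l * tnth z i) ^+ 2)^-1.
Proof.
rewrite -exprVn -[X in _ ^+ X]card_ord -prodr_const; apply: ler_prod => i _.
have p (x : R) : 0 < 1 + (l * x) ^+ 2 by rewrite ltr_pwDl ?sqr_ge0.
rewrite invr_ge0 (ltW (p _)) /= lef_pV2 ?posrE // lerD2l !exprMn.
apply: ler_wpM2l; first exact: sqr_ge0.
by have := coord_le_enorm (row_of_tuple z) i; rewrite mxE.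
Qed.

Lemma measurable_product_decay n (l : R) :
  measurable_fun setT (fun z : n.-tuple rT => \prod_(i < n) (1 + (l * tnth z i) ^+ 2)^-1).
Proof.
apply: (measurable_tuple_prod (h := fun x : R => (1 + (l * x) ^+ 2)^-1)).
apply: continuous_measurable_fun => x.
apply: cvgV; first by rewrite gt_eqF // ltr_pwDl ?sqr_ge0.
apply: cvgD; first exact: cvg_cst.
by rewrite expr2; under eq_fun do rewrite expr2; apply: cvgM; apply: cvgMr; exact: cvg_id.
Qed.

Lemma product_decay_ge0 n (l : R) (z : n.-tuple rT) :
  0 <= \prod_(i < n) (1 + (l * tnth z i) ^+ 2)^-1.
Proof. by apply: prodr_ge0 => i _; rewrite invr_ge0 addr_ge0 ?sqr_ge0. Qed.

Lemma integrable_product_decay n (l : R) : 0 < l ->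
  (mun n).-integrable setT
    (fun z => (\prod_(i < n) (1 + (l * tnth z i) ^+ 2)^-1)%:E).
Proof.
move=> l0; apply/integrableP; split.
  by apply/measurable_EFinP; exact: measurable_product_decay.
under eq_integral do rewrite /= ger0_norm ?product_decay_ge0 //.
by apply: le_lt_trans (integral_product_decay n l0) _; rewrite ltry.
Qed.

(** A seminorm of order 2n suffices: (1 + |x|)^(2n) >= (1 + |x|^2)^n, and the inverse of the latter
    is dominated by the product of the 1 / (1 + x_i^2). In the applications [h] is the real or the
    imaginary part of f. *)
Lemma schwartz_integrable n (f : 'rV[R]_n -> R[i]) (h : 'rV[R]_n -> R) :
  schwartz f -> continuous h -> (forall x, `|h x| <= ComplexField.Normc.normc (f x)) ->
  (mun n).-integrable setT (fun z => (h (row_of_tuple z))%:E).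
Proof.
move=> [_ _ sf] ch hf; have [M Mf] := sf (n + n)%N 0%N.
have fM x : (1 + enorm x) ^+ (n + n) * ComplexField.Normc.normc (f x) <= M.
  by have := Mf [::] x isT; rewrite /cpderiv /=; case: (f x).
apply: le_integrable
  (integrableZl measurableT M (integrable_product_decay n ltr01)) => //.
  by apply/measurable_EFinP; exact: measurable_continuous_row.
move=> z _ /=; rewrite lee_fin; apply: le_trans (ler_norm _).
apply: le_trans (hf _) _; pose r := enorm (row_of_tuple z).
have r0 : 0 <= r := enorm_ge0 _.
have M0 : 0 <= M.
  apply: le_trans (fM (row_of_tuple z)); rewrite mulr_ge0 //.
    by rewrite exprn_ge0 // addr_ge0.
  exact: le_trans (hf _).
have p (x : R) : 0 < 1 + x ^+ 2 by rewrite ltr_pwDl ?sqr_ge0.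
apply: le_trans (_ : M * ((1 + (1 * r) ^+ 2) ^+ n)^-1 <= _); last first.
  by apply: ler_wpM2l => //; exact: prod_coord_le.
rewrite mul1r ler_pdivlMr ?exprn_gt0 // mulrC.
apply: le_trans (fM (row_of_tuple z)); apply: ler_wpM2r; first exact: le_trans (hf _).
rewrite addnn -mul2n exprM; apply: lerXn2r; rewrite ?nnegrE ?sqr_ge0 ?(ltW (p _)) //.
by rewrite sqrrD expr1n mul1r lerD2r lerDl mulrn_wge0.
Qed.

End tuple_measurability.

(** * Measurable dependence of linear systems on a parameter *)

Section linear_ode.
Context {R : realType}.

Lemma comparison_at_right (g g' f f' : R -> R) (t : R) : 0 <= t ->
  (g s @[s --> (0:R)^'+] --> g 0)%classic ->
  (f s @[s --> (0:R)^'+] --> f 0)%classic ->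
  (forall s : R, 0 < s -> s <= t -> is_derive s (1:R) g (g' s)) ->
  (forall s : R, 0 < s -> s <= t -> is_derive s (1:R) f (f' s)) ->
  (forall s : R, 0 < s -> s <= t -> g' s <= f' s) -> g 0 <= f 0 -> g t <= f t.
Proof.
move=> t0 cg cf dg df gf gf0.
have := @gronwall_decay _ (fun s => g s - f s) (fun s => g' s - f' s) 0 t t0.
rewrite mul0r oppr0 expR0 mul1r => H.
suff : g t - f t <= g 0 - f 0 by move: gf0; lra.
apply: H.
- exact: cvgB.
- move=> s s0 st; have h1 := dg s s0 st; have h2 := df s s0 st.
  exact: is_deriveB.
- by move=> s s0 st; rewrite mul0r subr_le0; exact: gf.
Qed.

Section taylor.
Context (m : nat) (M : 'I_m -> 'I_m -> R) (y : 'I_m -> R -> R).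
Hypothesis y0 : forall i, (y i s @[s --> (0:R)^'+] --> y i 0)%classic.
Hypothesis dy : forall (s : R) i, 0 < s ->
  is_derive s (1:R) (y i) (- \sum_k M i k * y k s).

Fixpoint power_apply (u : 'I_m -> R) (j : nat) : 'I_m -> R :=
  if j is j'.+1 then fun i => \sum_k M i k * power_apply u j' k else u.

(** Partial sum of exp(- s M) u with N terms, hence of degree N - 1 in s; differentiation lowers N
    by one. *)
Definition taylor_ode (u : 'I_m -> R) (N : nat) (s : R) (i : 'I_m) : R :=
  \sum_(j < N) ((- s) ^+ j / j`!%:R) * power_apply u j i.

Let u i := y i 0.

Lemma exp_term_derive (a s : R) (j : nat) :
  is_derive s (1:R) (fun s => (a * s) ^+ j.+1 / j.+1`!%:R) (a * ((a * s) ^+ j / j`!%:R)).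
Proof.
have d1 : is_derive s (1 : R) (fun s => a * s) a.
  by apply: is_derive_eq; rewrite /GRing.scale /=; ring.
have dX : is_derive s (1 : R) (fun s => (a * s) ^+ j.+1) (j.+1%:R * (a * s) ^+ j * a).
  have := is_deriveX j.+1 d1; rewrite /= /GRing.scale /=.
  by rewrite (_ : (fun s => a * s) ^+ j.+1 = (fun s => (a * s) ^+ j.+1)) // funeqE => x; rewrite fctE.
have F0 : j`!%:R != 0 :> R by rewrite pnatr_eq0 -lt0n fact_gt0.
have j0 : j.+1%:R != 0 :> R by rewrite pnatr_eq0.
apply: is_derive_eq; rewrite /GRing.scale /= factS natrM.
move: j0 F0; move: (j.+1%:R : R) (j`!%:R : R) ((a * s) ^+ j) => p q r p0 q0.
by field; rewrite p0 q0.
Qed.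

Lemma taylor_ode_derive (N : nat) (i : 'I_m) (s : R) :
  is_derive s (1:R) (fun s => taylor_ode u N.+1 s i)
    (- \sum_k M i k * taylor_ode u N s k).
Proof.
elim: N => [|N IH].
  have -> : (fun s => taylor_ode u 1 s i) = cst (u i).
    by apply/funext => x; rewrite /taylor_ode big_ord_recl big_ord0 expr0 fact0 divr1 mul1r addr0.
  rewrite big1 ?oppr0; last by move=> k _; rewrite /taylor_ode big_ord0 mulr0.
  exact: is_derive_cst.
have -> : (fun s => taylor_ode u N.+2 s i) = (fun s => taylor_ode u N.+1 s i +
    ((-1) * s) ^+ N.+1 / N.+1`!%:R * power_apply u N.+1 i).
  by apply/funext => x; rewrite /taylor_ode big_ord_recr /= mulN1r.
have dt := exp_term_derive (-1) s N.
have -> : - (\sum_k M i k * taylor_ode u N.+1 s k) =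
  - (\sum_k M i k * taylor_ode u N s k)
  + (-1) * ((-1 * s) ^+ N / N`!%:R) * power_apply u N.+1 i.
  rewrite /= mulr_sumr -sumrN -sumrN -big_split; apply: eq_bigr => k _ /=.
  by rewrite /taylor_ode big_ord_recr /= !mulN1r; ring.
by apply: is_derive_eq; rewrite /GRing.scale /=; ring.
Qed.

Lemma taylor_ode_at0 (N : nat) (i : 'I_m) : taylor_ode u N.+1 0 i = u i.
Proof.
rewrite /taylor_ode big_ord_recl expr0 fact0 divr1 mul1r big1 ?addr0 //.
by move=> j _; rewrite oppr0 expr0n mul0r mul0r.
Qed.

Lemma ode_bounded (t : R) : 0 < t ->
  exists B : R, forall i s, 0 <= s -> s <= t -> `|y i s| <= B.
Proof.
move=> t0.
have one i : exists B : R, 0 <= B /\ forall s, 0 <= s -> s <= t -> `|y i s| <= B.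
  have cw : {within `[0, t], continuous (y i)}%classic.
    apply: (@within_continuous_derivable _ (y i) (fun s => - \sum_k M i k * y k s)) => //.
    by move=> s s0 _; exact: dy.
  have [c1 _ H1] := EVT_max (ltW t0) cw.
  have [c2 _ H2] := EVT_min (ltW t0) cw.
  exists (`|y i c1| + `|y i c2|); split; first by rewrite addr_ge0.
  move=> s s0 st; have sI : s \in (`[0, t] : interval R) by rewrite in_itv /= s0 st.
  have h1 := H1 s sI; have h2 := H2 s sI.
  have := ler_norm (y i c1); have := ler_norm (- y i c2); rewrite normrN.
  have := normr_ge0 (y i c1); have := normr_ge0 (y i c2).
  by move=> *; rewrite ler_norml; apply/andP; split; lra.
pose b i := projT1 (cid (one i)).
have bP i : 0 <= b i /\ forall s, 0 <= s -> s <= t -> `|y i s| <= b i.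
  exact: (projT2 (cid (one i))).
exists (\sum_i b i) => i s s0 st.
rewrite (bigD1 i) //= -[leLHS]addr0; apply: lerD; first exact: (bP i).2.
by apply: sumr_ge0 => j _; exact: (bP j).1.
Qed.

(** The derivative of the remainder with index N + 1 is - M applied to the remainder with index N.
    Each bound is thus the integral of the preceding one, starting from the bound [B] of the
    solution itself. *)
Lemma taylor_ode_remainder (t B : R) : 0 < t ->
  (forall i s, 0 <= s -> s <= t -> `|y i s| <= B) ->
  let K := \sum_i \sum_k `|M i k| in
  forall N i s, 0 <= s -> s <= t ->
  `|y i s - taylor_ode u N s i| <= B * ((K * s) ^+ N / N`!%:R).
Proof.
move=> t0 yB K; have K0 : 0 <= K by apply: sumr_ge0 => i _; exact: sumr_ge0.
elim=> [|N IH] i s s0 st.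
  by rewrite /taylor_ode big_ord0 subr0 expr0 fact0 divr1 mulr1; exact: yB.
have B0 : 0 <= B by exact: le_trans (yB i 0 (lexx 0) (ltW t0)).
pose g (x : R) := y i x - taylor_ode u N.+1 x i.
pose g' (x : R) := - \sum_k M i k * (y k x - taylor_ode u N x k).
pose f (x : R) := B * ((K * x) ^+ N.+1 / N.+1`!%:R).
pose f' (x : R) := B * (K * ((K * x) ^+ N / N`!%:R)).
have dP (x : R) : is_derive x (1:R) (fun x => taylor_ode u N.+1 x i)
  (- \sum_k M i k * taylor_ode u N x k) := taylor_ode_derive N i x.
have dg (x : R) : 0 < x -> is_derive x (1:R) g (g' x).
  move=> x0; have h1 := dy i x0; have h2 := dP x.
  apply: is_derive_eq; rewrite /g' -opprD; congr (- _); rewrite -sumrB.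
  by apply: eq_bigr => k _; ring.
have df (x : R) : is_derive x (1:R) f (f' x).
  have h := exp_term_derive K x N.
  exact: (is_deriveZ B h).
have cont_of (h h' : R -> R) : (forall x : R, is_derive x (1:R) h (h' x)) ->
    (h x @[x --> (0:R)^'+] --> h 0)%classic.
  move=> dh; apply: cvg_at_right_filter; apply/differentiable_continuous/derivable1_diffP.
  by have dx := dh 0; exact: (@ex_derive _ _ _ _ _ _ _ dx).
have cf : (f x @[x --> (0:R)^'+] --> f 0)%classic := cont_of _ _ df.
have cg : (g x @[x --> (0:R)^'+] --> g 0)%classic.
  by apply: cvgB; [exact: y0|exact: (cont_of _ _ dP)].
have g00 : g 0 = 0 by rewrite /g taylor_ode_at0 subrr.
have f00 : f 0 = 0 by rewrite /f mulr0 expr0n mul0r mulr0.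
have bnd (x : R) : 0 < x -> x <= s -> `|g' x| <= f' x.
  move=> x0 xs; rewrite /g' normrN; apply: le_trans (ler_norm_sum _ _ _) _.
  rewrite /f' mulrCA; set w := B * _.
  have w0 : 0 <= w by rewrite /w mulr_ge0 // divr_ge0 // exprn_ge0 // mulr_ge0 // ltW.
  apply: le_trans (_ : \sum_k `|M i k| * w <= _).
    apply: ler_sum => k _; rewrite normrM; apply: ler_wpM2l => //.
    by apply: IH; [exact: ltW|exact: le_trans st].
  rewrite -mulr_suml; apply: ler_wpM2r => //.
  rewrite /K [leRHS](bigD1 i) //= lerDl; apply: sumr_ge0 => j _.
  by apply: sumr_ge0 => k _.
rewrite -/(g s) -/(f s) ler_norml lerNl; apply/andP; split.
- apply: (@comparison_at_right (fun x => - g x) (fun x => - g' x) f f') => //.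
  + exact: cvgN.
  + by move=> x x0 _; have h := dg x x0; exact: is_deriveN.
  + by move=> x x0 xs; have := bnd x x0 xs; rewrite ler_norml lerNl => /andP[].
  + by rewrite g00 f00 oppr0.
- apply: (@comparison_at_right g g' f f') => //.
  + by move=> x x0 _; exact: dg.
  + by move=> x x0 xs; have := bnd x x0 xs; rewrite ler_norml => /andP[].
  + by rewrite g00 f00.
Qed.

Lemma taylor_ode_cvg (t : R) i : 0 <= t ->
  (taylor_ode u N t i @[N --> \oo] --> y i t)%classic.
Proof.
rewrite le_eqVlt => /predU1P[<-|t0].
  apply/cvgrPdist_le => e e0; near=> N.
  (* The empty sum is 0 and not the initial value, so the claim at t = 0 holds from N = 1 on. *)
  rewrite /= (_ : N = N.-1.+1); last by rewrite prednK //; near: N; exact: nbhs_infty_gt.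
  by rewrite taylor_ode_at0 subrr normr0 ltW.
have [B yB] := ode_bounded t0.
have H := taylor_ode_remainder t0 yB.
set K := \sum_i \sum_k `|M i k| in H.
have c0 : ((fun N => B * ((K * t) ^+ N / N`!%:R)) @ \oo --> (0:R))%classic.
  by rewrite -(mulr0 B); apply: cvgMr; exact: cvg_exp_coeff.
move/cvgrPdist_le : c0 => c0; apply/cvgrPdist_le => e e0; near=> N.
apply: le_trans (H N i t (ltW t0) (lexx t)) _.
have : `|0 - B * ((K * t) ^+ N / N`!%:R)| <= e by near: N; exact: c0.
by rewrite sub0r normrN; apply: le_trans; exact: ler_norm.
Unshelve. all: by end_near. Qed.

End taylor.

Lemma measurable_ode d (T : measurableType d) m (M : T -> 'I_m -> 'I_m -> R)
    (y : T -> 'I_m -> R -> R) (t : R) :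
  (forall i k, measurable_fun setT (fun x => M x i k)) ->
  (forall i, measurable_fun setT (fun x => y x i 0)) ->
  (forall x i, (y x i s @[s --> (0:R)^'+] --> y x i 0)%classic) ->
  (forall x (s : R) i, 0 < s -> is_derive s (1:R) (y x i) (- \sum_k M x i k * y x k s)) ->
  0 <= t -> forall i, measurable_fun setT (fun x => y x i t).
Proof.
move=> mM my cy dy t0 i.
have mp j k : measurable_fun setT (fun x => power_apply (M x) (fun i => y x i 0) j k).
  elim: j k => [|j IH] k /=; first exact: my.
  by apply: measurable_sum => l; apply: measurable_funM.
apply: (@measurable_fun_cvg _ _ _ _
  (fun N x => taylor_ode (M x) (fun i => y x i 0) N t i)) => //.
  by move=> N; apply: measurable_sum => j; apply: measurable_funM.
by move=> x _; apply: (taylor_ode_cvg (cy x)) => // s k s0; exact: dy.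
Qed.

End linear_ode.

(** * Pointwise bound on the Fourier side *)

Section plate_solution.
Context {R : realType}.
Local Notation C := R[i].

(** Real linearity, shared by Re and Im, is what turns a complex system with a real matrix into a
    real one. *)
Definition real_part (rho : C -> R) : Prop :=
  [/\ forall x y, rho (x + y) = rho x + rho y, forall x, rho (- x) = - rho x &
      forall (a : R) (x : C), rho ((a%:C)%C * x) = a * rho x].

Lemma real_part_Re : real_part (@complex.Re R).
Proof. by split=> [[a b] [c d]|[a b]|a [c d]] //=; rewrite mul0r subr0. Qed.

Lemma real_part_Im : real_part (@complex.Im R).
Proof. by split=> [[a b] [c d]|[a b]|a [c d]] //=; rewrite mul0r addr0. Qed.

Lemma real_part_mulmx (rho : C -> R) m k (A : 'M[R]_(m, k)) (x : 'cV[C]_k) i :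
  real_part rho -> rho ((complexmx A *m x) i 0) = \sum_j A i j * rho (x j 0).
Proof.
move=> [rD rN rM]; have r0 : rho 0 = 0.
  by have := rM 0 0; rewrite mulr0 mul0r.
rewrite mxE (big_morph rho rD r0); apply: eq_bigr => j _.
by rewrite mxE rM.
Qed.

Lemma solves_linear_ode_part (rho : C -> R) m (M : 'M[R]_m) (y0 : 'cV[C]_m)
    (y : R -> 'cV[C]_m) :
  rho = @complex.Re R \/ rho = @complex.Im R -> solves_linear_ode M y0 y ->
  [/\ forall i, rho (y 0 i 0) = rho (y0 i 0),
      forall i, (rho (y s i 0%R) @[s --> (0:R)^'+] --> rho (y 0 i 0%R))%classic &
      forall (t : R) i, 0 < t ->
        is_derive t (1:R) (fun s => rho (y s i 0)) (- \sum_k M i k * rho (y t k 0))].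
Proof.
move=> rh [yE cy dy].
have rp : real_part rho by case: rh => ->; [exact: real_part_Re|exact: real_part_Im].
have E (t : R) i : rho ((- (complexmx M *m y t)) i 0) = - \sum_k M i k * rho (y t k 0).
  by rewrite mxE; have [_ -> _] := rp; rewrite real_part_mulmx.
split=> [i|i|t i t0]; first by rewrite yE.
  by have [c1 c2] := cy i; case: rh => ->.
rewrite -E; have [d1 d2] := dy t t0 i.
by case: rh => ->.
Qed.

Lemma sum3E (f : 'I_3 -> R) : \sum_k f k = f 0 + f 1 + f 2%:R.
Proof.
rewrite !big_ord_recl big_ord0 addr0 addrA; congr (_ + _ + _); congr f; exact: val_inj.
Qed.

Context (n : nat) (sigma : R).
Hypothesis s1 : sigma < 1.
Implicit Type xi : 'rV[R]_n.

(** The quotient of the two scales |xi|^2 and |xi|^(2 sigma) in the symbol, called d in the energy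
    estimate. *)
Definition gap xi : R := enorm xi `^ (2 - 2 * sigma).

Lemma gap_sqr xi : enorm xi `^ (4 - 4 * sigma) = gap xi ^+ 2.
Proof.
by rewrite /gap -powR_mulrn ?powR_ge0 // -powRrM; congr (_ `^ _); ring.
Qed.

(** The addition rule for exponents holds at base 0 when the total exponent is not 0. Here it is 2,
    so xi = 0 is included. *)
Lemma gap_mul xi : enorm xi `^ (2 * sigma) * gap xi = enorm xi ^+ 2.
Proof.
have e : 2 * sigma + (2 - 2 * sigma) = 2 by ring.
by rewrite /gap -powRD e ?pnatr_eq0 // (powR_mulrn 2) // enorm_ge0.
Qed.

Lemma gap_mul_sqr xi : enorm xi `^ (2 * sigma) * gap xi ^+ 2 = enorm xi `^ (4 - 2 * sigma).
Proof.
have e : 2 * sigma + (4 - 4 * sigma) = 4 - 2 * sigma by ring.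
rewrite -gap_sqr -powRD e //.
have e0 : 0 < 4 - 2 * sigma by have := s1; lra.
by rewrite (gt_eqF e0).
Qed.

Lemma T0_unit : T0 R \in unitmx.
Proof.
have /mulmx1_unit[] // : T0 R *m (2^-1 *: mx3 [:: [:: -1; 1; 0]; [:: 0; 0; 2]; [:: 1; 1; 0]]) = 1%:M.
by apply/matrixP => -[[|[|[|//]]] hi] -[[|[|[|//]]] hj];
  rewrite !mxE /= sum3E !mxE /=; field.
Qed.

(** The determinant is 1 - 2 d^2, the denominator of the explicit inverse, and it is positive for d
    <= 1/4. *)
Lemma T1_unit xi : gap xi <= 4^-1 -> T1 sigma xi \in unitmx.
Proof.
move=> g4; have g0 : 0 <= gap xi by exact: powR_ge0.
have D0 : 1 - 2 * gap xi ^+ 2 != 0.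
  rewrite gt_eqF // subr_gt0; have : gap xi ^+ 2 <= 4^-1 * gap xi by rewrite expr2 ler_wpM2r.
  lra.
have /mulmx1_unit[] // : T1 sigma xi *m (1%:M + (1 - 2 * gap xi ^+ 2)^-1 *:
  mx3 [:: [:: gap xi ^+ 2; gap xi ^+ 2; - gap xi];
          [:: gap xi ^+ 2; gap xi ^+ 2; - gap xi];
          [:: - gap xi; - gap xi; 2 * gap xi ^+ 2]]) = 1%:M.
by apply/matrixP => -[[|[|[|//]]] hi] -[[|[|[|//]]] hj];
  rewrite !mxE /= sum3E !mxE /= -/(gap xi); field.
Qed.

Lemma T1half_unit xi : gap xi <= 4^-1 -> T1half sigma xi \in unitmx.
Proof.
move=> g4; have g0 : 0 <= gap xi by exact: powR_ge0.
have D0 : 1 - gap xi ^+ 4 != 0.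
  rewrite gt_eqF // subr_gt0 exprn_ilt1 //; lra.
have /mulmx1_unit[] // : T1half sigma xi *m (1%:M + (1 - gap xi ^+ 4)^-1 *:
  mx3 [:: [:: 0; 0; 0];
          [:: 0; gap xi ^+ 4; - gap xi ^+ 2];
          [:: 0; - gap xi ^+ 2; gap xi ^+ 4]]) = 1%:M.
by apply/matrixP => -[[|[|[|//]]] hi] -[[|[|[|//]]] hj];
  rewrite !mxE /= sum3E !mxE /= gap_sqr; field.
Qed.

Lemma diagonalizer_initR xi D2u0 u1 theta0 : gap xi <= 4^-1 ->
  complexmx (T0 R *m T1 sigma xi *m T1half sigma xi) *m initR sigma D2u0 u1 theta0 xi
  = initS D2u0 u1 theta0 xi.
Proof.
move=> g4; rewrite /initR mulmxA /complexmx -map_mxM.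
have v1 := T1_unit g4; have v2 := T1half_unit g4; have v3 := T0_unit.
rewrite -!mulmxA (mulmxA (T1half sigma xi)) mulmxV // mul1mx.
rewrite (mulmxA (T1 sigma xi)) mulmxV // mul1mx mulmxV //.
by rewrite map_mx1 mul1mx.
Qed.

Lemma diagonalizer_col xi (z : 'I_3 -> R) :
  let u := T1T1half_col (gap xi) (z 0) (z 1) (z 2%:R) in
  let P := T0 R *m T1 sigma xi *m T1half sigma xi in
  [/\ \sum_k P 0 k * z k = - u.1.1 + u.2, \sum_k P 1 k * z k = u.1.1 + u.2 &
      \sum_k P 2%:R k * z k = u.1.2].
Proof.
by split; rewrite !sum3E !mxE !sum3E !mxE !sum3E !mxE /= -/(gap xi) gap_sqr; ring.
Qed.

Lemma plate_part_bound (rho : C -> R) xi (D2u0 u1 theta0 : 'rV[R]_n -> C)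
    (w wt : R -> 'rV[R]_n -> 'cV[C]_3) (t : R) :
  rho = @complex.Re R \/ rho = @complex.Im R -> gap xi <= 4^-1 ->
  solutionS sigma D2u0 u1 theta0 w -> solutionR sigma D2u0 u1 theta0 wt -> 0 <= t ->
  forall i, `|rho ((w t xi -
      complexmx (T0 R *m T1 sigma xi *m T1half sigma xi) *m wt t xi) i 0)|
    <= 75 * gap xi * expR (- (8^-1 * enorm xi `^ (4 - 2 * sigma) * t))
       * \sum_j `|rho (initS D2u0 u1 theta0 xi j 0)|.
Proof.
move=> rh g4 sS sR t0 i.
have rp : real_part rho by case: rh => ->; [exact: real_part_Re|exact: real_part_Im].
have [wi cw dw] := solves_linear_ode_part rh (sS xi).
have [zi cz dz] := solves_linear_ode_part rh (sR xi).
set b := enorm xi `^ (2 * sigma).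
pose W k s := rho (w s xi k 0); pose Z k s := rho (wt s xi k 0).
have b0 : 0 <= b by exact: powR_ge0.
have g0 : 0 <= gap xi by exact: powR_ge0.
have [p0 p1 p2] := diagonalizer_col xi (fun k => rho (wt 0 xi k 0)).
have W0 k : W k 0 = \sum_j (T0 R *m T1 sigma xi *m T1half sigma xi) k j * Z j 0.
  by rewrite /W wi -(diagonalizer_initR _ _ _ g4) real_part_mulmx //; apply: eq_bigr => j _;
     rewrite /Z zi.
have cts f : f \in [:: W 0; W 1; W 2%:R; Z 0; Z 1; Z 2%:R] ->
    (f s @[s --> (0:R)^'+] --> f 0)%classic.
  by rewrite !inE => /or4P[/eqP->|/eqP->|/eqP->|/or3P[]/eqP->]; [exact: cw|exact: cw|exact: cw
    |exact: cz|exact: cz|exact: cz].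
have dW (s : R) : 0 < s ->
    [/\ is_derive s (1:R) (W 0) (- (b * gap xi * (- W 1 s - W 2%:R s) + b * ((W 0 s + W 1 s) / 2))),
        is_derive s (1:R) (W 1) (- (b * gap xi * (W 0 s - W 2%:R s) + b * ((W 0 s + W 1 s) / 2))) &
        is_derive s (1:R) (W 2%:R) (- (b * gap xi * ((W 0 s + W 1 s) / 2 + W 2%:R s)))].
  move=> sp; split.
  - have := dw s 0 sp; rewrite sum3E !mxE /= -/b -gap_mul -/b => H.
    by apply: is_derive_eq; rewrite /W; field.
  - have := dw s 1 sp; rewrite sum3E !mxE /= -/b -gap_mul -/b => H.
    by apply: is_derive_eq; rewrite /W; field.
  - have := dw s 2%:R sp; rewrite sum3E !mxE /= -/b -gap_mul -/b => H.
    by apply: is_derive_eq; rewrite /W; field.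
have dZ (s : R) : 0 < s ->
    [/\ is_derive s (1:R) (Z 0) (- (b * gap xi ^+ 2 * Z 0 s)),
        is_derive s (1:R) (Z 1) (- (b * gap xi * Z 1 s)) &
        is_derive s (1:R) (Z 2%:R) (- (b * Z 2%:R s))].
  move=> sp; split.
  - have := dz s 0 sp; rewrite sum3E !mxE /= -gap_mul_sqr -/b => H.
    by apply: is_derive_eq; rewrite /Z; ring.
  - have := dz s 1 sp; rewrite sum3E !mxE /= -gap_mul -/b => H.
    by apply: is_derive_eq; rewrite /Z; ring.
  - have := dz s 2%:R sp; rewrite sum3E !mxE /= -/b => H.
    by apply: is_derive_eq; rewrite /Z; ring.
have init : ((W 1 0 - W 0 0) / 2, W 2%:R 0, (W 0 0 + W 1 0) / 2) =
    T1T1half_col (gap xi) (Z 0 0) (Z 1 0) (Z 2%:R 0).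
  rewrite !W0 p0 p1 p2 -/(Z 0 0) -/(Z 1 0) -/(Z 2%:R 0).
  by case: (T1T1half_col _ _ _ _) => -[x y] z /=; congr (_, _, _); field.
have := @plate_difference_decay R b (gap xi) (W 0) (W 1) (W 2%:R) (Z 0) (Z 1) (Z 2%:R)
  b0 g0 g4 cts dW dZ init t t0.
rewrite /= (_ : b * gap xi ^+ 2 / 8 * t = 8^-1 * enorm xi `^ (4 - 2 * sigma) * t); last first.
  by rewrite gap_mul_sqr; ring.
have -> : `|W 0 0| + `|W 1 0| + `|W 2%:R 0| = \sum_j `|rho (initS D2u0 u1 theta0 xi j 0)|.
  by rewrite sum3E /W !wi.
have vE k : rho ((w t xi -
      complexmx (T0 R *m T1 sigma xi *m T1half sigma xi) *m wt t xi) k 0) =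
    W k t - \sum_j (T0 R *m T1 sigma xi *m T1half sigma xi) k j * Z j t.
  by rewrite !mxE; have [rD rN _] := rp; rewrite rD rN -real_part_mulmx // mxE.
have [q0 q1 q2] := diagonalizer_col xi (fun k => Z k t).
rewrite vE => -[B0 B1 B2].
have [->|[->|->]] : i = 0 \/ (i = 1 \/ i = 2%:R).
  by case: i => -[|[|[|//]]] hi; [left|right; left|right; right]; apply: val_inj.
- by rewrite q0.
- by rewrite q1.
- by rewrite q2.
Qed.

End plate_solution.

(** * L^p - L^q estimate for radial multipliers *)

Section radial_multiplier.
Context {R : realType}.
Local Notation rT := (measurableTypeR R).
Local Notation mun n := (@lebesgue_tuple R n).

(** The truncation to the unit ball places the weight inside the cube of the Bessel inequality; the
    support of chi lies in this ball. *)
Definition radial (n : nat) (a c k t : R) (z : n.-tuple rT) : R :=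
  if enorm (row_of_tuple z) <= 1 then
    enorm (row_of_tuple z) `^ a * expR (- (c * enorm (row_of_tuple z) `^ k * t))
  else 0.

Lemma radial_ge0 n a c k t (z : n.-tuple rT) : 0 <= radial a c k t z.
Proof. by rewrite /radial; case: ifP => // _; rewrite mulr_ge0 ?powR_ge0 ?expR_ge0. Qed.

Lemma measurable_radial n a c k t : measurable_fun setT (@radial n a c k t).
Proof.
have me := @measurable_enorm R n.
have mp b : measurable_fun setT (fun z : n.-tuple rT => enorm (row_of_tuple z) `^ b).
  exact: (measurableT_comp (measurable_powR b) me).
apply: measurable_fun_ifT => //; first exact: measurable_fun_ler.
apply: measurable_funM => //; apply: (measurableT_comp (@measurable_expR R)).
by apply: measurableT_comp => //; apply: measurable_funM => //; apply: measurable_funM.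
Qed.

Lemma radial_split n a c k t (z : n.-tuple rT) :
  radial a c k t z = radial 0 (c / 2) k t z * radial a (c / 2) k t z.
Proof.
rewrite /radial; case: ifP => _; last by rewrite mulr0.
rewrite powRr0 mul1r mulrCA -expRD; congr (_ * expR _).
by move: (_ `^ k) => x; lra.
Qed.

Lemma radial_sup n (a c k : R) : 0 <= a -> 0 < c -> 0 < k ->
  exists2 C : R, 0 < C & forall t (z : n.-tuple rT), 0 <= t ->
  radial a c k t z <= C * (1 + t) `^ (- (a / k)) * unit_cube z.
Proof.
move=> a0 c0 k0; have [C C0 HC] := radial_sup_decay a0 c0 k0; exists C => // t z t0.
have D0 : 0 <= C * (1 + t) `^ (- (a / k)) by rewrite mulr_ge0 ?powR_ge0 // ltW.
rewrite /radial; case: ifPn => [z1|_].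
  by rewrite unit_cube_enorm // mulr1; apply: HC => //; exact: enorm_ge0.
by rewrite mulr_ge0 //; have /andP[] := unit_cube01 z.
Qed.

Lemma radial_L2 n (a c k : R) : 0 <= a -> 0 < c -> 2 <= k ->
  exists2 C : R, 0 < C & forall t : R, 0 <= t ->
  (\int[mun n]_z ((radial a c k t z) ^+ 2)%:E
   <= ((C * (1 + t) `^ (- (a / k + n%:R / (2 * k)))) ^+ 2)%:E)%E.
Proof.
move=> a0 c0 k2; have k0 : 0 < k by lra.
have c2 : 0 < c / 2 by lra.
have [C1 C10 H1] := radial_sup_decay a0 c2 k0.
have [C2 C20 H2] := radial_product_decay n c0 k2.
have pi0 := pi_gt0 R.
exists (Num.sqrt (C1 ^+ 2 * C2 * pi ^+ n)).
  by rewrite sqrtr_gt0 !mulr_gt0 // exprn_gt0.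
move=> t t0; have t1 : 0 < 1 + t by lra.
set l := (1 + t) `^ k^-1.
have l0 : 0 < l by exact: powR_gt0.
set E := C1 * (1 + t) `^ (- (a / k)).
have E0 : 0 <= E by rewrite mulr_ge0 ?powR_ge0 // ltW.
have step (z : n.-tuple rT) : (radial a c k t z) ^+ 2 <=
    E ^+ 2 * C2 * \prod_(i < n) (1 + (l * tnth z i) ^+ 2)^-1.
  rewrite /radial; case: ifPn => [z1|_]; last first.
    rewrite expr0n mulr_ge0 ?product_decay_ge0 // mulr_ge0 ?sqr_ge0 // ltW //.
  set r := enorm _.
  have r0 : 0 <= r := enorm_ge0 _.
  (* The squared exponential is split in two: one half is kept with r^a for a supremum bound, the
     other is integrated. *)
  have -> : (r `^ a * expR (- (c * r `^ k * t))) ^+ 2 =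
      (r `^ a * expR (- (c / 2 * r `^ k * t))) ^+ 2 * expR (- (c * r `^ k * t)).
    have -> : expR (- (c * r `^ k * t)) = expR (- (c / 2 * r `^ k * t)) ^+ 2.
      by rewrite -expRM_natr; congr expR; move: (r `^ k) => x; lra.
    by ring.
  rewrite -[leRHS]mulrA; apply: ler_pM; rewrite ?sqr_ge0 ?expR_ge0 //.
    have h := H1 r t r0 z1 t0; apply: lerXn2r => //.
    by rewrite nnegrE mulr_ge0 ?powR_ge0 ?expR_ge0.
  apply: le_trans (H2 r t r0 z1 t0) _; apply: ler_wpM2l; first exact: ltW.
  exact: prod_coord_le.
apply: (@le_trans _ _ (\int[mun n]_z ((E ^+ 2 * C2)%:E *
    (\prod_(i < n) (1 + (l * tnth z i) ^+ 2)^-1)%:E)))%E.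
  apply: ge0_le_integral => //.
  - by move=> z _; rewrite lee_fin sqr_ge0.
  - by apply/measurable_EFinP/measurable_funX; exact: measurable_radial.
  - by apply: measurable_funeM; apply/measurable_EFinP; exact: measurable_product_decay.
  - by move=> z _; rewrite -EFinM lee_fin; exact: step.
rewrite ge0_integralZl_EFin //; first last.
- by rewrite mulr_ge0 ?sqr_ge0 // ltW.
- by apply/measurable_EFinP; exact: measurable_product_decay.
- by move=> z _; rewrite lee_fin product_decay_ge0.
apply: le_trans (lee_wpmul2l _ (integral_product_decay n l0)) _.
  by rewrite lee_fin mulr_ge0 ?sqr_ge0 // ltW.
rewrite -EFinM lee_fin [leRHS]exprMn sqr_sqrtr; last first.
  by rewrite !mulr_ge0 ?sqr_ge0 ?exprn_ge0 // ltW.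
rewrite /E exprMn exprMn exprVn.
have -> : l ^+ n = (1 + t) `^ (n%:R / k).
  by rewrite /l -powR_mulrn ?powR_ge0 // -powRrM mulrC.
have sq b : ((1 + t) `^ b) ^+ 2 = (1 + t) `^ (b * 2).
  by rewrite -powR_mulrn ?powR_ge0 // -powRrM.
rewrite -powRN !sq.
have -> : - (a / k + n%:R / (2 * k)) * 2 = - (a / k) * 2 + - (n%:R / k).
  by field; rewrite gt_eqF.
rewrite powRD; last by rewrite (gt_eqF t1) implybT.
by rewrite le_eqVlt; apply/orP; left; apply/eqP; ring.
Qed.

End radial_multiplier.

Section multiplier_estimate.
Context {R : realType}.
Local Notation rT := (measurableTypeR R).
Local Notation mun n := (@lebesgue_tuple R n).

Lemma le_integral_sum_sqr d (T : measurableType d) (mu : {measure set T -> \bar R})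
    (J : finType) (f : J -> T -> R) (B : R) :
  (forall j, measurable_fun setT (f j)) ->
  (forall j, \int[mu]_x (f j x ^+ 2)%:E <= (B ^+ 2)%:E)%E -> 0 <= B ->
  (\int[mu]_x ((\sum_j `|f j x|) ^+ 2)%:E <= ((#|J|%:R * B) ^+ 2)%:E)%E.
Proof.
move=> mf fB B0.
have cs (b : J -> R) : (\sum_j `|b j|) ^+ 2 <= #|J|%:R * \sum_j b j ^+ 2.
  rewrite expr2 mulr_suml mulr_sumr.
  under eq_bigr do rewrite mulr_sumr.
  apply: (@le_trans _ _ (\sum_i \sum_j (b i ^+ 2 + b j ^+ 2) / 2)).
    apply: ler_sum => i _; apply: ler_sum => j _.
    have := sqr_ge0 (`|b i| - `|b j|); rewrite sqrrB !real_normK ?num_real //; lra.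
  under eq_bigr do rewrite -mulr_suml big_split /= sumr_const.
  rewrite -mulr_suml big_split /= sumr_const -mulr_natl -sumrMnl.
  rewrite (eq_bigr (fun i => #|J|%:R * b i ^+ 2)); last by move=> i _; rewrite mulr_natl.
  by rewrite -mulr_sumr; lra.
apply: (@le_trans _ _ (\int[mu]_x (#|J|%:R%:E * \sum_j (f j x ^+ 2)%:E)))%E.
  apply: ge0_le_integral => //.
  - by move=> x _; rewrite lee_fin sqr_ge0.
  - apply/measurable_EFinP/measurable_funX; apply: measurable_sum => j.
    exact: measurableT_comp.
  - apply: measurable_funeM; apply: emeasurable_sum => j.
    by apply/measurable_EFinP; exact: measurable_funX.
  - by move=> x _; rewrite sumEFin -EFinM lee_fin.
rewrite ge0_integralZl_EFin //; first last.
- apply: emeasurable_sum => j; by apply/measurable_EFinP; exact: measurable_funX.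
- by move=> x _; apply: sume_ge0 => j _; rewrite lee_fin sqr_ge0.
rewrite ge0_integral_sum //; first last.
- by move=> j x _; rewrite lee_fin sqr_ge0.
- by move=> j; apply/measurable_EFinP; exact: measurable_funX.
rewrite exprMn expr2 -mulrA EFinM; apply: lee_wpmul2l; first by rewrite lee_fin.
apply: (@le_trans _ _ (\sum_(j : J) (B ^+ 2)%:E)%E); first by apply: lee_sum.
by rewrite sumEFin lee_fin sumr_const mulr_natl.
Qed.

Lemma radial_dual n (a c k p : R) : 0 <= a -> 0 < c -> 2 <= k -> 1 <= p -> p <= 2 ->
  exists2 C : R, 0 <= C & forall t u (g : n.-tuple rT -> R) L, 0 <= t ->
  u = cos \/ u = sin -> (mun n).-integrable setT (EFin \o g) -> 0 <= L ->
  (Lnorm (mun n) p%:E (EFin \o g) <= L%:E)%E ->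
  (\int[mun n]_y ((radial a c k t y * trig_transform u g y) ^+ 2)%:E
   <= ((C * (1 + t) `^ (- (a / k + n%:R / k * (p^-1 - 2^-1))) * L) ^+ 2)%:E)%E.
Proof.
move=> a0 c0 k2 p1 p2; have k0 : 0 < k by lra.
have p0 : 0 < p by lra.
have [C2 C20 H2] := radial_L2 n a0 c0 k2.
have [Co Co0 Ho] := radial_sup n a0 c0 k0.
exists (C2 `^ (2 / p - 1) * (Num.sqrt (bessel_cst n) * Co) `^ (2 - 2 / p)).
  by rewrite mulr_ge0 ?powR_ge0.
move=> t u g L t0 ucs gi L0 gL; have t1 : 0 < 1 + t by lra.
have T0 b : 0 <= (1 + t) `^ b by exact: powR_ge0.
have Moo0 : 0 <= Co * (1 + t) `^ (- (a / k)) by rewrite mulr_ge0 // ltW.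
have M20 : 0 <= C2 * (1 + t) `^ (- (a / k + n%:R / (2 * k))) by rewrite mulr_ge0 // ltW.
have sb : 0 <= Num.sqrt (bessel_cst n) * Co by rewrite mulr_ge0 ?sqrtr_ge0 // ltW.
apply: le_trans (dual_bound ucs gi (measurable_radial _ _ _ _) (radial_ge0 _ _ _ _)
  (fun y => Ho t y t0) Moo0 M20 (H2 t t0) p1 p2 L0 gL) _.
rewrite /dual_constant mulrA (powRM _ (ltW C20) (T0 _)) (powRM _ sb (T0 _)).
rewrite -!powRrM le_eqVlt; apply/orP; left; apply/eqP; congr ((_ * _) ^+ 2)%:E.
rewrite mulrACA; congr (_ * _); rewrite -powRD; last by rewrite (gt_eqF t1) implybT.
(* (2/p - 1) (a/k + n/(2k)) + (2 - 2/p) a/k = a/k + (n/k) (1/p - 1/2). *)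
by congr (_ `^ _); field; rewrite !gt_eqF.
Qed.

Section amplitude.
Context (n : nat) (a c k p K : R) (J : finType).

(** These are the two endpoints of the later interpolation. [J] lists the cosine and sine transforms
    of the parts of the data, whose sum dominates G; [v] is one of the functions in the inverse
    transform. *)
Lemma multiplier_bounds : 0 <= a -> 0 < c -> 2 <= k -> 1 <= p -> p <= 2 -> 0 <= K ->
  exists2 C : R, 0 <= C & forall t (u : J -> R -> R) (g : J -> n.-tuple rT -> R) L,
  0 <= t -> (forall j, u j = cos \/ u j = sin) ->
  (forall j, (mun n).-integrable setT (EFin \o g j)) -> 0 <= L ->
  (forall j, Lnorm (mun n) p%:E (EFin \o g j) <= L%:E)%E ->
  forall G : n.-tuple rT -> R, measurable_fun setT G ->
  (forall z, `|G z| <= K * radial a c k t z * \sum_j `|trig_transform (u j) (g j) z|) ->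
  (mun n).-integrable setT (EFin \o G) /\ forall v, v = cos \/ v = sin ->
  (forall x, `|trig_transform v G x| <= C * (1 + t) `^ (- (a / k + n%:R / k * p^-1)) * L) /\
  (\int[mun n]_x ((trig_transform v G x) ^+ 2)%:E
   <= ((C * (1 + t) `^ (- (a / k + n%:R / k * (p^-1 - 2^-1))) * L) ^+ 2)%:E)%E.
Proof.
move=> a0 c0 k2 p1 p2 K0; have k0 : 0 < k by lra.
have p0 : 0 < p by lra.
have c20 : 0 < c / 2 by lra.
have [D1 D10 H1] := radial_dual n a0 c0 k2 p1 p2.
have [D2 D20 H2] := radial_dual n a0 c20 k2 p1 p2.
have [D3 D30 H3] := radial_L2 n (lexx 0) c20 k2.
have [Co Co0 Ho] := radial_sup n a0 c0 k0.
set N : R := #|J|%:R; have N0 : 0 <= N by exact: ler0n.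
(* [X] comes from the L^1 bound of G, by Cauchy-Schwarz with the two halves of the weight, and [Y]
   from the Bessel inequality applied to G. *)
pose X := K * (N * (D3 * D2)); pose Y := Num.sqrt (bessel_cst n) * (K * (N * D1)).
have X0 : 0 <= X by rewrite !mulr_ge0 // ltW.
have Y0 : 0 <= Y by rewrite !mulr_ge0 ?sqrtr_ge0.
exists (X + Y); first by rewrite addr_ge0.
move=> t u g L t0 ucs gi L0 gL G mG Gle; have t1 : 0 < 1 + t by lra.
have T0 b : 0 <= (1 + t) `^ b by exact: powR_ge0.
have mt j := measurable_trig_transform_tuple (ucs j) (gi j).
have mr b d := @measurable_radial R n b d k t.
have rt0 b d z : 0 <= @radial R n b d k t z by exact: radial_ge0.
pose f j z := radial a c k t z * trig_transform (u j) (g j) z.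
have mf j : measurable_fun setT (f j) by exact: measurable_funM.
have Gf z : `|G z| <= K * \sum_j `|f j z|.
  apply: le_trans (Gle z) _; rewrite -mulrA; apply: ler_wpM2l => //.
  by rewrite mulr_sumr; apply: ler_sum => j _; rewrite normrM ger0_norm.
pose f2 j z := radial a (c / 2) k t z * trig_transform (u j) (g j) z.
have mf2 j : measurable_fun setT (f2 j) by exact: measurable_funM.
pose E1 := (1 + t) `^ (- (a / k + n%:R / k * (p^-1 - 2^-1))).
pose E0 := (1 + t) `^ (- (0 / k + n%:R / (2 * k))).
have E00 : 0 <= E0 by exact: T0.
have E10 : 0 <= E1 by exact: T0.
have CS j : (\int[mun n]_z (`|f j z|)%:E <= ((D3 * E0) * (D2 * E1 * L))%:E)%E.
  have := @integral_CauchySchwarz _ _ _ (mun n) (radial 0 (c / 2) k t) (f2 j)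
    (D3 * E0) (D2 * E1 * L) (mr _ _) (mf2 j).
  have -> : (fun z => (`|radial 0 (c / 2) k t z * f2 j z|)%:E) = (fun z => (`|f j z|)%:E).
    by apply/funext => z; rewrite /f /f2 mulrA -radial_split.
  apply; [by rewrite mulr_ge0 // ltW|by rewrite !mulr_ge0|exact: H3|].
  exact: (H2 t (u j) (g j) L t0 (ucs j) (gi j) L0 (gL j)).
have mGn : measurable_fun setT (fun z => (`|G z|)%:E).
  by apply/measurable_EFinP; exact: measurableT_comp.
have iG : (\int[mun n]_z (`|G z|)%:E <= (X * (E0 * E1) * L)%:E)%E.
  apply: (@le_trans _ _ (\int[mun n]_z (K%:E * \sum_j (`|f j z|)%:E)))%E.
    apply: ge0_le_integral => //.
    - apply: measurable_funeM; apply: emeasurable_sum => j.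
      by apply/measurable_EFinP; exact: measurableT_comp.
    - by move=> z _; rewrite sumEFin -EFinM lee_fin.
  rewrite ge0_integralZl_EFin //; first last.
  - apply: emeasurable_sum => j; by apply/measurable_EFinP; exact: measurableT_comp.
  - by move=> z _; apply: sume_ge0 => j _; rewrite lee_fin.
  rewrite ge0_integral_sum //; first last.
  - by move=> j; apply/measurable_EFinP; exact: measurableT_comp.
  have -> : (X * (E0 * E1) * L)%:E = (K%:E * (N * (D3 * E0 * (D2 * E1 * L)))%:E)%E.
    by rewrite -EFinM /X; congr EFin; ring.
  apply: lee_wpmul2l; first by rewrite lee_fin.
  apply: (@le_trans _ _ (\sum_(j : J) (D3 * E0 * (D2 * E1 * L))%:E)%E).
    by apply: lee_sum => j _; exact: CS.
  by rewrite sumEFin lee_fin sumr_const mulr_natl.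
have giG : (mun n).-integrable setT (EFin \o G).
  apply/integrableP; split; first exact/measurable_EFinP.
  by apply: le_lt_trans iG _; exact: ltry.
have EE : E0 * E1 = (1 + t) `^ (- (a / k + n%:R / k * p^-1)).
  rewrite -powRD; last by rewrite (gt_eqF t1) implybT.
  by congr (_ `^ _); field; rewrite !gt_eqF.
split=> // v vcs; have [cv v1] := cos_sin_bounded vcs; split => [x|].
  apply: le_trans (trig_transform_tuple_bound vcs giG x) _.
  have iGn := integrable_norm giG.
  rewrite -lee_fin fineK; last exact: integrable_fin_num.
  apply: le_trans iG _; rewrite EE lee_fin; apply: ler_wpM2r => //.
  by apply: ler_wpM2r => //; rewrite lerDl.
have Gcube z : G z * unit_cube z = G z.
  have [z1|z1] := boolP (enorm (row_of_tuple z) <= 1).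
    by rewrite unit_cube_enorm // mulr1.
  have := Gle z; rewrite /radial (negbTE z1) mulr0 mul0r normr_le0 => /eqP ->.
  by rewrite mul0r.
have GB z : `|G z| <= K * (Co * (1 + t) `^ (- (a / k))) * \sum_j \int[mun n]_x `|g j x|.
  apply: le_trans (Gle z) _; apply: ler_pM.
  - by rewrite mulr_ge0.
  - by apply: sumr_ge0.
  - apply: ler_wpM2l => //; apply: le_trans (Ho t z t0) _.
    rewrite -[leRHS]mulr1; apply: ler_wpM2l; first by rewrite mulr_ge0 // ltW.
    by have /andP[] := unit_cube01 z.
  - by apply: ler_sum => j _; exact: trig_transform_tuple_bound.
have tE x : trig_transform v G x = \int[mun n]_y (G y * trig_kernel v (x, y)).
  apply: eq_Rintegral => y _; rewrite /trig_kernel /= tdotC.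
  by rewrite -{1}(Gcube y); ring.
under eq_integral do rewrite tE.
apply: le_trans (bessel_tuple vcs mG GB) _.
have F1 := @le_integral_sum_sqr _ _ (mun n) J f (D1 * E1 * L) mf.
have {}F1 : (\int[mun n]_z ((\sum_j `|f j z|) ^+ 2)%:E <= ((N * (D1 * E1 * L)) ^+ 2)%:E)%E.
  apply: F1; last by rewrite !mulr_ge0.
  by move=> j; exact: (H1 t (u j) (g j) L t0 (ucs j) (gi j) L0 (gL j)).
have ms : measurable_fun setT (fun z => ((\sum_j `|f j z|) ^+ 2)%:E).
  apply/measurable_EFinP/measurable_funX; apply: measurable_sum => j.
  exact: measurableT_comp.
apply: (@le_trans _ _ (((Y * E1 * L) ^+ 2)%:E)); last first.
  rewrite lee_fin; apply: lerXn2r; rewrite ?nnegrE ?mulr_ge0 ?addr_ge0 //.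
  by do 2 (apply: ler_wpM2r => //); rewrite lerDr.
have -> : (Y * E1 * L) ^+ 2 = bessel_cst n * (K ^+ 2 * (N * (D1 * E1 * L)) ^+ 2).
  by rewrite -(sqr_sqrtr (bessel_cst_ge0 n)) /Y; ring.
rewrite EFinM; apply: lee_wpmul2l; first by rewrite lee_fin bessel_cst_ge0.
rewrite EFinM; apply: le_trans (lee_wpmul2l _ F1); last by rewrite lee_fin sqr_ge0.
rewrite -ge0_integralZl_EFin ?sqr_ge0 //; last by move=> z _; rewrite lee_fin sqr_ge0.
apply: ge0_le_integral => //.
- by move=> z _; rewrite lee_fin mulr_ge0 ?sqr_ge0 //; have /andP[] := unit_cube01 z.
- apply/measurable_EFinP; apply: measurable_funM; first exact: measurable_funX.
  exact: measurable_unit_cube.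
- exact: measurable_funeM.
- move=> z _; rewrite -EFinM lee_fin expr2 -mulrA Gcube -expr2 -exprMn -real_normK ?num_real //.
  apply: lerXn2r; rewrite ?nnegrE //.
  by rewrite mulr_ge0 //; apply: sumr_ge0.
Qed.

End amplitude.

(** Interpolation with parameter 2/q gives the exponent: (1 - 2/q)/p + (2/q) (1/p - 1/2) = 1/p -
    1/q. [I] is meant for the four real transforms that bound an inverse Fourier transform and [kap]
    for its factor (2 pi)^(- n). *)
Lemma multiplier_estimate n (a c k p K kap : R) (q : \bar R) (I J : finType) :
  0 <= a -> 0 < c -> 2 <= k -> 1 <= p -> p <= 2 -> 0 <= K -> 0 <= kap -> (2%:E <= q)%E ->
  exists2 C : R, 0 <= C & forall t (u : J -> R -> R) (g : J -> n.-tuple rT -> R) L,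
  0 <= t -> (forall j, u j = cos \/ u j = sin) ->
  (forall j, (mun n).-integrable setT (EFin \o g j)) -> 0 <= L ->
  (forall j, Lnorm (mun n) p%:E (EFin \o g j) <= L%:E)%E ->
  forall (v : I -> R -> R) (G : I -> n.-tuple rT -> R),
  (forall i, v i = cos \/ v i = sin) -> (forall i, measurable_fun setT (G i)) ->
  (forall i z, `|G i z| <= K * radial a c k t z * \sum_j `|trig_transform (u j) (g j) z|) ->
  (forall i, (mun n).-integrable setT (EFin \o G i)) /\
  forall H : n.-tuple rT -> R, measurable_fun setT H ->
  (forall x, `|H x| <= kap * \sum_i `|trig_transform (v i) (G i) x|) ->
  (Lnorm (mun n) q (EFin \o H) <=
    (C * (1 + t) `^ (- (a / k + n%:R / k * (p^-1 - fine q^-1))) * L)%:E)%E.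
Proof.
move=> a0 c0 k2 p1 p2 K0 kap0 q2; have k0 : 0 < k by lra.
have [C C0 HC] := multiplier_bounds n J a0 c0 k2 p1 p2 K0.
set N : R := #|I|%:R; have N0 : 0 <= N by exact: ler0n.
exists (kap * (N * C)); first by rewrite !mulr_ge0.
move=> t u g L t0 ucs gi L0 gL v G vcs mG Gle; have t1 : 0 < 1 + t by lra.
pose S := kap * (N * C) * L.
have S0 : 0 <= S by rewrite !mulr_ge0.
pose eB := - (a / k + n%:R / k * p^-1).
pose eA := - (a / k + n%:R / k * (p^-1 - 2^-1)).
have h i := HC t u g L t0 ucs gi L0 gL (G i) (mG i) (Gle i).
have T0 b : 0 <= (1 + t) `^ b by exact: powR_ge0.
split=> [i|H mH Hle]; first exact: (h i).1.
have B0 : 0 <= S * (1 + t) `^ eB by rewrite mulr_ge0.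
have A0 : 0 <= S * (1 + t) `^ eA by rewrite mulr_ge0.
have HB x : `|H x| <= S * (1 + t) `^ eB.
  apply: le_trans (Hle x) _.
  have -> : S * (1 + t) `^ eB = kap * (N * (C * (1 + t) `^ eB * L)) by rewrite /S; ring.
  apply: ler_wpM2l => //.
  apply: le_trans (ler_sum _ (fun i _ => ((h i).2 _ (vcs i)).1 x)) _.
  by rewrite sumr_const -[leLHS]mulr_natl.
have HA : (\int[mun n]_x (H x ^+ 2)%:E <= ((S * (1 + t) `^ eA) ^+ 2)%:E)%E.
  pose F i := trig_transform (v i) (G i).
  have mF i : measurable_fun setT (F i).
    exact: measurable_trig_transform_tuple (vcs i) (h i).1.
  have F1 : (\int[mun n]_x ((\sum_i `|F i x|) ^+ 2)%:E
      <= ((N * (C * (1 + t) `^ eA * L)) ^+ 2)%:E)%E.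
    apply: le_integral_sum_sqr => //; last by rewrite !mulr_ge0.
    by move=> i; exact: ((h i).2 _ (vcs i)).2.
  have ms : measurable_fun setT (fun z => ((\sum_i `|F i z|) ^+ 2)%:E).
    apply/measurable_EFinP/measurable_funX; apply: measurable_sum => i.
    exact: measurableT_comp.
  have -> : (S * (1 + t) `^ eA) ^+ 2 = kap ^+ 2 * (N * (C * (1 + t) `^ eA * L)) ^+ 2.
    by rewrite /S; ring.
  rewrite EFinM; apply: le_trans (lee_wpmul2l _ F1); last by rewrite lee_fin sqr_ge0.
  rewrite -ge0_integralZl_EFin ?sqr_ge0 //; last by move=> z _; rewrite lee_fin sqr_ge0.
  apply: ge0_le_integral => //.
  - by move=> z _; rewrite lee_fin sqr_ge0.
  - exact/measurable_EFinP/measurable_funX.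
  - exact: measurable_funeM.
  - move=> z _; rewrite -EFinM lee_fin -exprMn -real_normK ?num_real //.
    apply: lerXn2r; rewrite ?nnegrE //.
    by rewrite mulr_ge0 //; apply: sumr_ge0.
apply: le_trans (Lnorm_interpolation mH A0 B0 q2 HB HA) _.
rewrite lee_fin; set th := fine _.
rewrite !(powRM _ S0 (T0 _)) -!powRrM mulrACA.
have e1 : 1 - 2 * th + 2 * th = 1 by ring.
rewrite -powRD ?e1 ?oner_eq0 // powRr1 //.
rewrite -powRD; last by rewrite (gt_eqF t1) implybT.
rewrite -[leRHS]mulrAC -/S le_eqVlt; apply/orP; left; apply/eqP.
by congr (_ * _ `^ _); rewrite /eA /eB; field; rewrite !gt_eqF //; lra.
Qed.

End multiplier_estimate.

(** * Fourier transforms as sine and cosine transforms *)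

Section measurable_matrix.
Context d (T : measurableType d) {R : realType}.

(** The inverse is not continuous at 0. The identity 1/x = x (x^2)^(-1), which also holds at 0
    because both sides are 0 there, reduces it to a real power. *)
Lemma measurable_invr (f : T -> R) : measurable_fun setT f ->
  measurable_fun setT (fun x => (f x)^-1).
Proof.
move=> mf; rewrite (_ : (fun x => _) = (fun x => f x * (f x ^+ 2) `^ (-1))).
  apply: measurable_funM => //.
  by apply: (measurableT_comp (measurable_powR (-1))); exact: measurable_funX.
apply/funext => x; rewrite powR_inv1 ?sqr_ge0 //.
have [->|f0] := eqVneq (f x) 0; first by rewrite invr0 mul0r.
by rewrite expr2 invfM mulrA divff // mul1r.
Qed.

Lemma measurable_det m (A : T -> 'M[R]_m) :
  (forall i j, measurable_fun setT (fun x => A x i j)) ->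
  measurable_fun setT (fun x => \det (A x)).
Proof.
move=> mA; apply: measurable_sum => s; apply: measurable_funM => //.
by apply: measurable_prod => i _; exact: mA.
Qed.

Lemma measurable_mulmx m k l (A : T -> 'M[R]_(m, k)) (B : T -> 'M[R]_(k, l)) :
  (forall i j, measurable_fun setT (fun x => A x i j)) ->
  (forall i j, measurable_fun setT (fun x => B x i j)) ->
  forall i j, measurable_fun setT (fun x => (A x *m B x) i j).
Proof.
move=> mA mB i j; under eq_fun do rewrite mxE.
by apply: measurable_sum => r; exact: measurable_funM.
Qed.

(** The initial value of the reference system must be measurable on the whole space, including the
    xi where T1 or T1half is singular. There [invmx A] is [A] itself; elsewhere Cramer's rule
    applies. *)
Lemma measurable_invmx m (A : T -> 'M[R]_m) :
  (forall i j, measurable_fun setT (fun x => A x i j)) ->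
  forall i j, measurable_fun setT (fun x => invmx (A x) i j).
Proof.
move=> mA i j; have md := measurable_det mA.
have mc : measurable_fun setT (fun x => cofactor (A x) j i).
  apply: measurable_funM => //; apply: measurable_det => k l.
  by under eq_fun do rewrite !mxE; exact: mA.
rewrite (_ : (fun x => _) =
  (fun x => if \det (A x) == 0 then A x i j else (\det (A x))^-1 * cofactor (A x) j i)).
  apply: measurable_fun_ifT => //; first exact: measurable_fun_eqr.
  by apply: measurable_funM => //; exact: measurable_invr.
apply/funext => x; rewrite /invmx unitmxE unitfE.
by case: eqP => //= _; rewrite !mxE.
Qed.

End measurable_matrix.

Section Lnorm_monotone.
Context d (T : measurableType d) {R : realType} (mu : {measure set T -> \bar R}).

Lemma le_Lnorm (p : R) (f g : T -> R) : 0 < p ->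
  measurable_fun setT f -> measurable_fun setT g -> (forall x, `|f x| <= `|g x|) ->
  (Lnorm mu p%:E (EFin \o f) <= Lnorm mu p%:E (EFin \o g))%E.
Proof.
move=> p0 mf mg fg; rewrite unlock.
have mp (h : T -> R) : measurable_fun setT h ->
    measurable_fun setT (fun x => `|(EFin \o h) x| `^ p)%E.
  move=> mh; rewrite (_ : (fun x => _) = (fun x => (`|h x| `^ p)%:E)); last by apply/funext.
  apply/measurable_EFinP; apply: (measurableT_comp (measurable_powR p)).
  exact: measurableT_comp.
have i0 (h : T -> R) : (0 <= \int[mu]_x (`|(EFin \o h) x| `^ p))%E.
  by apply: integral_ge0 => x _; exact: poweR_ge0.
apply: gt0_ler_poweR.
- by rewrite invr_ge0 ltW.
- by rewrite in_itv /= leey andbT; exact: i0.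
- by rewrite in_itv /= leey andbT; exact: i0.
apply: ge0_le_integral => //; [by move=> x _; exact: poweR_ge0|exact: mp|exact: mp|].
by move=> x _ /=; rewrite lee_fin; apply: ler_powR2 => //; exact: ltW.
Qed.

End Lnorm_monotone.

(** * Real and imaginary parts of Fourier transforms *)

Section fourier_parts.
Context {R : realType} (n : nat).
Local Notation C := R[i].
Local Notation rT := (measurableTypeR R).
Local Notation mun := (@lebesgue_tuple R n).
Implicit Type f : 'rV[R]_n -> C.

(** Together with [cpart], pairs of booleans index the four real transforms that make up a complex
    Fourier transform. *)
Definition trig_of (b : bool) : R -> R := if b then cos else sin.

Definition cpart (b : bool) f (z : n.-tuple rT) : R :=
  if b then complex.Re (f (row_of_tuple z)) else complex.Im (f (row_of_tuple z)).

Lemma trig_of_cases b : trig_of b = cos \/ trig_of b = sin.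
Proof. by case: b; [left|right]. Qed.

Lemma normc_parts (x : C) : ComplexField.Normc.normc x <= `|complex.Re x| + `|complex.Im x|.
Proof.
case: x => a b /=; rewrite -ler_sqr ?nnegrE ?sqrtr_ge0 ?addr_ge0 //.
rewrite sqr_sqrtr ?addr_ge0 ?sqr_ge0 // sqrrD !real_normK ?num_real //.
by rewrite lerD2r lerDl mulrn_wge0 // mulr_ge0.
Qed.

Lemma part_le_normc (rho : C -> R) (x : C) :
  rho = @complex.Re R \/ rho = @complex.Im R -> `|rho x| <= ComplexField.Normc.normc x.
Proof.
case: x => a b [|] -> /=; rewrite -ler_sqr ?nnegrE ?sqrtr_ge0 // sqr_sqrtr ?addr_ge0 ?sqr_ge0 //.
  by rewrite real_normK ?num_real // lerDl sqr_ge0.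
by rewrite real_normK ?num_real // lerDr sqr_ge0.
Qed.

(** The phase is kept general because the Fourier transform and its inverse use opposite signs of
    the dot product. *)
Lemma cintegral_expi f (theta : n.-tuple rT -> R) (vt : 'rV[R]_n -> R) :
  measurable_fun setT theta -> (forall z, vt (row_of_tuple z) = theta z) ->
  (forall b, mun.-integrable setT (EFin \o cpart b f)) ->
  cintegral (fun x => expi (vt x) * f x) =
  Complex (\int[mun]_z (cpart true f z * cos (theta z)) -
           \int[mun]_z (cpart false f z * sin (theta z)))
          (\int[mun]_z (cpart false f z * cos (theta z)) +
           \int[mun]_z (cpart true f z * sin (theta z))).
Proof.
move=> mth vE fi.
have mp b : measurable_fun setT (cpart b f).
  by apply/measurable_EFinP; exact: measurable_int (fi b).
have i1 (b c : bool) : mun.-integrable setT (EFin \o (fun z => cpart b f z * trig_of c (theta z))).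
  have [cc cb] := cos_sin_bounded (trig_of_cases c).
  apply: le_integrable (fi b) => //.
    apply/measurable_EFinP; apply: measurable_funM => //.
    by apply: (measurableT_comp (f := trig_of c)) => //; exact: continuous_measurable_fun.
  by move=> z _ /=; rewrite lee_fin normrM -[leRHS]mulr1 ler_pM.
rewrite /cintegral; congr Complex.
  rewrite -RintegralB //; [|exact: (i1 true true)|exact: (i1 false false)].
  apply: eq_Rintegral => z _; rewrite vE /cpart; case: (f _) => a b /=; ring.
rewrite -RintegralD //; [|exact: (i1 false true)|exact: (i1 true false)].
apply: eq_Rintegral => z _; rewrite vE /cpart; case: (f _) => a b /=; ring.
Qed.

Lemma fourier_row f z : (forall b, mun.-integrable setT (EFin \o cpart b f)) ->
  fourier f (row_of_tuple z) =
  Complex (trig_transform cos (cpart true f) z + trig_transform sin (cpart false f) z)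
          (trig_transform cos (cpart false f) z - trig_transform sin (cpart true f) z).
Proof.
move=> fi.
have mth : measurable_fun setT (fun x : n.-tuple rT => - tdot x z).
  by apply: measurableT_comp => //;
    exact: (measurableT_comp (@measurable_tdot R n) (pair2_measurable z)).
rewrite /fourier (cintegral_expi mth) // => [|x]; last by rewrite dot_row_of_tuple.
have sN b : \int[mun]_x (cpart b f x * sin (- tdot x z)) = - trig_transform sin (cpart b f) z.
  rewrite -mulN1r -RintegralZl //.
    by apply: eq_Rintegral => x _; rewrite sinN; ring.
  apply: le_integrable (fi b) => //.
    apply/measurable_EFinP; apply: measurable_funM.
      by apply/measurable_EFinP; exact: measurable_int (fi b).
    by apply: measurable_trig_tdot; exact: continuous_sin.
  by move=> x _ /=; rewrite lee_fin normrM -[leRHS]mulr1 ler_pM // sin_max.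
have cN b : \int[mun]_x (cpart b f x * cos (- tdot x z)) = trig_transform cos (cpart b f) z.
  by apply: eq_Rintegral => x _; rewrite cosN.
by rewrite !sN !cN opprK.
Qed.

Lemma big_bool_pair (F : bool * bool -> R) :
  \sum_b F b = F (true, true) + F (true, false) + (F (false, true) + F (false, false)).
Proof.
rewrite (eq_bigr (fun b => F (b.1, b.2))); last by case.
by rewrite -(pair_bigA _ (fun b c => F (b, c))) /= !big_bool.
Qed.

(** Each part involves two of the four transforms; summing all four gives one bound for both
    parts. *)
Lemma fourier_part_le (rho : C -> R) f z :
  rho = @complex.Re R \/ rho = @complex.Im R ->
  (forall b, mun.-integrable setT (EFin \o cpart b f)) ->
  `|rho (fourier f (row_of_tuple z))| <=
    \sum_(b : bool * bool) `|trig_transform (trig_of b.1) (cpart b.2 f) z|.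
Proof.
move=> rh fi; rewrite fourier_row // big_bool_pair /=.
case: rh => -> /=.
  apply: le_trans (ler_normD _ _) _; rewrite -[leRHS]addrA lerD2l.
  by rewrite addrA lerDr addr_ge0.
apply: le_trans (ler_normB _ _) _.
have ar (a b c d : R) : 0 <= a -> 0 <= d -> b + c <= a + b + (c + d) by lra.
exact: ar.
Qed.

Lemma measurable_fourier_part (rho : C -> R) f :
  rho = @complex.Re R \/ rho = @complex.Im R ->
  (forall b, mun.-integrable setT (EFin \o cpart b f)) ->
  measurable_fun setT (fun z : n.-tuple rT => rho (fourier f (row_of_tuple z))).
Proof.
move=> rh fi; under eq_fun do rewrite fourier_row //.
have mt c b : measurable_fun setT (trig_transform (trig_of c) (cpart b f)).
  exact: measurable_trig_transform_tuple (trig_of_cases c) (fi b).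
case: rh => -> /=; [apply: measurable_funD|apply: measurable_funB].
- exact: (mt true true).
- exact: (mt false false).
- exact: (mt true false).
- exact: (mt false true).
Qed.

Lemma inv_fourier_row f x : (forall b, mun.-integrable setT (EFin \o cpart b f)) ->
  inv_fourier f (row_of_tuple x) = (((2 * pi) ^- n)%:C)%C *
  Complex (trig_transform cos (cpart true f) x - trig_transform sin (cpart false f) x)
          (trig_transform cos (cpart false f) x + trig_transform sin (cpart true f) x).
Proof.
move=> fi.
have mth : measurable_fun setT (fun z : n.-tuple rT => tdot z x).
  exact: (measurableT_comp (@measurable_tdot R n) (pair2_measurable x)).
rewrite /inv_fourier (cintegral_expi mth) // => z.
by rewrite dot_row_of_tuple tdotC.
Qed.

Lemma normc_inv_fourier_le f x : (forall b, mun.-integrable setT (EFin \o cpart b f)) ->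
  `|ComplexField.Normc.normc (inv_fourier f (row_of_tuple x))| <= (2 * pi) ^- n *
    \sum_(b : bool * bool) `|trig_transform (trig_of b.1) (cpart b.2 f) x|.
Proof.
move=> fi; rewrite ger0_norm; last by case: (inv_fourier _ _) => a b; exact: sqrtr_ge0.
apply: le_trans (normc_parts _) _; rewrite inv_fourier_row // big_bool_pair /=.
have p0 : 0 <= (2 * pi) ^- n :> R by rewrite invr_ge0 exprn_ge0 // mulr_ge0 // pi_ge0.
rewrite !mul0r subr0 addr0 !normrM (ger0_norm p0) -mulrDr; apply: ler_wpM2l => //.
apply: le_trans (lerD (ler_normB _ _) (ler_normD _ _)) _.
by rewrite le_eqVlt; apply/orP; left; apply/eqP; ring.
Qed.

Lemma measurable_normc_inv_fourier f : (forall b, mun.-integrable setT (EFin \o cpart b f)) ->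
  measurable_fun setT (fun x : n.-tuple rT =>
    ComplexField.Normc.normc (inv_fourier f (row_of_tuple x))).
Proof.
move=> fi; under eq_fun do rewrite inv_fourier_row //=.
have mt c b : measurable_fun setT (trig_transform (trig_of c) (cpart b f)).
  exact: measurable_trig_transform_tuple (trig_of_cases c) (fi b).
apply: (measurableT_comp (f := @Num.sqrt R)).
  by apply: continuous_measurable_fun; exact: sqrt_continuous.
have m1 := measurable_funB (mt true true) (mt false false).
have m2 := measurable_funD (mt true false) (mt false true).
apply: measurable_funD; apply: measurable_funX.
  apply: measurable_funB; first exact: measurable_funM.
  exact: measurable_funM.
apply: measurable_funD; first exact: measurable_funM.
exact: measurable_funM.
Qed.

Lemma schwartz_cpart f : schwartz f ->
  (forall b, mun.-integrable setT (EFin \o cpart b f)) /\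
  (forall (p : R) b, 0 < p -> (Lnorm mun p%:E (EFin \o cpart b f) <= Lpnorm p%:E f)%E).
Proof.
move=> sf.
have cR := schwartz_Re_continuous sf; have cI := schwartz_Im_continuous sf.
have mp b : measurable_fun setT (cpart b f).
  by case: b; [exact: (measurable_continuous_row cR)|exact: (measurable_continuous_row cI)].
split=> [b|p b p0].
  case: b; [apply: (schwartz_integrable sf cR)|apply: (schwartz_integrable sf cI)] => x.
    by apply: part_le_normc; left.
  by apply: part_le_normc; right.
apply: le_Lnorm => //.
  rewrite (_ : (fun z => _) = (fun z => Num.sqrt (cpart true f z ^+ 2 + cpart false f z ^+ 2))).
    apply: (measurableT_comp (f := @Num.sqrt R)).
      by apply: continuous_measurable_fun; exact: sqrt_continuous.
    by apply: measurable_funD; exact: measurable_funX.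
  by apply/funext => z; rewrite /cpart; case: (f _).
move=> z; apply: le_trans (ler_norm _).
by case: b; apply: part_le_normc; [left|right].
Qed.

End fourier_parts.

(** * The low-frequency estimate *)

Section plate_estimate.
Context {R : realType} (n : nat) (sigma : R).
Local Notation C := R[i].
Local Notation rT := (measurableTypeR R).
Local Notation mun := (@lebesgue_tuple R n).
Hypothesis s1 : sigma < 1.

Lemma measurable_powR_enorm (b : R) :
  measurable_fun setT (fun z : n.-tuple rT => enorm (row_of_tuple z) `^ b).
Proof. exact: (measurableT_comp (measurable_powR b) (@measurable_enorm R n)). Qed.

Lemma measurable_symbolS i j :
  measurable_fun setT (fun z : n.-tuple rT => symbolS sigma (row_of_tuple z) i j).
Proof.
under eq_fun do rewrite mxE [X in X + _]mxE [X in _ + X]mxE.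
apply: measurable_funD; apply: measurable_funM => //; last exact: measurable_powR_enorm.
by apply: measurable_funX; exact: measurable_enorm.
Qed.

Lemma measurable_symbolR i j :
  measurable_fun setT (fun z : n.-tuple rT => symbolR sigma (row_of_tuple z) i j).
Proof.
have me : measurable_fun setT (fun z : n.-tuple rT => enorm (row_of_tuple z) ^+ 2).
  by apply: measurable_funX; exact: measurable_enorm.
under eq_fun do rewrite mxE.
by case: i j => [[|[|[|//]]] hi] [[|[|[|//]]] hj] /=;
  first [exact: measurable_cst|exact: me|exact: measurable_powR_enorm].
Qed.

Lemma measurable_T1 i j :
  measurable_fun setT (fun z : n.-tuple rT => T1 sigma (row_of_tuple z) i j).
Proof.
under eq_fun do rewrite mxE [X in _ + X]mxE.
apply: measurable_funD => //; apply: measurable_funM => //.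
exact: measurable_powR_enorm.
Qed.

Lemma measurable_T1half i j :
  measurable_fun setT (fun z : n.-tuple rT => T1half sigma (row_of_tuple z) i j).
Proof.
under eq_fun do rewrite mxE [X in _ + X]mxE.
apply: measurable_funD => //; apply: measurable_funM => //.
exact: measurable_powR_enorm.
Qed.

Section data.
Context (F : 'I_3 -> 'rV[R]_n -> C) (rho : C -> R).
Hypotheses (rh : rho = @complex.Re R \/ rho = @complex.Im R)
  (Fi : forall k b, mun.-integrable setT (EFin \o cpart b (F k))).

Let rp : real_part rho.
Proof. by case: rh => ->; [exact: real_part_Re|exact: real_part_Im]. Qed.

(** The data are numbered F 0 = u1, F 1 = |D|^2 u0, F 2 = theta0. *)
Let w0 xi := initS (F 1) (F 0) (F 2%:R) xi.

Lemma initS_part_le z j : `|rho (w0 (row_of_tuple z) j 0)| <=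
  \sum_(k : 'I_3 * (bool * bool))
    `|trig_transform (trig_of k.2.1) (cpart k.2.2 (F k.1)) z|.
Proof.
have [rD rN _] := rp.
pose S k := \sum_(b : bool * bool) `|trig_transform (trig_of b.1) (cpart b.2 (F k)) z|.
have S0 k : 0 <= S k by exact: sumr_ge0.
have h k : `|rho (fourier (F k) (row_of_tuple z))| <= S k by exact: fourier_part_le.
rewrite -(pair_bigA _ (fun k (b : bool * bool) =>
  `|trig_transform (trig_of b.1) (cpart b.2 (F k)) z|)) /= sum3E -!/(S _).
have h0 := h 0; have h1 := h 1; have h2 := h 2%:R.
have S00 := S0 0; have S01 := S0 1; have S02 := S0 2%:R.
rewrite /w0 /initS mxE; case: j => [[|[|[|//]]] hj] /=.
- rewrite rD; apply: le_trans (ler_normD _ _) _.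
  by apply: le_trans (lerD h0 h1) _; rewrite lerDl.
- rewrite rD rN; apply: le_trans (ler_normB _ _) _.
  by apply: le_trans (lerD h0 h1) _; rewrite lerDl.
- by apply: le_trans h2 _; rewrite lerDr addr_ge0.
Qed.

Lemma measurable_initS_part j :
  measurable_fun setT (fun z : n.-tuple rT => rho (w0 (row_of_tuple z) j 0)).
Proof.
have [rD rN _] := rp; have m k := measurable_fourier_part rh (Fi k).
under eq_fun do rewrite mxE.
case: j => [[|[|[|//]]] hj] /=; last exact: m.
- by under eq_fun do rewrite rD; exact: measurable_funD.
- by under eq_fun do rewrite rD rN; exact: measurable_funB.
Qed.

Lemma measurable_initR_part j : measurable_fun setT (fun z : n.-tuple rT =>
  rho (initR sigma (F 1) (F 0) (F 2%:R) (row_of_tuple z) j 0)).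
Proof.
under eq_fun do rewrite real_part_mulmx //.
apply: measurable_sum => k; apply: measurable_funM; last exact: measurable_initS_part.
move: j k; apply: measurable_mulmx => [|i j //]; apply: measurable_mulmx;
  apply: measurable_invmx.
- exact: measurable_T1half.
- exact: measurable_T1.
Qed.

Lemma measurable_solution_part (M : 'rV[R]_n -> 'M[R]_3) (y0 : 'rV[R]_n -> 'cV[C]_3)
    (w : R -> 'rV[R]_n -> 'cV[C]_3) (t : R) :
  (forall i j, measurable_fun setT (fun z : n.-tuple rT => M (row_of_tuple z) i j)) ->
  (forall j, measurable_fun setT (fun z : n.-tuple rT => rho (y0 (row_of_tuple z) j 0))) ->
  (forall xi, solves_linear_ode (M xi) (y0 xi) (fun t => w t xi)) -> 0 <= t ->
  forall j, measurable_fun setT (fun z : n.-tuple rT => rho (w t (row_of_tuple z) j 0)).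
Proof.
move=> mM my sw t0 j.
have h xi := solves_linear_ode_part rh (sw xi).
apply: (@measurable_ode R _ _ 3 (fun z => M (row_of_tuple z))
  (fun (z : n.-tuple rT) j s => rho (w s (row_of_tuple z) j 0))) => //.
- move=> i; rewrite (_ : (fun z => _) = (fun z => rho (y0 (row_of_tuple z) i 0))) //.
  by apply/funext => z; have [-> _ _] := h (row_of_tuple z).
- by move=> z i; have [_ c _] := h (row_of_tuple z); exact: c.
- by move=> z s i sp; have [_ _ d] := h (row_of_tuple z); exact: d.
Qed.

Lemma measurable_difference_part (w wt : R -> 'rV[R]_n -> 'cV[C]_3) (t : R) :
  solutionS sigma (F 1) (F 0) (F 2%:R) w -> solutionR sigma (F 1) (F 0) (F 2%:R) wt ->
  0 <= t -> forall i, measurable_fun setT (fun z : n.-tuple rT =>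
    let xi := row_of_tuple z in
    rho ((w t xi - complexmx (T0 R *m T1 sigma xi *m T1half sigma xi) *m wt t xi) i 0)).
Proof.
move=> sw swt t0 i; have [rD rN _] := rp.
rewrite (_ : (fun z => _) = (fun z : n.-tuple rT => rho (w t (row_of_tuple z) i 0) -
   \sum_j (T0 R *m T1 sigma (row_of_tuple z) *m T1half sigma (row_of_tuple z)) i j
     * rho (wt t (row_of_tuple z) j 0))).
  apply: measurable_funB.
    apply: measurable_solution_part sw t0 i; first exact: measurable_symbolS.
    exact: measurable_initS_part.
  apply: measurable_sum => j; apply: measurable_funM; last first.
    apply: measurable_solution_part swt t0 j; first exact: measurable_symbolR.
    exact: measurable_initR_part.
  move: i j; apply: measurable_mulmx; last exact: measurable_T1half.
  apply: measurable_mulmx; [by move=> i j|exact: measurable_T1].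
by apply/funext => z /=; rewrite mxE rD [X in _ + rho X]mxE rN real_part_mulmx.
Qed.

End data.

Lemma cpartE (b : bool) :
  exists2 rho : C -> R, rho = @complex.Re R \/ rho = @complex.Im R &
    forall f (z : n.-tuple rT), cpart b f z = rho (f (row_of_tuple z)).
Proof. by case: b; [exists (@complex.Re R); [left|]|exists (@complex.Im R); [right|]]. Qed.

(** The first condition on [eps] keeps the support of chi in the unit ball, where [radial] is not
    truncated; the second gives d <= 1/4 there. *)
Lemma hnorm_cut_decay (eps : R) (chi : 'rV[R]_n -> R) (s p : R) (q : \bar R) :
  eps <= 1 -> eps `^ (2 - 2 * sigma) <= 4^-1 -> cutoff eps chi ->
  0 <= s -> 1 <= p -> p <= 2 -> (2%:E <= q)%E ->
  exists2 C0 : R, 0 <= C0 & forall (F : 'I_3 -> 'rV[R]_n -> C)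
      (w wt : R -> 'rV[R]_n -> 'cV[C]_3) (t L : R) (i : 'I_3),
  (forall k, schwartz (F k)) ->
  solutionS sigma (F 1) (F 0) (F 2%:R) w -> solutionR sigma (F 1) (F 0) (F 2%:R) wt ->
  0 <= t -> 0 <= L -> (forall k, Lpnorm p%:E (F k) <= L%:E)%E ->
  (hnorm_cut s q chi (fun xi => (w t xi -
      complexmx (T0 R *m T1 sigma xi *m T1half sigma xi) *m wt t xi) i 0)%R
   <= (C0 * (1 + t) `^ (- ((s + (2 - 2 * sigma)) / (4 - 2 * sigma)
        + n%:R / (4 - 2 * sigma) * (p^-1 - fine q^-1))) * L)%:E)%E.
Proof.
move=> eps1 epsg [chis chi01 chi0 _] sge0 p1 p2 q2.
have a0 : 0 <= s + (2 - 2 * sigma) by have := s1; lra.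
have k2 : 2 <= 4 - 2 * sigma by have := s1; lra.
have c0 : 0 < 8^-1 :> R by lra.
have pi0 : 0 <= (2 * pi) ^- n :> R by rewrite invr_ge0 exprn_ge0 // mulr_ge0 // pi_ge0.
(* 225 = 3 * 75: the pointwise bound has the constant 75, and each of the three initial components
   is bounded by the full sum of transforms. *)
have [C0 C00 HC] := @multiplier_estimate R n _ _ _ p 225 _ q (bool * bool)%type
  ('I_3 * (bool * bool))%type a0 c0 k2 p1 p2 (ler0n _ 225) pi0 q2.
exists C0 => // F w wt t L i sF sw swt t0 L0 FL.
have Fi k b := (schwartz_cpart (sF k)).1 b.
have p0 : 0 < p by lra.
pose V xi := (w t xi - complexmx (T0 R *m T1 sigma xi *m T1half sigma xi) *m wt t xi) i 0.
pose f xi := ((enorm xi `^ s * chi xi)%:C)%C * V xi.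
have mchi : measurable_fun setT (fun z : n.-tuple rT => chi (row_of_tuple z)).
  by apply: measurable_continuous_row => x; apply: differentiable_continuous; exact: (chis [::] x).
have fE b : exists2 rho : C -> R, rho = @complex.Re R \/ rho = @complex.Im R &
    forall z : n.-tuple rT, cpart b f z =
      enorm (row_of_tuple z) `^ s * chi (row_of_tuple z) * rho (V (row_of_tuple z)).
  have [rho rh rE] := cpartE b; exists rho => // z; rewrite rE.
  have [_ _ rM] : real_part rho by case: rh => ->; [exact: real_part_Re|exact: real_part_Im].
  exact: rM.
have mf b : measurable_fun setT (cpart b f).
  have [rho rh /funext ->] := fE b.
  apply: measurable_funM; last exact: (measurable_difference_part rh Fi sw swt t0 i).
  by apply: measurable_funM => //; exact: measurable_powR_enorm.
have hL (k : 'I_3 * (bool * bool)) :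
    (Lnorm mun p%:E (EFin \o cpart k.2.2 (F k.1)) <= L%:E)%E.
  by apply: le_trans (FL k.1); exact: (schwartz_cpart (sF k.1)).2.
have hG (b : bool * bool) z : `|cpart b.2 f z| <= 225 *
    radial (s + (2 - 2 * sigma)) 8^-1 (4 - 2 * sigma) t z *
    \sum_(k : 'I_3 * (bool * bool)) `|trig_transform (trig_of k.2.1) (cpart k.2.2 (F k.1)) z|.
  have [rho rh ->] := fE b.2.
  set S := \sum_k _; have S0 : 0 <= S by exact: sumr_ge0.
  set xi := row_of_tuple z.
  have [r1|r1] := ltP eps (enorm xi).
    by rewrite chi0 // mulr0 mul0r normr0 !mulr_ge0 ?radial_ge0.
  have g4 : gap sigma xi <= 4^-1.
    apply: le_trans epsg; apply: ler_powR2 => //; last exact: enorm_ge0.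
    by have := s1; lra.
  have /andP[ch0 ch1] := chi01 xi.
  rewrite /radial (le_trans r1 eps1) !normrM (ger0_norm ch0) (ger0_norm (powR_ge0 _ _)).
  (* Splitting off |xi|^s is legitimate at xi = 0 as well, since s + (2 - 2 sigma) > 0. *)
  rewrite powRD; last first.
    by apply/implyP => /eqP e; exfalso; have := s1; lra.
  have h := plate_part_bound s1 rh g4 sw swt t0 i; rewrite -/(V xi) in h.
  have hS : \sum_j `|rho (initS (F 1) (F 0) (F 2%:R) xi j 0)| <= 3 * S.
    apply: le_trans (ler_sum _ (fun j _ => initS_part_le rh Fi z j)) _.
    by rewrite sumr_const card_ord mulr_natl.
  have E0 : 0 <= 75 * gap sigma xi * expR (- (8^-1 * enorm xi `^ (4 - 2 * sigma) * t)).
    by rewrite !mulr_ge0 ?expR_ge0 ?powR_ge0.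
  have {}h := le_trans h (ler_wpM2l E0 hS).
  have rs0 : 0 <= enorm xi `^ s by exact: powR_ge0.
  apply: (@le_trans _ _ (enorm xi `^ s * `|rho (V xi)|)).
    by apply: ler_wpM2r => //; rewrite ler_piMr.
  apply: le_trans (ler_wpM2l rs0 h) _.
  by rewrite le_eqVlt; apply/orP; left; apply/eqP; rewrite /gap; ring.
have [fi] := HC t (fun k => trig_of k.2.1) (fun k => cpart k.2.2 (F k.1)) L t0
  (fun k => trig_of_cases k.2.1) (fun k => Fi k.1 k.2.2) L0 hL (fun b => trig_of b.1)
  (fun b => cpart b.2 f) (fun b => trig_of_cases b.1) (fun b => mf b.2) hG.
apply.
- by apply: measurable_normc_inv_fourier => b; exact: (fi (true, b)).
- by move=> x; apply: normc_inv_fourier_le => b; exact: (fi (true, b)).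
Qed.

End plate_estimate.

Theorem theorem5p2 (R : realType) (n : nat) (sigma : R)
    (n_ge1 : (1 <= n)%N) (sigma_ge0 : 0 <= sigma) (sigma_lt1 : sigma < 1) :
  exists2 eps0 : R, 0 < eps0 &
  forall (eps : R) (chi : 'rV[R]_n -> R),
    0 < eps -> eps <= eps0 -> cutoff eps chi ->
  forall (s p : R) (q : \bar R),
    0 <= s -> 1 <= p -> p <= 2 -> (2%:E <= q)%E ->
  exists2 C : R, 0 < C &
  forall (u0 : ('rV[R]_n -> R[i]) -> R[i]) (D2u0 u1 theta0 : 'rV[R]_n -> R[i])
         (w wt : R -> 'rV[R]_n -> 'cV[R[i]]_3),
    tempered_distribution u0 -> is_D2 u0 D2u0 ->
    schwartz D2u0 -> schwartz u1 -> schwartz theta0 ->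
    solutionS sigma D2u0 u1 theta0 w ->
    solutionR sigma D2u0 u1 theta0 wt ->
  forall t : R, 0 <= t ->
    (hnorm_cut_vec s q chi
       (fun xi => w t xi -
          complexmx (T0 R *m T1 sigma xi *m T1half sigma xi) *m wt t xi)%R
     <= (C * (1 + t) `^ (- (s / (4 - 2 * sigma))
                         - n%:R / (4 - 2 * sigma) * (p^-1 - fine (q^-1)%E)
                         - (1 - sigma) / (2 - sigma)))%R%:E
        * (Lpnorm p%:E D2u0 + Lpnorm p%:E u1 + Lpnorm p%:E theta0))%E.
Proof.
have k0 : 0 < 2 - 2 * sigma by lra.
(* This enforces |xi| <= 1 and d <= 1/4 on the support of the cut-off. *)
exists (Num.min 1 (4^-1 `^ (2 - 2 * sigma)^-1)).
  by rewrite lt_min ltr01 powR_gt0 // invr_gt0.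
move=> eps chi eps_gt0; rewrite le_min => /andP[eps1 epsg] cchi s p q s0 p1 p2 q2.
have {}epsg : eps `^ (2 - 2 * sigma) <= 4^-1.
  apply: le_trans (ler_powR2 (ltW k0) (ltW eps_gt0) epsg) _.
  by rewrite -powRrM mulVf ?gt_eqF // powRr1 // invr_ge0.
have [C0 C00 HC] := hnorm_cut_decay sigma_lt1 eps1 epsg cchi s0 p1 p2 q2.
(* The factor 3 counts the components of the vector; the summand 1 makes the constant positive even
   if [C0] is 0. *)
exists (3 * C0 + 1); first by rewrite ltr_wpDl // mulr_ge0.
move=> u0 D2u0 u1 theta0 w wt _ _ sD s1 sth sw swt t t0.
set e := - _ - _ - _; set S := (_ + _ + _)%E.
have T0 : 0 < (1 + t) `^ e by rewrite powR_gt0 // ltr_pwDl.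
have B0 : 0 < (3 * C0 + 1) * (1 + t) `^ e.
  by rewrite mulr_gt0 // ltr_wpDl // mulr_ge0.
have N0 f : (0 <= @Lpnorm R n p%:E f)%E by exact: Lnorm_ge0.
have S0 : (0 <= S)%E by rewrite !adde_ge0.
(* An infinite right-hand side makes the claim trivial; otherwise the sum of the norms is a real
   number and can serve as the bound L. *)
have [Soo|Sfin] := eqVneq S +oo%E; first by rewrite Soo gt0_muley ?lte_fin ?leey.
have SE : S = (fine S)%:E by rewrite fineK // ge0_fin_numE // ltey.
pose F : 'I_3 -> 'rV[R]_n -> R[i] := fun k => nth (fun _ => 0) [:: u1; D2u0; theta0] k.
have sF k : schwartz (F k) by case: k => [[|[|[|//]]] hk].
have L0 : 0 <= fine S by rewrite -lee_fin -SE.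
have FL k : (Lpnorm p%:E (F k) <= (fine S)%:E)%E.
  rewrite -SE /S; case: k => [[|[|[|//]]] hk] /=.
  - by rewrite (addeC (Lpnorm _ D2u0)) -addeA leeDl // adde_ge0.
  - by rewrite -addeA leeDl // adde_ge0.
  - by rewrite addeC leeDl // adde_ge0.
have H i := HC F w wt t (fine S) i sF sw swt t0 L0 FL.
rewrite /hnorm_cut_vec.
apply: le_trans (lee_sum _ (fun i _ => H i)) _.
rewrite SE -EFinM sumEFin lee_fin sumr_const card_ord.
(* (2 - 2 sigma) / (4 - 2 sigma) = (1 - sigma) / (2 - sigma). *)
have -> : - ((s + (2 - 2 * sigma)) / (4 - 2 * sigma) +
    n%:R / (4 - 2 * sigma) * (p^-1 - fine q^-1%E)) = e.
  rewrite /e; move: (fine _) => x; field.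
  by apply/and3P; split; rewrite gt_eqF //; lra.
rewrite -[leLHS]mulr_natl.
have -> : (3 * C0 + 1) * (1 + t) `^ e * fine S =
    3 * (C0 * (1 + t) `^ e * fine S) + (1 + t) `^ e * fine S by ring.
by rewrite lerDl mulr_ge0 // ltW.
Qed.
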